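(* Let $R$ be a connected graded associative algebra over a field $k$. Then $R$ is Artin-Schelter regular if and only if the Ext-algebra $\bigoplus_{i\in\mathbb Z}\mathrm{Ext}^i_R(k_R,k_R)$ is Frobenius.
   Context: A connected graded algebra is $R=\bigoplus_{n\ge0}R_n$ with $R_0=k$; the grading is called the Adams grading. $k_R$ denotes the trivial right module $R/R_{\ge1}$. Modules are graded; $(\Sigma M)_j=M_{j+1}$. For graded modules $M,N$, $\mathrm{Ext}^i_R(M,N)=\bigoplus_{j\in\mathbb Z}\mathrm{Ext}^i(M,\Sigma^jN)$, where the $\mathrm{Ext}^i$ on the right is computed in the category of graded right $R$-modules with degree-preserving maps. Left $R$-modules are regarded as $R^{\mathrm{op}}$-modules. $R$ is Gorenstein if $\mathrm{injdim}\,R_R=\mathrm{injdim}\,{}_RR<\infty$. $R$ is Artin-Schelter Gorenstein if $R$ is Gorenstein of injective dimension $d$ and there is an integer $l$ with $\mathrm{Ext}^i_R(k,R)\cong\mathrm{Ext}^i_{R^{\mathrm{op}}}(k,R)\cong 0$ for $i\ne d$ and $\cong\Sigma^l(k)$ for $i=d$. $R$ is Artin-Schelter regular if $R$ is Artin-Schelter Gorenstein and has global dimension $d$. The Ext-algebra $H=\bigoplus_i\mathrm{Ext}^i_R(k_R,k_R)$ is a $\mathbb Z\times\mathbb Z$-graded algebra (cohomological degree $i$, Adams degree) under the Yoneda product. A bigraded associative algebra $H$ is Frobenius if it is finite-dimensional over $k$ and there are integers $l,d$ and isomorphisms of bigraded left $H$-modules and of bigraded right $H$-modules $S^l\Sigma^d(H)\cong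 H^\sharp$, where $(SV)^i_j=V^{i+1}_j$, $(\Sigma V)^i_j=V^i_{j+1}$, and $(H^\sharp)^i_j=\mathrm{Hom}_k(H^{-i}_{-j},k)$. *)

(* Defs.v *)
From HB Require Import structures.
From mathcomp Require Import all_boot all_order all_algebra.
From mathcomp Require Import boolp classical_sets functions.
From mathcomp Require Import finmap monalg.
Set Implicit Arguments.
Unset Strict Implicit.
Unset Printing Implicit Defensive.
Import Order.TTheory GRing.Theory Num.Theory.
Local Open Scope ring_scope.

Section ConverseAlgebra.
Variables (k : fieldType) (A : algType k).
Definition cscale (c : k) (x : A^c) : A^c := (c *: (x : A)).
Lemma cscaleA c1 c2 x : cscale c1 (cscale c2 x) = cscale (c1 * c2) x.
Proof. exact: scalerA. Qed.
Lemma cscale1 : left_id 1 cscale.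
Proof. exact: scale1r. Qed.
Lemma cscaleDr : right_distributive cscale +%R.
Proof. exact: scalerDr. Qed.
Lemma cscaleDl x : {morph cscale^~ x : a b / a + b}.
Proof. by move=> a b; exact: scalerDl. Qed.
HB.instance Definition _ :=
  GRing.Zmodule_isLmodule.Build k A^c cscaleA cscale1 cscaleDr cscaleDl.
Lemma cscaleAl (c : k) (x y : A^c) : c *: (x * y) = c *: x * y.
Proof. exact: (@scalerAr k A c y x). Qed.
HB.instance Definition _ := GRing.Lmodule_isLalgebra.Build k A^c cscaleAl.
Lemma cscaleAr (c : k) (x y : A^c) : c *: (x * y) = x * (c *: y).
Proof. exact: (@scalerAl k A c y x). Qed.
HB.instance Definition _ := GRing.Lalgebra_isAlgebra.Build k A^c cscaleAr.
End ConverseAlgebra.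

Record subspace (K : pzRingType) (V : lmodType K) := Subspace {
  ss_set :> V -> Prop;
  ss0 : ss_set 0;
  ssP : forall a u v, ss_set u -> ss_set v -> ss_set (a *: u + v) }.

Section SubQuotient.
Variables (K : pzRingType) (V : lmodType K) (S : subspace V).

Definition ss_pred : {pred V} := fun x => `[< S x >].
Lemma ss_closed : submod_closed ss_pred.
Proof.
split; first by apply/asboolP; exact: ss0.
move=> a u v /asboolP Su /asboolP Sv; apply/asboolP; exact: ssP.
Qed.
HB.instance Definition _ := GRing.isSubmodClosed.Build K V ss_pred ss_closed.

Lemma ss_predP x : reflect (S x) (x \in ss_pred).
Proof. exact: asboolP. Qed.

Definition ss_sub := {x : V | x \in ss_pred}.
HB.instance Definition _ := [isSub of ss_sub for @sval _ _].
HB.instance Definition _ := [Choice of ss_sub by <:].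
HB.instance Definition _ := [SubChoice_isSubLmodule of ss_sub by <:].

Definition ss_quot := Quotient.quot ss_pred.
HB.instance Definition _ := GRing.Zmodule.on ss_quot.
Definition ss_pi (x : V) : ss_quot := (\pi_(Quotient.quot ss_pred) x)%qT.
Definition ss_repr (q : ss_quot) : V := repr (q : Quotient.quot ss_pred).

Lemma ss_reprK q : ss_pi (ss_repr q) = q.
Proof. exact: reprK. Qed.

Lemma ss_piE x y : ss_pi x = ss_pi y <-> S (x - y).
Proof.
split=> [/eqP|h]; first by rewrite -Quotient.idealrBE => /ss_predP.
by apply/eqP; rewrite -Quotient.idealrBE; apply/ss_predP.
Qed.

Lemma ss_piD x y : ss_pi (x + y) = ss_pi x + ss_pi y.
Proof. exact: Quotient.pi_add. Qed.

Definition ss_scale (a : K) (q : ss_quot) : ss_quot := ss_pi (a *: ss_repr q).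

Lemma ss_scale_pi a x : ss_scale a (ss_pi x) = ss_pi (a *: x).
Proof.
apply/ss_piE; rewrite -scalerBr; apply/ss_predP; apply: rpredZ.
by apply/ss_predP/ss_piE; rewrite ss_reprK.
Qed.

Fact ss_scaleA a b q : ss_scale a (ss_scale b q) = ss_scale (a * b) q.
Proof. by rewrite -[q]ss_reprK !ss_scale_pi scalerA. Qed.
Fact ss_scale1 : left_id 1 ss_scale.
Proof. by move=> q; rewrite -[q]ss_reprK !ss_scale_pi scale1r. Qed.
Fact ss_scaleDr : right_distributive ss_scale +%R.
Proof.
move=> a q r; rewrite -[q]ss_reprK -[r]ss_reprK -ss_piD !ss_scale_pi.
by rewrite scalerDr ss_piD.
Qed.
Fact ss_scaleDl q : {morph ss_scale^~ q : a b / a + b}.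
Proof.
by move=> a b; rewrite -[q]ss_reprK !ss_scale_pi scalerDl ss_piD.
Qed.
HB.instance Definition _ := GRing.Zmodule_isLmodule.Build K ss_quot
  ss_scaleA ss_scale1 ss_scaleDr ss_scaleDl.

Fact ss_pi_linear : linear ss_pi.
Proof. by move=> a x y; rewrite ss_piD -ss_scale_pi. Qed.
HB.instance Definition _ := GRing.isLinear.Build K V ss_quot _ ss_pi ss_pi_linear.
End SubQuotient.

(* [homology] is the subquotient [Z / (Z :&: B)]. *)
Section Homology.
Variables (K : pzRingType) (V : lmodType K) (Z B : subspace V).
Fact hom_bd0 : B (val (0 : ss_sub Z)).
Proof. by rewrite raddf0; exact: ss0. Qed.
Fact hom_bdP a (u v : ss_sub Z) :
  B (val u) -> B (val v) -> B (val (a *: u + v)).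
Proof. by move=> Bu Bv; rewrite linearP; exact: ssP. Qed.
Definition hom_bd : subspace (ss_sub Z) :=
  @Subspace K (ss_sub Z) (fun u => B (val u)) hom_bd0 hom_bdP.
Definition homology := ss_quot hom_bd.
HB.instance Definition _ := GRing.Lmodule.on homology.
Definition hclass : ss_sub Z -> homology := ss_pi hom_bd.
HB.instance Definition _ := GRing.Linear.on hclass.
End Homology.

Section Gradings.
Variable V : zmodType.
Implicit Type G : int -> V -> Prop.

(* [x] is a finite sum of elements taken from distinct [G j]. *)
Definition in_gr_sum G x : Prop := exists (s : seq int) (x_ : int -> V),
  [/\ uniq s, forall j, G j (x_ j) & x = \sum_(j <- s) x_ j].

Record is_grading G : Prop := IsGrading {
  gr_zero : forall j, G j 0;
  gr_sub : forall j x y, G j x -> G j y -> G j (x - y);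
  gr_span : forall x, in_gr_sum G x;
  gr_indep : forall (s : seq int) (x_ : int -> V), uniq s ->
    (forall j, G j (x_ j)) -> \sum_(j <- s) x_ j = 0 ->
    forall j, j \in s -> x_ j = 0 }.

Section InGrSum.
Variable G : int -> V -> Prop.
Hypothesis G0 : forall j, G j 0.
Hypothesis GB : forall j x y, G j x -> G j y -> G j (x - y).

Lemma gr_opp j x : G j x -> G j (- x).
Proof. by move=> Gx; rewrite -[- x]add0r; apply: GB. Qed.

Lemma gr_add j x y : G j x -> G j y -> G j (x + y).
Proof. by move=> Gx Gy; rewrite -[y]opprK; apply: GB => //; exact: gr_opp. Qed.

Lemma in_gr_sum0 : in_gr_sum G 0.
Proof. by exists [::], (fun=> 0); split=> //; rewrite big_nil. Qed.

Lemma in_gr_sum1 j x : G j x -> in_gr_sum G x.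
Proof.
move=> Gx; exists [:: j], (fun i => if i == j then x else 0); split=> //.
  by move=> i; case: eqP => // ->.
by rewrite big_seq1 eqxx.
Qed.

Lemma in_gr_sumD x y : in_gr_sum G x -> in_gr_sum G y -> in_gr_sum G (x + y).
Proof.
move=> [s [x_ [us xG ->]]] [t [y_ [ut yG ->]]].
exists (undup (s ++ t)), (fun j => (if j \in s then x_ j else 0) +
                                   (if j \in t then y_ j else 0)).
split; first exact: undup_uniq.
  by move=> j; apply: gr_add; case: ifP.
have E (w : seq int) (F : int -> V) : uniq w -> {subset w <= s ++ t} ->
    \sum_(j <- w) F j = \sum_(j <- undup (s ++ t)) (if j \in w then F j else 0).
  move=> uw sub; rewrite -big_mkcond /= -[RHS]big_filter; apply: perm_big.
  apply: uniq_perm => //; first by rewrite filter_uniq ?undup_uniq.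
  by move=> j; rewrite mem_filter mem_undup; case: (boolP (j \in w)) => // /sub ->.
by rewrite big_split /= -!E // => j jw; rewrite mem_cat jw ?orbT.
Qed.

Lemma in_gr_sum_sum (I : eqType) (r : seq I) (F : I -> V) :
  (forall i, i \in r -> in_gr_sum G (F i)) -> in_gr_sum G (\sum_(i <- r) F i).
Proof.
elim: r => [_|i r IH h]; first by rewrite big_nil; exact: in_gr_sum0.
rewrite big_cons; apply: in_gr_sumD; first by apply: h; rewrite inE eqxx.
by apply: IH => l lr; apply: h; rewrite inE lr orbT.
Qed.
End InGrSum.
End Gradings.

(* A connected graded algebra; the components of negative degree are zero.
   That [k -> R_0] is injective is automatic, rings being nonzero here. *)
Record connGrAlg (k : fieldType) := ConnGrAlg {
  ga_alg :> algType k;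
  ga_comp : int -> ga_alg -> Prop;
  ga_grading : is_grading ga_comp;
  ga_mul : forall i j x y, ga_comp i x -> ga_comp j y -> ga_comp (i + j) (x * y);
  ga_neg : forall j x, j < 0 -> ga_comp j x -> x = 0;
  ga_conn : forall x, ga_comp 0 x <-> exists c : k, x = c%:A }.

Section Opposite.
Variables (k : fieldType) (R : connGrAlg k).
Let comp (j : int) : (R : algType k)^c -> Prop := @ga_comp k R j.
Fact opp_mul i j x y : comp i x -> comp j y -> comp (i + j) (x * y).
Proof. by move=> Rx Ry; rewrite addrC; exact: (ga_mul Ry Rx). Qed.
Definition oppGrAlg : connGrAlg k :=
  @ConnGrAlg k (R : algType k)^c comp (ga_grading R) opp_mul
    (@ga_neg k R) (@ga_conn k R).
End Opposite.

(* Graded left modules. Graded right R-modules are graded left modules over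
   [oppGrAlg R], whose underlying ring is the converse ring of R. *)
Record grMod (k : fieldType) (R : connGrAlg k) := GrMod {
  gm_mod :> lmodType R;
  gm_comp : int -> gm_mod -> Prop;
  gm_grading : is_grading gm_comp;
  gm_act : forall i j (a : R) x,
    ga_comp i a -> gm_comp j x -> gm_comp (i + j) (a *: x) }.

Section GradedModules.
Variables (k : fieldType) (R : connGrAlg k).
Implicit Types (M N P : grMod R).

Definition graded_map M N (f : M -> N) : Prop :=
  forall j x, gm_comp j x -> gm_comp j (f x).

(* [(Sigma^j M)_i = M_(i + j)] *)
Section Shift.
Variables (j : int) (M : grMod R).
Let comp (i : int) (x : M) : Prop := gm_comp (i + j) x.
Fact shift_grading : is_grading comp.
Proof.
have [M0 MB Msp Mind] := gm_grading M.
split=> [i|i x y|x|s x_ us x_M sx i si]; first exact: M0.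
- exact: MB.
- have [s [x_ [us x_M ->]]] := Msp x.
  exists [seq i - j | i <- s], (fun i => x_ (i + j)); split=> //.
  + by rewrite map_inj_uniq //; exact: addIr.
  + by move=> i; exact: x_M.
  + by rewrite big_map; apply: eq_bigr => i _; rewrite subrK.
- have := Mind [seq i + j | i <- s] (fun i => x_ (i - j)).
  rewrite map_inj_uniq; last exact: addIr.
  move=> /(_ us) H; rewrite -[i](addrK j); apply: H.
  + by move=> l; have := x_M (l - j); rewrite /comp subrK.
  + by rewrite big_map -[RHS]sx; apply: eq_bigr => l _; rewrite addrK.
  + exact: map_f.
Qed.
Fact shift_act i l (a : R) x : ga_comp i a -> comp l x -> comp (i + l) (a *: x).
Proof. by move=> Ra Mx; rewrite /comp -addrA; exact: gm_act. Qed.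
Definition shift : grMod R := GrMod shift_grading shift_act.
End Shift.

Definition regMod : grMod R :=
  @GrMod k R (R : algType k)^o (@ga_comp k R) (ga_grading R) (@ga_mul k R).

Definition aug_comp (j : int) (a : (R : algType k)^o) : Prop :=
  ga_comp j a /\ (j <= 0 -> a = 0).

Fact aug_comp0 j : aug_comp j 0.
Proof. by split=> //; exact: gr_zero (ga_grading R) j. Qed.
Fact aug_compB j x y : aug_comp j x -> aug_comp j y -> aug_comp j (x - y).
Proof.
move=> [Rx x0] [Ry y0]; split; first exact: gr_sub (ga_grading R) _ _ _ Rx Ry.
by move=> j0; rewrite x0 // y0 // subrr.
Qed.
Fact aug_compM i j (a : R) x : ga_comp i a -> aug_comp j x ->
  aug_comp (i + j) (a *: x).
Proof.
move=> Ra [Rx x0]; split; first exact: ga_mul.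
have [i0|i0] := ltP i 0; first by rewrite (ga_neg i0 Ra) scale0r.
move=> ij; rewrite x0 ?scaler0 //; apply: le_trans ij; by rewrite lerDr.
Qed.

Fact aug_idealP a (u v : (R : algType k)^o) :
  in_gr_sum aug_comp u -> in_gr_sum aug_comp v -> in_gr_sum aug_comp (a *: u + v).
Proof.
move=> Su; apply: (in_gr_sumD aug_comp0 aug_compB).
have [s [a_ [_ aR ->]]] := gr_span (ga_grading R) a.
have [t [u_ [_ uR ->]]] := Su.
rewrite scaler_suml; apply: (in_gr_sum_sum aug_comp0 aug_compB) => j _.
rewrite scaler_sumr; apply: (in_gr_sum_sum aug_comp0 aug_compB) => l _.
apply: (@in_gr_sum1 _ _ aug_comp0 (j + l)); exact: aug_compM.
Qed.

Definition aug_ideal : subspace (R : algType k)^o :=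
  Subspace (in_gr_sum0 aug_comp0) aug_idealP.

(* The trivial module [R / R_(>= 1)], concentrated in degree 0. *)
Definition triv_comp (j : int) (x : ss_quot aug_ideal) : Prop := j != 0 -> x = 0.

Fact triv_grading : is_grading triv_comp.
Proof.
split=> [j _|j x y x0 y0 j0|x|s x_ us x0 sx j js] //.
- by rewrite x0 // y0 // subrr.
- apply: (@in_gr_sum1 _ _ _ 0) => // j _ //.
- have [j0|] := eqVneq j 0; last exact: x0.
  move: sx; rewrite (bigD1_seq j) //= big1 ?addr0 // => i ij.
  by apply: x0; rewrite -j0.
Qed.

Fact triv_act i j (a : R) x :
  ga_comp i a -> triv_comp j x -> triv_comp (i + j) (a *: x).
Proof.
move=> Ra x0; have [j0|/x0-> _] := eqVneq j 0; last exact: scaler0.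
rewrite /triv_comp {}j0 addr0 => i0; have [ilt|ige] := ltP i 0.
  by rewrite (ga_neg ilt Ra) scale0r.
rewrite -[x]ss_reprK -linearZ /= -[RHS](linear0 (ss_pi aug_ideal)).
apply/ss_piE; rewrite subr0 /=.
have [t [b_ [_ bR ->]]] := gr_span (ga_grading R) (ss_repr x).
rewrite scaler_sumr; apply: (in_gr_sum_sum aug_comp0 aug_compB) => l _.
have [l0|l0] := ltP l 0; first by rewrite (ga_neg l0 (bR l)) scaler0; exact: in_gr_sum0 aug_comp0.
apply: (@in_gr_sum1 _ _ aug_comp0 (i + l)); split; first exact: ga_mul.
move=> il; suff: i <= 0 by rewrite le_eqVlt (negPf i0) ltNge ige.
by apply: le_trans il; rewrite lerDl.
Qed.

Definition trivMod : grMod R := GrMod triv_grading triv_act.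

Definition surj (U V : Type) (f : U -> V) : Prop := forall y, exists x, f x = y.

Definition projective P : Prop :=
  forall M N (g : {linear M -> N}) (f : {linear P -> N}),
    graded_map g -> surj g -> graded_map f ->
    exists h : {linear P -> M}, graded_map h /\ forall x, g (h x) = f x.

Definition injective_mod (I : grMod R) : Prop :=
  forall M N (g : {linear M -> N}) (f : {linear M -> I}),
    graded_map g -> injective g -> graded_map f ->
    exists h : {linear N -> I}, graded_map h /\ forall x, h (g x) = f x.

(* Projective resolutions, as complexes indexed by the integers that vanish
   in negative degrees; as a differential [pr_d i j] is given for all [i] and
   [j], with [pr_d i j = 0] unless [i = j + 1]. *)
Record projRes M := ProjRes {
  pr_obj :> int -> grMod R;
  pr_d : forall i j, {linear pr_obj i -> pr_obj j};
  pr_aug : {linear pr_obj 0 -> M};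
  pr_d_graded : forall i j, graded_map (pr_d i j);
  pr_aug_graded : graded_map pr_aug;
  pr_shape : forall i j x, i <> j + 1 -> pr_d i j x = 0;
  pr_neg : forall i (x : pr_obj i), i < 0 -> x = 0;
  pr_projective : forall i, projective (pr_obj i);
  pr_aug_surj : surj pr_aug;
  pr_exact0 : forall x, pr_aug x = 0 <-> exists y, pr_d 1 0 y = x;
  pr_exact : forall i x, 0 < i ->
    pr_d i (i - 1) x = 0 <-> exists y, pr_d (i + 1) i y = x }.

Lemma gr_comp_uniq (V : zmodType) (G : int -> V -> Prop) (s : seq int)
  (x_ : int -> V) d y : is_grading G -> uniq s -> (forall j, G j (x_ j)) ->
  G d y -> \sum_(j <- s) x_ j = y -> y = if d \in s then x_ d else 0.
Proof.
move=> gG us xG yG sE.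
case: ifP => ds.
  have := gr_indep gG (x_ := fun j => x_ j - if j == d then y else 0) us.
  move=> /(_ _ _ d ds); rewrite eqxx => H; apply/esym/eqP; rewrite -subr_eq0.
  apply/eqP; apply: H.
    by move=> j; apply: gr_sub => //; case: eqP => [->|_] //; exact: gr_zero.
  rewrite sumrB sE (bigD1_seq d) //= eqxx big1 ?addr0 ?subrr //.
  by move=> j /negPf->.
have := gr_indep gG (s := d :: s) (x_ := fun j => (if j \in s then x_ j else 0)
   - if j == d then y else 0).
rewrite /= ds us => /(_ isT) H.
have : (if d \in s then x_ d else 0) - (if d == d then y else 0) = 0.
  apply: H; last by rewrite inE eqxx.
    move=> j; apply: gr_sub => //; first by case: ifP => _ //; exact: gr_zero.
    by case: eqP => [->|_] //; exact: gr_zero.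
  rewrite big_cons ds eqxx sub0r (eq_big_seq x_) ?sE ?addNr //.
  move=> j js; rewrite js; case: eqP => [jd|_]; last by rewrite subr0.
  by rewrite -jd js in ds.
by rewrite ds eqxx sub0r => /eqP; rewrite oppr_eq0 => /eqP.
Qed.

Lemma graded_preim M N (g : {linear M -> N}) d y :
  graded_map g -> gm_comp d (g y) -> exists x, gm_comp d x /\ g x = g y.
Proof.
move=> gg gy; have [s [y_ [us yM ys]]] := gr_span (gm_grading M) y.
have := @gr_comp_uniq _ _ s (fun j => g (y_ j)) d (g y) (gm_grading N) us.
rewrite {2}ys linear_sum => /(_ (fun j => gg _ _ (yM j)) gy erefl).
case: ifP => _ ->; first by exists (y_ d).
by exists 0; rewrite linear0; split=> //; exact: gr_zero (gm_grading M) d.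
Qed.

Section SubModule.
Variables (M : grMod R) (S : subspace M).
Hypothesis Shom :
  forall x, S x -> in_gr_sum (fun j y => gm_comp j y /\ S y) x.
Let comp (j : int) (x : ss_sub S) : Prop := gm_comp j (val x).
Fact sub_grading : is_grading comp.
Proof.
have [M0 MB Msp Mind] := gm_grading M.
split=> [j|j x y|x|s x_ us xM sx j js].
- by rewrite /comp raddf0.
- by rewrite /comp raddfB; exact: MB.
- have [s [y_ [us yM ys]]] := Shom (elimT (ss_predP _ _) (valP x)).
  exists s, (fun j => Sub (y_ j) (introT (ss_predP _ _) (yM j).2)); split=> //.
    by move=> j; exact: (yM j).1.
  by apply: val_inj; rewrite {1}ys raddf_sum.
- apply: val_inj; rewrite raddf0.
  apply: (Mind s (fun j => val (x_ j))) => //.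
  by rewrite -raddf_sum sx raddf0.
Qed.
Fact sub_act i j (a : R) x : ga_comp i a -> comp j x -> comp (i + j) (a *: x).
Proof. by move=> Ra Mx; rewrite /comp linearZ; exact: gm_act. Qed.
Definition subMod : grMod R := GrMod sub_grading sub_act.

Definition corestr P (f : P -> M) (fS : forall x, S (f x)) : P -> subMod :=
  fun x => Sub (f x) (introT (ss_predP _ _) (fS x)).
Lemma corestr_linear P (f : {linear P -> M}) fS : linear (@corestr P f fS).
Proof.
by move=> a x y; apply: val_inj; rewrite linearP /= linearP.
Qed.
Lemma val_corestr P (f : P -> M) fS x : val (@corestr P f fS x) = f x.
Proof. by []. Qed.
End SubModule.

Definition mklin (K : pzRingType) (U V : lmodType K) (f : U -> V)
  (hf : linear f) : {linear U -> V} :=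
  HB.pack f (GRing.isLinear.Build K U V _ f hf).

Section Image.
Variables (M N : grMod R) (g : {linear M -> N}) (gg : graded_map g).
Fact im0 : exists x, g x = 0.
Proof. by exists 0; rewrite linear0. Qed.
Fact imP a u v : (exists x, g x = u) -> (exists x, g x = v) ->
  exists x, g x = a *: u + v.
Proof. by move=> [x <-] [y <-]; exists (a *: x + y); rewrite linearP. Qed.
Definition im := @Subspace R N (fun y => exists x, g x = y) im0 imP.
Lemma im_hom y : im y -> in_gr_sum (fun j y => gm_comp j y /\ im y) y.
Proof.
move=> [x <-]; have [s [x_ [us xM ->]]] := gr_span (gm_grading M) x.
exists s, (fun j => g (x_ j)); split=> //; last by rewrite linear_sum.
by move=> j; split; [exact: gg | exists (x_ j)].
Qed.
End Image.

Lemma projective_lift P M N (g : {linear M -> N}) (f : {linear P -> N}) :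
  projective P -> graded_map g -> graded_map f ->
  (forall x, exists y, g y = f x) ->
  exists h : {linear P -> M}, graded_map h /\ forall x, g (h x) = f x.
Proof.
move=> prP gg gf fg.
pose I := subMod (im_hom gg).
have gS x : im g (g x) by exists x.
pose g' : {linear M -> I} := mklin (corestr_linear (im_hom gg) gS).
pose f' : {linear P -> I} := mklin (corestr_linear (im_hom gg) fg).
have gg' : graded_map g' by move=> j x; exact: gg.
have gf' : graded_map f' by move=> j x; exact: gf.
have [|h [gh hE]] := prP M I g' f' gg' _ gf'.
  move=> y; have /ss_predP[x xy] := valP y; exists x; apply: val_inj.
  by rewrite -xy.
by exists h; split=> // x; have /(congr1 val) := hE x.
Qed.
Section Zero.
Let comp (_ : int) (_ : 'rV[R]_0) : Prop := True.
Fact zero_grading : is_grading comp.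
Proof.
split=> // [x|s x_ _ _ _ j _]; last exact: thinmx0.
by exists [::], (fun=> 0); split=> //; rewrite big_nil thinmx0.
Qed.
Fact zero_act i j (a : R) x : ga_comp i a -> comp j x -> comp (i + j) (a *: x).
Proof. by []. Qed.
Definition zeroMod : grMod R := GrMod zero_grading zero_act.
End Zero.

(* The free graded module on a family of generators of degrees [dg]. *)
Section Free.
Variables (X : choiceType) (dg : X -> int).
Let comp (j : int) (f : {malg R[X]}) : Prop :=
  forall x, ga_comp (j - dg x) (mcoeff x f).

Let comp0 j : comp j 0.
Proof. by move=> x; rewrite mcoeff0; exact: gr_zero (ga_grading R) _. Qed.
Let compB j f g : comp j f -> comp j g -> comp j (f - g).
Proof.
by move=> hf hg x; rewrite mcoeffB; apply: gr_sub (ga_grading R) _ _ _ _ _.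
Qed.

Fact free_grading : is_grading comp.
Proof.
split=> // [f|s x_ us xR sx j js].
- rewrite [f]monalgE; apply: (in_gr_sum_sum comp0 compB) => x _.
  have [s [a_ [_ aR ->]]] := gr_span (ga_grading R) (mcoeff x f).
  rewrite raddf_sum; apply: (in_gr_sum_sum comp0 compB) => i _.
  apply: (@in_gr_sum1 _ _ comp0 (i + dg x)) => y; rewrite mcoeffU.
  case: eqP => [<-|_]; first by rewrite addrK mulr1n.
  exact: gr_zero (ga_grading R) _.
- apply/malgP => x; rewrite mcoeff0.
  have [_ _ _ H] := shift_grading (- dg x) regMod.
  apply: (H s (fun i => mcoeff x (x_ i))) => //; first by move=> i; exact: xR.
  by rewrite -raddf_sum sx raddf0.
Qed.

Fact free_act i j (a : R) f : ga_comp i a -> comp j f -> comp (i + j) (a *: f).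
Proof.
by move=> Ra hf x; rewrite mcoeffZ -addrA; exact: ga_mul.
Qed.

Definition freeMod : grMod R := GrMod free_grading free_act.

Section Ext.
Variables (M : grMod R) (phi : X -> M).
Definition free_ext (f : freeMod) : M :=
  \sum_(x <- msupp (f : {malg R[X]})) mcoeff x f *: phi x.

Lemma free_extw (d : {fset X}%fset) (f : freeMod) :
  (msupp (f : {malg R[X]}) `<=` d)%fset ->
  free_ext f = \sum_(x <- d) mcoeff x f *: phi x.
Proof.
move=> le; rewrite [LHS](big_fset_incl _ le) //= => x xd /mcoeff_outdom ->.
by rewrite scale0r.
Qed.

Lemma free_ext_linear : linear free_ext.
Proof.
move=> a f g.
pose d := (msupp (f : {malg R[X]}) `|` msupp (g : {malg R[X]}) `|`
           msupp (a *: f + g : {malg R[X]}))%fset.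
have lef : (msupp (f : {malg R[X]}) `<=` d)%fset.
  by apply/fsubsetP => x xf; rewrite /d !in_fsetU xf.
have leg : (msupp (g : {malg R[X]}) `<=` d)%fset.
  by apply/fsubsetP => x xf; rewrite /d !in_fsetU xf orbT.
have leh : (msupp (a *: f + g : {malg R[X]}) `<=` d)%fset.
  by apply/fsubsetP => x xf; rewrite /d !in_fsetU xf orbT.
rewrite (free_extw lef) (free_extw leg) (free_extw leh).
rewrite scaler_sumr -big_split /=; apply: eq_bigr => x _.
by rewrite mcoeffD mcoeffZ scalerDl scalerA.
Qed.

Definition free_lin : {linear freeMod -> M} := mklin free_ext_linear.

Lemma free_linU x : free_lin (mkmalgU x 1) = phi x.
Proof.
rewrite /= (@free_extw [fset x]%fset); last exact: msuppU_le.
by rewrite big_seq_fset1 mcoeffUU scale1r.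
Qed.

Hypothesis phi_graded : forall x, gm_comp (dg x) (phi x).
Lemma free_lin_graded : graded_map free_lin.
Proof.
move=> j f hf /=; rewrite /free_ext; elim/big_ind: _ => [|u v|x _].
- exact: gr_zero (gm_grading M) j.
- by apply: gr_add => [i|i y z]; [apply: gr_zero|apply: gr_sub]; exact: gm_grading.
- by rewrite -[j](subrK (dg x)); apply: gm_act.
Qed.
End Ext.

Lemma freeE (f : freeMod) :
  f = \sum_(x <- msupp (f : {malg R[X]})) mcoeff x f *: (mkmalgU x 1 : freeMod).
Proof.
rewrite [LHS](monalgE (f : {malg R[X]})); apply: eq_bigr => x _; apply/malgP => y.
by rewrite mcoeffZ !mcoeffU mulrnAr mulr1.
Qed.

Lemma freeU_comp x : @gm_comp k R freeMod (dg x) (mkmalgU x 1).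
Proof.
move=> y; rewrite mcoeffU; case: eqP => [<-|_].
  by rewrite subrr; apply/ga_conn; exists 1; rewrite scale1r.
exact: gr_zero (ga_grading R) _.
Qed.

Lemma free_projective : projective freeMod.
Proof.
move=> M N g f gg sg gf.
have /choice[phi Hphi] x : exists y, gm_comp (dg x) y /\ g y = f (mkmalgU x 1).
  have [y yE] := sg (f (mkmalgU x 1)); rewrite -yE; apply: graded_preim => //.
  by rewrite yE; apply: gf; exact: freeU_comp.
exists (free_lin phi); split; first by apply: free_lin_graded => x; case: (Hphi x).
move=> u; rewrite [X in f X]freeE linear_sum /= /free_ext linear_sum.
by apply: eq_bigr => x _; rewrite !linearZ /= (Hphi x).2.
Qed.
End Free.

(* The free module on the homogeneous elements of a kernel. *)
Section Cover.
Variables (M N : grMod R) (g : {linear M -> N}) (gg : graded_map g).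
Definition cover_gen :=
  {p : int * M | `[< gm_comp p.1 p.2 /\ g p.2 = 0 >]}.
HB.instance Definition _ := Choice.on cover_gen.
Definition cover : grMod R := freeMod (fun p : cover_gen => (val p).1).
Definition cover_map : {linear cover -> M} :=
  free_lin (fun p : cover_gen => (val p).1) (fun p : cover_gen => (val p).2).
Lemma cover_graded : graded_map cover_map.
Proof. by apply: free_lin_graded => -[p /= /asboolP[]]. Qed.

Lemma cover_exact x : g x = 0 <-> exists y, cover_map y = x.
Proof.
split=> [gx0|[y <-]]; last first.
  rewrite /= /free_ext linear_sum big1 // => -[p /= hp] _.
  by rewrite linearZ /=; have /asboolP[_ ->] := hp; rewrite scaler0.
have [s [x_ [us xM xE]]] := gr_span (gm_grading M) x.
have gx j : j \in s -> g (x_ j) = 0.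
  apply: (gr_indep (gm_grading N) (x_ := fun j => g (x_ j)) us).
    by move=> i; exact: gg.
  by rewrite -linear_sum -xE.
have /choice[y_ yE] j : exists y, j \in s -> cover_map y = x_ j.
  have [js|_] := boolP (j \in s); last by exists 0.
  have hp : `[< gm_comp (j, x_ j).1 (j, x_ j).2 /\ g (j, x_ j).2 = 0 >].
    by apply/asboolP; split=> //; exact: gx.
  exists (mkmalgU (Sub (j, x_ j) hp : cover_gen) 1) => _.
  by rewrite [LHS]free_linU.
exists (\sum_(j <- s) y_ j); rewrite linear_sum xE.
by apply: eq_big_seq => j js; exact: yE.
Qed.
End Cover.

End GradedModules.

Section Resolution.
Variables (k : fieldType) (R : connGrAlg k).

Record rstate := RState {
  rs_src : grMod R;
  rs_tgt : grMod R;
  rs_map : {linear rs_src -> rs_tgt};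
  rs_gr : graded_map rs_map }.

Definition rnext (st : rstate) : rstate :=
  RState (cover_graded (g := rs_map st)).

Variable M : grMod R.

Definition lin0 (U V : lmodType R) : {linear U -> V} := \0.

Definition rstart : rstate := RState (cover_graded (g := lin0 M M)).

Definition rs (n : nat) : rstate := iter n rnext rstart.
Definition rd (n : nat) : {linear rs_src (rs n.+1) -> rs_src (rs n)} :=
  rs_map (rs n.+1).

Lemma lin0_graded (N N' : grMod R) : graded_map (lin0 N N').
Proof. by move=> j x _; exact: gr_zero (gm_grading N') j. Qed.

Lemma rs_projective n : projective (rs_src (rs n)).
Proof. by case: n => [|n]; exact: free_projective. Qed.

Lemma rd_graded n : graded_map (rd n).
Proof. exact: rs_gr. Qed.

Lemma rd_exact0 x : rs_map rstart x = 0 <-> exists y, rd 0 y = x.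
Proof. exact: (@cover_exact k R _ _ (rs_map rstart) (@rs_gr rstart) x). Qed.

Lemma rd_exact n x : rd n x = 0 <-> exists y, rd n.+1 y = x.
Proof. exact: (@cover_exact k R _ _ (rd n) (@rd_graded n) x). Qed.

Lemma raug_surj : surj (rs_map rstart).
Proof. by move=> x; apply/(@cover_exact k R _ _ (lin0 M M) (@lin0_graded M M) x). Qed.

Definition res_obj (i : int) : grMod R :=
  match i with Posz n => rs_src (rs n) | Negz _ => zeroMod R end.

Definition rdd (n m : nat) : {linear rs_src (rs n) -> rs_src (rs m)} :=
  match n with
  | 0 => lin0 _ _
  | n'.+1 =>
    match n' =P m with
    | ReflectT e => ecast z {linear rs_src (rs n'.+1) -> rs_src (rs z)} e (rd n')
    | ReflectF _ => lin0 _ _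
    end
  end.

Definition res_d (i j : int) : {linear res_obj i -> res_obj j} :=
  match i, j with
  | Posz n, Posz m => rdd n m
  | _, _ => lin0 _ _
  end.

Lemma rddS n : rdd n.+1 n = rd n.
Proof. by rewrite /rdd; case: eqP => // e; rewrite (eq_axiomK e). Qed.

Lemma res_d_graded i j : graded_map (res_d i j).
Proof.
case: i j => [[|n]|n] [m|m] /=; try exact: lin0_graded.
case: eqP => e; last exact: lin0_graded.
by case: m / e; exact: rd_graded.
Qed.

Lemma res_shape i j x : i <> j + 1 -> res_d i j x = 0.
Proof.
case: i j x => [[|n]|n] [m|m] //= x ij; case: eqP => // e.
by case: ij; rewrite e -addn1 PoszD.
Qed.

Lemma res_neg i (x : res_obj i) : i < 0 -> x = 0.
Proof. by case: i x => [n|n] //= x _; exact: thinmx0. Qed.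

Lemma zero_projective : projective (zeroMod R).
Proof.
move=> A B g f _ _ _; exists (lin0 _ _); split; first exact: lin0_graded.
by move=> x; rewrite linear0 (thinmx0 x) linear0.
Qed.

Lemma res_projective i : projective (res_obj i).
Proof. case: i => n; [exact: rs_projective | exact: zero_projective]. Qed.

Lemma res_exact_gen (i j l : int) (x : res_obj i) : 0 < i -> i = j + 1 -> l = i + 1 ->
  res_d i j x = 0 <-> exists y, res_d l i y = x.
Proof.
case: i x => [[|n]|n] // x _.
rewrite -[X in Posz X = _]addn1 -[X in _ = Posz X + _]addn1.
move=> ij lE.
have {ij} -> : j = n by apply: (@addIr _ 1); rewrite -ij PoszD.
have {lE} -> : l = n.+2 by rewrite lE -PoszD !addn1.
by rewrite /= -/(rdd n.+1 n) -/(rdd n.+2 n.+1) !rddS; exact: rd_exact.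
Qed.

Definition res : projRes M.
Proof.
refine (@ProjRes k R M res_obj res_d (rs_map rstart) res_d_graded (@rs_gr rstart)
  res_shape res_neg res_projective raug_surj _ _).
- by move=> x; rewrite /= -/(rdd 1 0) rddS; exact: rd_exact0.
- by move=> i x i0; apply: res_exact_gen => //; rewrite subrK.
Qed.

End Resolution.

Section ResolutionTheory.
Variables (k : fieldType) (R : connGrAlg k) (N : grMod R) (Q : projRes N).

Lemma pr_exactE i j l (x : Q i) : 0 < i -> i = j + 1 -> l = i + 1 ->
  pr_d Q i j x = 0 <-> exists y, pr_d Q l i y = x.
Proof.
move=> i0 ij ->; have -> : j = i - 1 by rewrite ij addrK.
exact: pr_exact.
Qed.

Lemma pr_dd i j l x : pr_d Q j l (pr_d Q i j x) = 0.
Proof.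
have [jl|/eqP jl] := eqVneq j (l + 1); last by rewrite pr_shape.
have [ij|/eqP ij] := eqVneq i (j + 1); last by rewrite (pr_shape x ij) linear0.
have [j0|] := ltP 0 j; first by apply/(pr_exactE _ j0 jl ij); exists x.
by move=> j0; apply: pr_neg; rewrite -lezD1 -jl.
Qed.

Definition is_cocycle (L : grMod R) (i : int) (f : {linear Q i -> L}) : Prop :=
  forall x, f (pr_d Q (i + 1) i x) = 0.

Lemma pr_dE i l (L : grMod R) (f : {linear Q i -> L}) x :
  is_cocycle f -> l = i + 1 -> f (pr_d Q l i x) = 0.
Proof. by move=> fc le; move: x; rewrite {}le => x; exact: fc. Qed.

End ResolutionTheory.

(* Lifting a map [f : M -> Sigma^j N] in cohomological degree i to a map of
   resolutions. *)
Section Lifting.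
Variables (k : fieldType) (R : connGrAlg k).
Variables (M N : grMod R) (P : projRes M) (Q : projRes N).

(* [F n m] is only relevant for [n = m + i]. *)
Record is_lift (i j : int) (f : P i -> N)
    (F : forall n m : int, {linear P n -> Q m}) : Prop := IsLift {
  lift_graded : forall n m, n = m + i ->
    @graded_map k R (P n) (shift j (Q m)) (F n m);
  lift_aug : forall x, pr_aug Q (F i 0 x) = f x;
  lift_comm : forall n m x, n = m + i ->
    pr_d Q m (m - 1) (F n m x) = F (n - 1) (m - 1) (pr_d P n (n - 1) x) }.

Section LiftExists.
Variables (i j : int) (f : {linear P i -> N}).
Hypotheses (fg : @graded_map k R (P i) (shift j N) f) (fc : is_cocycle f).

Let liftable (m : nat) (G : forall n, {linear P n -> Q m}) : Prop :=
  forall n : int, n = m%:Z + i -> @graded_map k R (P n) (shift j (Q m)) (G n) /\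
  forall (n1 : int) x, n1 = n + 1 -> exists y, pr_d Q m.+1 m y = G n (pr_d P n1 n x).

Let lift0 : exists G : forall n, {linear P n -> Q 0},
  liftable G /\ forall x, pr_aug Q (G i x) = f x.
Proof.
have ag : @graded_map k R (shift j (Q 0)) (shift j N) (pr_aug Q).
  by move=> a x; exact: pr_aug_graded.
have [x|h [hg hE]] := @projective_lift k R (P i) (shift j (Q 0)) (shift j N)
  (pr_aug Q) f (@pr_projective k R M P i) ag fg; first exact: pr_aug_surj.
pose G n : {linear P n -> Q 0} :=
  match i =P n with
  | ReflectT e => ecast z {linear P z -> Q 0} e h
  | ReflectF _ => lin0 _ _
  end.
have Gi : G i = h by rewrite /G; case: eqP => // e; rewrite (eq_axiomK e).
exists G; split; last by move=> x; rewrite Gi; exact: hE.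
move=> n; rewrite add0r => ->; rewrite Gi; split=> // n1 x n1E.
by apply/pr_exact0; rewrite hE; exact: pr_dE fc n1E.
Qed.

Let liftS (m : nat) (G : forall n, {linear P n -> Q m}) : liftable G ->
  exists G' : forall n, {linear P n -> Q m.+1}, liftable G' /\
  forall (n n1 : int) x, n1 = n + 1 -> n = m%:Z + i ->
    pr_d Q m.+1 m (G' n1 x) = G n (pr_d P n1 n x).
Proof.
move=> GL.
have H (n1 : int) : exists h : {linear P n1 -> Q m.+1}, forall n : int,
    n1 = n + 1 -> n = m%:Z + i ->
    @graded_map k R (P n1) (shift j (Q m.+1)) h /\
    forall x, pr_d Q m.+1 m (h x) = G n (pr_d P n1 n x).
  have [n1E|n1E] := eqVneq n1 (m%:Z + i + 1); last first.
    by exists (lin0 _ _) => n n1n nm; rewrite n1n nm eqxx in n1E.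
  have [Gg Gim] := GL _ erefl.
  have dg : @graded_map k R (shift j (Q m.+1)) (shift j (Q m)) (pr_d Q m.+1 m).
    by move=> a x; exact: pr_d_graded.
  have Gdg : @graded_map k R (P n1) (shift j (Q m))
      (G (m%:Z + i) \o pr_d P n1 (m%:Z + i)).
    by move=> a x Px; apply: Gg; exact: pr_d_graded.
  have [x|h [hg hE]] := @projective_lift k R (P n1) (shift j (Q m.+1))
    (shift j (Q m)) (pr_d Q m.+1 m) (G (m%:Z + i) \o pr_d P n1 (m%:Z + i))
    (@pr_projective k R M P n1) dg Gdg; first exact: Gim.
  by exists h => n n1n ->; split.
exists (fun n1 => projT1 (cid (H n1))); split; last first.
  by move=> n n1 x n1n nm; case: cid => h /= /(_ _ n1n nm)[].
move=> n1 n1m.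
have n1E : n1 = m%:Z + i + 1 by rewrite n1m -addn1 PoszD addrAC.
case: cid => h /= /(_ _ n1E erefl)[hg hE]; split=> // n2 x n2E.
have mE : (m.+1 = m%:Z + 1 :> int) by rewrite -addn1 PoszD.
have mE' : (m.+2 = m.+1%:Z + 1 :> int) by rewrite -addn1 PoszD.
by apply/(pr_exactE _ _ mE mE') => //; rewrite hE pr_dd linear0.
Qed.

Lemma lift_ex : exists F, is_lift j f F.
Proof.
pose T m := {G : forall n, {linear P n -> Q (Posz m)} | liftable G}.
have [G0 [G0L G0E]] := lift0.
pose st m (G : T m) : T m.+1 :=
  exist _ (projT1 (cid (liftS (proj2_sig G))))
          (projT2 (cid (liftS (proj2_sig G)))).1.
pose G := fix G m : T m :=
  if m is m'.+1 then st m' (G m') else exist _ G0 G0L.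
exists (fun n m => match m with
  | Posz m => proj1_sig (G m) n
  | Negz m => lin0 _ _
  end).
split=> [n [m|m] nm|x|n m x nm].
- by have [] := proj2_sig (G m) n nm.
- exact: lin0_graded.
- exact: G0E.
- have m1E : m = m - 1 + 1 by rewrite subrK.
  have n1E : n = n - 1 + 1 by rewrite subrK.
  have n1m : n - 1 = m - 1 + i by rewrite nm addrAC.
  move: (m - 1) (n - 1) m1E n1E n1m => m' n' m1E n1E n1m.
  case: m' m1E n1m => [m'|m'] m1E n1m; last first.
    by rewrite [LHS]pr_neg // [RHS]pr_neg.
  have {m1E nm} mE : m = m'.+1 by rewrite m1E -PoszD addn1.
  rewrite {m}mE /=; case: cid => /= G' [_ ]; exact.
Qed.
End LiftExists.

Lemma lift_commE i j (f : P i -> N) F n m n' m' x : is_lift j f F ->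
  n = m + i -> m = m' + 1 -> n = n' + 1 ->
  pr_d Q m m' (F n m x) = F n' m' (pr_d P n n' x).
Proof.
move=> FL nm mE nE.
have -> : m' = m - 1 by rewrite mE addrK.
have -> : n' = n - 1 by rewrite nE addrK.
exact: (lift_comm FL _ nm).
Qed.

Section LiftHomotopy.
Variables (i j : int) (f : {linear P i -> N}) (F : forall n m, {linear P n -> Q m}).
Variable h : {linear P (i - 1) -> N}.
Hypotheses (FL : is_lift j f F) (hg : @graded_map k R (P (i - 1)) (shift j N) h).
Hypothesis fh : forall x, f x = h (pr_d P i (i - 1) x).

Let homot (m : nat) (S : forall n, {linear P n -> Q m}) : Prop :=
  (forall n : int, n + 1 = m%:Z + i -> @graded_map k R (P n) (shift j (Q m)) (S n))
  /\ forall (n n1 : int) x, n1 = m%:Z + i -> n1 = n + 1 ->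
    exists y, pr_d Q m.+1 m y = F n1 m x - S n (pr_d P n1 n x).

Let homot0 : exists S : forall n, {linear P n -> Q 0}, homot S.
Proof.
have ag : @graded_map k R (shift j (Q 0)) (shift j N) (pr_aug Q).
  by move=> a x; exact: pr_aug_graded.
have [x|s [sg sE]] := @projective_lift k R (P (i - 1)) (shift j (Q 0)) (shift j N)
  (pr_aug Q) h (@pr_projective k R M P (i - 1)) ag hg; first exact: pr_aug_surj.
pose G n : {linear P n -> Q 0} :=
  match i - 1 =P n with
  | ReflectT e => ecast z {linear P z -> Q 0} e s
  | ReflectF _ => lin0 _ _
  end.
have Gi : G (i - 1) = s by rewrite /G; case: eqP => // e; rewrite (eq_axiomK e).
exists G; split=> [n|n n1 x].
  by rewrite add0r => /(canRL (addrK 1)) ->; rewrite Gi.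
rewrite add0r => n1E nE; move: x; rewrite {}n1E in nE *.
have -> : n = i - 1 by rewrite nE addrK.
move=> x; rewrite Gi; apply/pr_exact0; rewrite linearB /= sE.
by rewrite (lift_aug FL) fh subrr.
Qed.

Let homotS (m : nat) (S : forall n, {linear P n -> Q m}) : homot S ->
  exists S' : forall n, {linear P n -> Q m.+1}, homot S'.
Proof.
move=> [Sg Sim].
have H (n1 : int) : exists s : {linear P n1 -> Q m.+1}, forall n : int,
    n1 = n + 1 -> n1 = m%:Z + i ->
    @graded_map k R (P n1) (shift j (Q m.+1)) s /\
    forall x, pr_d Q m.+1 m (s x) = F n1 m x - S n (pr_d P n1 n x).
  have [n1m|n1m] := eqVneq n1 (m%:Z + i); last first.
    by exists (lin0 _ _) => n _ n1E; rewrite n1E eqxx in n1m.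
  have n1E : n1 = n1 - 1 + 1 by rewrite subrK.
  have dg : @graded_map k R (shift j (Q m.+1)) (shift j (Q m)) (pr_d Q m.+1 m).
    by move=> a x; exact: pr_d_graded.
  have Gdg : @graded_map k R (P n1) (shift j (Q m))
      (F n1 m \- (S (n1 - 1) \o pr_d P n1 (n1 - 1))).
    move=> a x Px; apply: (gr_sub (gm_grading (Q m))).
      exact: (lift_graded FL n1m Px).
    by apply: Sg; [rewrite -n1E | exact: pr_d_graded].
  have [x|s [sg sE]] := @projective_lift k R (P n1) (shift j (Q m.+1))
    (shift j (Q m)) (pr_d Q m.+1 m) _ (@pr_projective k R M P n1) dg Gdg.
    by have := Sim _ _ x n1m n1E.
  exists s => n nE _; split=> // x; rewrite sE /=.
  by have -> : n1 - 1 = n by rewrite nE addrK.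
exists (fun n1 => projT1 (cid (H n1))); split=> [n1|n1 n2 x n2m n2E].
  move=> n1m; have n1E : n1 = n1 - 1 + 1 by rewrite subrK.
  case: cid => s /= /(_ _ n1E)[] //.
  by apply: (@addIr _ 1); rewrite n1m -addn1 PoszD addrAC.
have n1E : n1 = n1 - 1 + 1 by rewrite subrK.
have n1m : n1 = m%:Z + i.
  by apply: (@addIr _ 1); rewrite -n2E n2m -addn1 PoszD addrAC.
case: cid => s /= /(_ _ n1E n1m)[_ sE].
have mE : (m.+1 = m%:Z + 1 :> int) by rewrite -addn1 PoszD.
have mE' : (m.+2 = m.+1%:Z + 1 :> int) by rewrite -addn1 PoszD.
apply/(pr_exactE _ _ mE mE') => //; rewrite linearB /= sE pr_dd linear0 subr0.
by rewrite (lift_commE _ FL n2m mE n2E) subrr.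
Qed.

Lemma lift_homotopy (m : nat) : exists S : forall n, {linear P n -> Q m}, homot S.
Proof. by elim: m => [|m [S /homotS]]; first exact: homot0. Qed.

Variables (L : grMod R) (i1 j1 : int) (g : {linear Q i1 -> L}).
Hypotheses (gg : @graded_map k R (Q i1) (shift j1 L) g) (gc : is_cocycle g).

Lemma lift_cobound (n : int) : n = i1 + i -> exists s : {linear P (n - 1) -> L},
  @graded_map k R (P (n - 1)) (shift (j1 + j) L) s /\
  forall x, g (F n i1 x) = s (pr_d P n (n - 1) x).
Proof.
move=> nE; case: i1 nE g gg gc => [m|m] nE g' gg' gc'; last first.
  exists (lin0 _ _); split; first by move=> a x _; exact: gr_zero (gm_grading L) _.
  by move=> x; rewrite (pr_neg (F n (Negz m) x)) // linear0.
have [S [Sg Sim]] := lift_homotopy m.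
have n1 : n = n - 1 + 1 by rewrite subrK.
exists (g' \o S (n - 1)); split=> [a x Px|x].
  rewrite /= /shift /= [j1 + j]addrC addrA; apply: gg'.
  by apply: Sg => //; rewrite -n1.
have [y] := Sim _ _ x nE n1.
move=> /(congr1 g'); rewrite linearB /= => /esym/eqP.
rewrite (pr_dE y gc') ?subr_eq0 //; last by rewrite -PoszD addn1.
by move=> /eqP.
Qed.
End LiftHomotopy.

End Lifting.

(* An R-module as a k-vector space, with c acting as [c%:A]. *)
Section RestrictScalars.
Variables (k : fieldType) (R : connGrAlg k) (N : lmodType R).
Definition resk : Type := N.
HB.instance Definition _ := GRing.Zmodule.on resk.
Definition resk_scale (c : k) (x : resk) : resk := (c%:A : R) *: (x : N).
Fact resk_scaleA a b x : resk_scale a (resk_scale b x) = resk_scale (a * b) x.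
Proof. by rewrite /resk_scale scalerA -scalerAl mul1r scalerA. Qed.
Fact resk_scale1 : left_id 1 resk_scale.
Proof. by move=> x; rewrite /resk_scale !scale1r. Qed.
Fact resk_scaleDr : right_distributive resk_scale +%R.
Proof. by move=> a x y; rewrite /resk_scale scalerDr. Qed.
Fact resk_scaleDl x : {morph resk_scale^~ x : a b / a + b}.
Proof. by move=> a b; rewrite /resk_scale !scalerDl. Qed.
HB.instance Definition _ := GRing.Zmodule_isLmodule.Build k resk
  resk_scaleA resk_scale1 resk_scaleDr resk_scaleDl.
End RestrictScalars.

Section LinearCombination.
Variables (k : fieldType) (R : connGrAlg k) (U V : lmodType R).
Variables (c : k) (f g : {linear U -> V}).
Fact lcomb_linear : linear (fun x => (c%:A : R) *: f x + g x).
Proof.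
move=> a x y; rewrite !linearP !scalerDr !scalerA -scalerAl mul1r.
by rewrite -scalerAr mulr1 !addrA; congr (_ + _); rewrite addrAC.
Qed.
Definition lcomb : {linear U -> V} := mklin lcomb_linear.
End LinearCombination.

Lemma lcomb_graded (k : fieldType) (R : connGrAlg k) (M N : grMod R) (c : k)
  (f g : {linear M -> N}) : graded_map f -> graded_map g -> graded_map (lcomb c f g).
Proof.
move=> fg gg j x Mx /=.
apply: gr_add => [i|i y z||]; [exact: gr_zero (gm_grading N) i
  | exact: gr_sub (gm_grading N) _ _ _ | | exact: gg].
by rewrite -[j]add0r; apply: gm_act; [apply/ga_conn; exists c | exact: fg].
Qed.

Lemma lcomb_cocycle (k : fieldType) (R : connGrAlg k) (M N : grMod R)
  (P : projRes M) i (c : k) (f g : {linear P i -> N}) :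
  is_cocycle f -> is_cocycle g -> is_cocycle (lcomb c f g).
Proof. by move=> fc gc x /=; rewrite fc gc scaler0 addr0. Qed.

Section Ext.
Variables (k : fieldType) (R : connGrAlg k).

Section Resolved.
Variables (M : grMod R) (P : projRes M) (i : int) (N : grMod R).

Definition cocycle_set (f : P i -> resk N) : Prop :=
  exists g : {linear P i -> N}, [/\ graded_map g, is_cocycle g & forall x, f x = g x].
Fact cocycle0 : cocycle_set 0.
Proof.
exists (lin0 _ _); split=> //; exact: lin0_graded.
Qed.
Fact cocycleP (c : k) f f' :
  cocycle_set f -> cocycle_set f' -> cocycle_set (c *: f + f').
Proof.
move=> [g [gg gc fE]] [g' [gg' gc' fE']]; exists (lcomb c g g'); split.
- exact: lcomb_graded.
- exact: lcomb_cocycle.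
- by move=> x; rewrite /= -fE -fE'.
Qed.
Definition cocycles : subspace (P i -> resk N) := Subspace cocycle0 cocycleP.

Definition coboundary_set (f : P i -> resk N) : Prop :=
  exists h : {linear P (i - 1) -> N},
    graded_map h /\ forall x, f x = h (pr_d P i (i - 1) x).
Fact coboundary0 : coboundary_set 0.
Proof. by exists (lin0 _ _); split=> //; exact: lin0_graded. Qed.
Fact coboundaryP (c : k) f f' :
  coboundary_set f -> coboundary_set f' -> coboundary_set (c *: f + f').
Proof.
move=> [g [gg fE]] [g' [gg' fE']]; exists (lcomb c g g'); split.
- exact: lcomb_graded.
- by move=> x; rewrite /= -fE -fE'.
Qed.
Definition coboundaries : subspace (P i -> resk N) :=
  Subspace coboundary0 coboundaryP.

(* [H^i (Hom (P, N))] *)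
Definition cohom : lmodType k := homology cocycles coboundaries.
End Resolved.

Definition Ext (i : int) (M N : grMod R) : lmodType k := cohom (res M) i N.

(* The degree j component of [Ext^i_R(M, N)], for j in Z. *)
Definition ExtGr (i j : int) (M N : grMod R) : lmodType k := Ext i M (shift j N).
End Ext.

(* Associativity and the unit laws hold up to the identification of
   components of equal degrees; [bg_mul] takes the degree of the product with
   a proof that it is the sum of the degrees of the factors. *)
Record bigrAlg (k : fieldType) := BigrAlg {
  bg_comp :> int -> int -> lmodType k;
  bg_one : bg_comp 0 0;
  bg_mul : forall i1 j1 i2 j2 i j : int, i = i1 + i2 -> j = j1 + j2 ->
    bg_comp i1 j1 -> bg_comp i2 j2 -> bg_comp i j;
  bg_mulDl : forall i1 j1 i2 j2 i j (ei : i = i1 + i2) (ej : j = j1 + j2) c x x' y,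
    bg_mul ei ej (c *: x + x') y = c *: bg_mul ei ej x y + bg_mul ei ej x' y;
  bg_mulDr : forall i1 j1 i2 j2 i j (ei : i = i1 + i2) (ej : j = j1 + j2) c x y y',
    bg_mul ei ej x (c *: y + y') = c *: bg_mul ei ej x y + bg_mul ei ej x y';
  bg_mul1l : forall i j (ei : i = 0 + i) (ej : j = 0 + j) x,
    bg_mul ei ej bg_one x = x;
  bg_mul1r : forall i j (ei : i = i + 0) (ej : j = j + 0) x,
    bg_mul ei ej x bg_one = x;
  bg_mulA : forall i1 j1 i2 j2 i3 j3 i12 j12 i23 j23 i j
    (ei12 : i12 = i1 + i2) (ej12 : j12 = j1 + j2)
    (ei23 : i23 = i2 + i3) (ej23 : j23 = j2 + j3)
    (eil : i = i12 + i3) (ejl : j = j12 + j3)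
    (eir : i = i1 + i23) (ejr : j = j1 + j23) x y z,
    bg_mul eil ejl (bg_mul ei12 ej12 x y) z = bg_mul eir ejr x (bg_mul ei23 ej23 y z)
}.

Section ExtClasses.
Variables (k : fieldType) (R : connGrAlg k) (M : grMod R) (i : int) (N : grMod R).
Local Notation P := (res M).

(* [x] is the class of the cocycle [g]. *)
Definition is_class (g : P i -> N) (x : Ext i M N) : Prop :=
  exists gc : (g : P i -> resk N) \in ss_pred (cocycles P i N),
    x = hclass (coboundaries P i N) (exist _ g gc).

Lemma is_class_cocycle (g : {linear P i -> N}) x : is_class g x ->
  graded_map g /\ is_cocycle g.
Proof.
move=> [/ss_predP [g' [gg gc gE]] _]; split=> [j y Py|y].
  by rewrite gE; exact: gg.
by rewrite gE; exact: gc.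
Qed.

Lemma is_class_ex x : exists g : {linear P i -> N}, is_class g x.
Proof.
have := ss_reprK x; set f := ss_repr x => fx.
have /ss_predP[g [gg gc gE]] := valP f.
have gf : (g : P i -> resk N) = val f by apply/funext => y; rewrite gE.
exists g; rewrite /is_class gf; exists (valP f); rewrite -[LHS]fx.
by congr (ss_pi _ _); apply: val_inj.
Qed.

Lemma class_of (g : {linear P i -> N}) : graded_map g -> is_cocycle g ->
  exists x, is_class g x.
Proof.
move=> gg gc.
have h : (g : P i -> resk N) \in ss_pred (cocycles P i N).
  by apply/ss_predP; exists g.
by exists (hclass (coboundaries P i N) (exist _ (g : P i -> resk N) h)), h.
Qed.

Lemma is_class_eq (g g' : {linear P i -> N}) x x' :
  is_class g x -> is_class g' x' ->
  x = x' <-> exists h : {linear P (i - 1) -> N},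
    graded_map h /\ forall y, g y - g' y = h (pr_d P i (i - 1) y).
Proof.
move=> [gc ->] [gc' ->]; rewrite /hclass; split.
  by move=> /ss_piE [h [hg hE]]; exists h; split=> // y; rewrite -hE.
by move=> [h [hg hE]]; apply/ss_piE; exists h; split=> // y; rewrite -hE.
Qed.

Lemma is_class_lcomb c (g g' : {linear P i -> N}) x x' :
  is_class g x -> is_class g' x' -> is_class (lcomb c g g') (c *: x + x').
Proof.
move=> [gc ->] [gc' ->]; rewrite -linearP /=.
set u := c *: _ + _.
have h : (lcomb c g g' : P i -> resk N) \in ss_pred (cocycles P i N) := valP u.
by exists h; congr (hclass _ _); apply: val_inj.
Qed.

Lemma is_class_ext (g g' : P i -> N) x : g =1 g' -> is_class g x -> is_class g' x.
Proof. by move=> /funext ->. Qed.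
End ExtClasses.

Section Yoneda.
Variables (k : fieldType) (R : connGrAlg k) (M N L : grMod R).
Local Notation P := (res M).
Local Notation Q := (res N).

Section Product.
Variables (i1 j1 i2 j2 i j : int) (ei : i = i1 + i2) (ej : j = j1 + j2).

(* The product of the classes of [g : N -> Sigma^j1 L] and of
   [f : M -> Sigma^j2 N] is the class of [g \o F_i1], where [F] lifts [f] to a
   map of resolutions. *)
Definition is_yoneda (x : ExtGr i1 j1 N L) (y : ExtGr i2 j2 M N)
    (z : ExtGr i j M L) : Prop :=
  exists (g : {linear Q i1 -> L}) (f : {linear P i2 -> N})
         (F : forall n m : int, {linear P n -> Q m}),
    [/\ @is_class k R N i1 (shift j1 L) g x, @is_class k R M i2 (shift j2 N) f y,
        is_lift j2 f F & @is_class k R M i (shift j L) (g \o F i i1) z].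

Lemma comp_lift_class (g : {linear Q i1 -> L}) (f : {linear P i2 -> N}) F x :
  @is_class k R N i1 (shift j1 L) g x -> is_lift j2 f F ->
  exists z, @is_class k R M i (shift j L) (g \o F i i1) z.
Proof.
move=> gx FL.
have [gg gc] := @is_class_cocycle k R N i1 (shift j1 L) g x gx.
apply: (@class_of k R M i (shift j L) (g \o F i i1)) => [a u Pu|u].
  rewrite /= /shift /= ej [j1 + _]addrC addrA; apply: gg.
  exact: (lift_graded FL ei Pu).
rewrite /= -(@lift_commE _ _ _ _ _ _ _ _ _ _ (i + 1) (i1 + 1) _ _ _ FL) //.
by rewrite ei addrAC.
Qed.

Lemma yoneda_ex x y : exists z, is_yoneda x y z.
Proof.
have [g gx] := is_class_ex x; have [f fy] := is_class_ex y.
have [fg fc] := @is_class_cocycle k R M i2 (shift j2 N) f y fy.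
have [F FL] := @lift_ex k R M N P Q i2 j2 f fg fc.
have [z zE] := comp_lift_class gx FL.
by exists z, g, f, F.
Qed.

Lemma is_yoneda_uniq x y z z' : is_yoneda x y z -> is_yoneda x y z' -> z = z'.
Proof.
move=> [g [f [F [gx fy FL Hz]]]] [g' [f' [F' [gx' fy' FL' Hz']]]].
have [h [hg hE]] := (is_class_eq gx gx').1 erefl.
have [s [sg sE]] := (is_class_eq fy' fy).1 erefl.
have [gg' gc'] := @is_class_cocycle k R N i1 (shift j1 L) g' x gx'.
pose G n m : {linear P n -> Q m} := lcomb (-1) (F n m) (F' n m).
have GL : is_lift j2 (lcomb (-1) f f') G.
  split=> [n m nm|u|n m u nm].
  - apply: (@lcomb_graded k R (P n) (shift j2 (Q m))).
      exact: (lift_graded FL nm).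
    exact: (lift_graded FL' nm).
  - by rewrite /= linearP /= (lift_aug FL) (lift_aug FL').
  - by rewrite /= linearP /= (lift_comm FL _ nm) (lift_comm FL' _ nm).
have fE u : lcomb (-1) f f' u = s (pr_d P i2 (i2 - 1) u).
  by rewrite /= -sE scaleN1r scaleN1r addrC.
have [t [tg tE]] := lift_cobound GL sg fE gg' gc' ei.
apply/(is_class_eq Hz Hz').
exists (lcomb (-1) t (h \o F (i - 1) (i1 - 1))); split.
  apply: (@lcomb_graded k R (P (i - 1)) (shift j L)).
    by move=> a u Pu; rewrite ej; exact: tg.
  move=> a u Pu; rewrite /= /shift /= ej [j1 + _]addrC addrA; apply: hg.
  by apply: (lift_graded FL _ Pu); rewrite ei addrAC.
move=> u.
rewrite /= -(@lift_commE _ _ _ _ _ _ _ _ _ _ i i1 _ _ _ FL) ?subrK // -hE.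
by rewrite -tE /= linearP /= !scaleN1r opprD opprK [RHS]addrC addrA addrNK.
Qed.

Definition yoneda x y : ExtGr i j M L := projT1 (cid (yoneda_ex x y)).

Lemma yonedaP x y : is_yoneda x y (yoneda x y).
Proof. exact: projT2 (cid (yoneda_ex x y)). Qed.

Lemma yonedaE (g : {linear Q i1 -> L}) (f : {linear P i2 -> N}) F x y :
  @is_class k R N i1 (shift j1 L) g x -> @is_class k R M i2 (shift j2 N) f y ->
  is_lift j2 f F -> @is_class k R M i (shift j L) (g \o F i i1) (yoneda x y).
Proof.
move=> gx fy FL; have [z zE] := comp_lift_class gx FL.
suff <- : z = yoneda x y by [].
by apply: is_yoneda_uniq (yonedaP x y); exists g, f, F.
Qed.
End Product.
End Yoneda.

Section ExtAlgebra.
Variables (k : fieldType) (R : connGrAlg k) (M : grMod R).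
Local Notation P := (res M).
Local Notation H i j := (ExtGr i j M M).
Local Notation cls i j := (@is_class k R M i (shift j M)).

Lemma cls_ex i j x : exists g : {linear P i -> M}, cls i j g x.
Proof. exact: (@is_class_ex k R M i (shift j M) x). Qed.

Lemma cls_lcomb i j c (g g' : {linear P i -> M}) x x' :
  cls i j g x -> cls i j g' x' -> cls i j (lcomb c g g') (c *: x + x').
Proof. exact: (@is_class_lcomb k R M i (shift j M)). Qed.

Lemma is_class_uniq i j (g : {linear P i -> M}) x x' :
  cls i j g x -> cls i j g x' -> x = x'.
Proof.
move=> gx gx'; apply/(is_class_eq gx gx'); exists (lin0 _ _).
by split=> [|y]; [exact: lin0_graded | rewrite subrr].
Qed.

Lemma has_lift i j (f : {linear P i -> M}) x : cls i j f x ->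
  exists F : forall n m : int, {linear P n -> P m}, is_lift j f F.
Proof.
by move=> /(@is_class_cocycle k R M i (shift j M) f x)[fg fc]; exact: lift_ex.
Qed.

Fact one_cocycle :
  (pr_aug P : P 0 -> resk (shift 0 M)) \in ss_pred (cocycles P 0 (shift 0 M)).
Proof.
apply/ss_predP; exists (pr_aug P); split=> // [j x Px|x].
  by rewrite /= addr0; exact: pr_aug_graded.
by apply: (pr_exact0 (pr_d P 1 0 x)).2; exists x.
Qed.

Definition ext_one : H 0 0 :=
  hclass (coboundaries P 0 (shift 0 M)) (exist _ (pr_aug P : P 0 -> resk (shift 0 M)) one_cocycle).

Lemma ext_oneE : cls 0 0 (pr_aug P) ext_one.
Proof. by exists one_cocycle. Qed.

Definition ext_mul (i1 j1 i2 j2 i j : int) (ei : i = i1 + i2) (ej : j = j1 + j2)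
  (x : H i1 j1) (y : H i2 j2) : H i j := @yoneda k R M M M i1 j1 i2 j2 i j ei ej x y.

Fact ext_mulDl i1 j1 i2 j2 i j (ei : i = i1 + i2) (ej : j = j1 + j2) c x x' y :
  ext_mul ei ej (c *: x + x') y = c *: ext_mul ei ej x y + ext_mul ei ej x' y.
Proof.
have [g gx] := cls_ex x; have [g' gx'] := cls_ex x'.
have [f fy] := cls_ex y; have [F FL] := has_lift fy.
have := cls_lcomb c (yonedaE ei ej gx fy FL) (yonedaE ei ej gx' fy FL).
apply: is_class_uniq.
have := yonedaE ei ej (cls_lcomb c gx gx') fy FL.
by apply: is_class_ext => u.
Qed.

Fact ext_mulDr i1 j1 i2 j2 i j (ei : i = i1 + i2) (ej : j = j1 + j2) c x y y' :
  ext_mul ei ej x (c *: y + y') = c *: ext_mul ei ej x y + ext_mul ei ej x y'.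
Proof.
have [g gx] := cls_ex x.
have [f fy] := cls_ex y; have [F FL] := has_lift fy.
have [f' fy'] := cls_ex y'; have [F' FL'] := has_lift fy'.
have GL : is_lift (Q := P) j2 (lcomb c f f') (fun n m => lcomb c (F n m) (F' n m)).
  split=> [n m nm|u|n m u nm].
  - apply: (@lcomb_graded k R (P n) (shift j2 (P m))).
      exact: (lift_graded FL nm).
    exact: (lift_graded FL' nm).
  - by rewrite /= linearP /= (lift_aug FL) (lift_aug FL').
  - by rewrite /= linearP /= (lift_comm FL _ nm) (lift_comm FL' _ nm).
have := cls_lcomb c (yonedaE ei ej gx fy FL) (yonedaE ei ej gx fy' FL').
apply: is_class_uniq.
have := yonedaE ei ej gx (cls_lcomb c fy fy') GL.
by apply: is_class_ext => u; rewrite /= linearP.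
Qed.

Fact ext_mul1l i j (ei : i = 0 + i) (ej : j = 0 + j) x :
  ext_mul ei ej ext_one x = x.
Proof.
have [f fx] := cls_ex x; have [F FL] := has_lift fx.
apply: is_class_uniq (fx).
have := yonedaE ei ej ext_oneE fx FL.
by apply: is_class_ext => u; exact: lift_aug FL u.
Qed.

Definition lin_id (n m : int) : {linear P n -> P m} :=
  match n =P m with
  | ReflectT e => ecast z {linear P n -> P z} e idfun
  | ReflectF _ => lin0 _ _
  end.
Lemma lin_idE n x : lin_id n n x = x.
Proof. by rewrite /lin_id; case: eqP => // e; rewrite (eq_axiomK e). Qed.

Lemma lin_id_lift : is_lift 0 (pr_aug P) lin_id.
Proof.
split=> [n m|x|n m x]; last 2 first.
- by rewrite lin_idE.
- by rewrite addr0 => nm; move: x; rewrite {}nm => x; rewrite !lin_idE.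
by rewrite addr0 => -> a x; rewrite lin_idE /= addr0.
Qed.

Fact ext_mul1r i j (ei : i = i + 0) (ej : j = j + 0) x :
  ext_mul ei ej x ext_one = x.
Proof.
have [f fx] := cls_ex x.
apply: is_class_uniq (fx).
have := yonedaE ei ej fx ext_oneE lin_id_lift.
by apply: is_class_ext => u; rewrite /= lin_idE.
Qed.

Fact ext_mulA i1 j1 i2 j2 i3 j3 i12 j12 i23 j23 i j
    (ei12 : i12 = i1 + i2) (ej12 : j12 = j1 + j2)
    (ei23 : i23 = i2 + i3) (ej23 : j23 = j2 + j3)
    (eil : i = i12 + i3) (ejl : j = j12 + j3)
    (eir : i = i1 + i23) (ejr : j = j1 + j23) x y z :
  ext_mul eil ejl (ext_mul ei12 ej12 x y) z = ext_mul eir ejr x (ext_mul ei23 ej23 y z).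
Proof.
have [g gx] := cls_ex x.
have [h hy] := cls_ex y; have [G GL] := has_lift hy.
have [f fz] := cls_ex z; have [F FL] := has_lift fz.
have c1 := yonedaE eil ejl (yonedaE ei12 ej12 gx hy GL) fz FL.
have c2 := yonedaE ei23 ej23 hy fz FL.
have GFL : is_lift j23 (h \o F i23 i2) (fun n m => G (m + i2) m \o F n (m + i2)).
  split=> [n m nm a u Pu|u|n m u nm].
  - rewrite /= ej23 [j2 + _]addrC addrA; apply: (lift_graded GL) => //.
    by apply: (lift_graded FL) => //; rewrite nm ei23 addrA.
  - rewrite /=; move: (0 + i2) (add0r i2) => w ->; exact: lift_aug GL _.
  - have nm' : n = m + i2 + i3 by rewrite nm ei23 addrA.
    have mE : m = m - 1 + 1 by rewrite subrK.
    have mE' : m + i2 = m - 1 + i2 + 1 by rewrite [RHS]addrAC subrK.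
    have nE : n = n - 1 + 1 by rewrite subrK.
    by rewrite /= (lift_commE _ GL erefl mE mE') (lift_commE _ FL nm' mE' nE).
have c3 := yonedaE eir ejr gx c2 GFL.
apply: (is_class_uniq c1); move: c3; rewrite -ei12.
by apply: is_class_ext.
Qed.

Definition ExtAlg : bigrAlg k :=
  BigrAlg ext_mulDl ext_mulDr ext_mul1l ext_mul1r ext_mulA.
End ExtAlgebra.

Section Frobenius.
Variables (k : fieldType) (H : bigrAlg k).

Definition findim (V : lmodType k) : Prop :=
  exists (n : nat) (b : 'I_n -> V), forall x, exists c : 'I_n -> k,
    x = \sum_i c i *: b i.

(* The total space [\oplus_(i, j) H i j] is finite-dimensional. *)
Definition bg_findim : Prop :=
  (forall i j, findim (H i j)) /\
  exists n : nat, forall i j (x : H i j), (n < `|i|)%N || (n < `|j|)%N -> x = 0.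

(* [(H^#)^i_j = Hom_k (H^(-i)_(-j), k)] *)
Definition gdual (i j : int) : Type := {linear H (- i) (- j) -> k^o}.

(* [phi] is defined on [(S^l Sigma^d H)^i_j = H^(i + l)_(j + d)]. *)
Definition linear_iso (l d : int) (phi : forall i j, H (i + l) (j + d) -> gdual i j)
    : Prop :=
  (forall i j c x x' y,
     phi i j (c *: x + x') y = c * phi i j x y + phi i j x' y) /\
  forall i j, bijective (phi i j).

(* The actions on the dual are [(h f)(y) = f (y h)] and [(f h)(y) = f (h y)],
   and H acts on its shifts through its product. Koszul signs in the shifts or
   in the dual would only multiply the action of the elements of degree (a, b)
   by a sign that depends on the parity of a, which gives an isomorphic
   module. *)
Definition left_linear (l d : int) (phi : forall i j, H (i + l) (j + d) -> gdual i j)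
    : Prop :=
  forall (a b i j : int) (h : H a b) (x : H (i + l) (j + d))
    (y : H (- (a + i)) (- (b + j)))
    (ei : a + i + l = a + (i + l)) (ej : b + j + d = b + (j + d))
    (ei' : - i = - (a + i) + a) (ej' : - j = - (b + j) + b),
  phi (a + i) (b + j) (bg_mul ei ej h x) y = phi i j x (bg_mul ei' ej' y h).

Definition right_linear (l d : int) (phi : forall i j, H (i + l) (j + d) -> gdual i j)
    : Prop :=
  forall (a b i j : int) (h : H a b) (x : H (i + l) (j + d))
    (y : H (- (i + a)) (- (j + b)))
    (ei : i + a + l = i + l + a) (ej : j + b + d = j + d + b)
    (ei' : - i = a + - (i + a)) (ej' : - j = b + - (j + b)),
  phi (i + a) (j + b) (bg_mul ei ej x h) y = phi i j x (bg_mul ei' ej' h y).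

Definition Frobenius : Prop :=
  bg_findim /\ exists l d : int,
    (exists phi, @linear_iso l d phi /\ left_linear phi) /\
    (exists psi, @linear_iso l d psi /\ right_linear psi).
End Frobenius.

Section Dimensions.
Variables (k : fieldType) (R : connGrAlg k).

Record injRes (M : grMod R) := InjRes {
  ir_obj :> nat -> grMod R;
  ir_d : forall i, {linear ir_obj i -> ir_obj i.+1};
  ir_aug : {linear M -> ir_obj 0};
  ir_d_graded : forall i, graded_map (ir_d i);
  ir_aug_graded : graded_map ir_aug;
  ir_injective : forall i, injective_mod (ir_obj i);
  ir_aug_inj : injective ir_aug;
  ir_exact0 : forall x, ir_d 0 x = 0 <-> exists y, ir_aug y = x;
  ir_exact : forall i x, ir_d i.+1 x = 0 <-> exists y, ir_d i y = x }.

(* Injective and global dimensions are those of the category of graded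
   modules. *)
Definition injdim_le (M : grMod R) (n : nat) : Prop :=
  exists I : injRes M, forall i (x : I i), (n < i)%N -> x = 0.

Definition injdim_is (M : grMod R) (n : nat) : Prop :=
  injdim_le M n /\ forall m, injdim_le M m -> (n <= m)%N.

Definition projdim_le (M : grMod R) (n : nat) : Prop :=
  exists P : projRes M, forall i (x : P i), n%:Z < i -> x = 0.

Definition gldim_is (n : nat) : Prop :=
  (forall M, projdim_le M n) /\
  forall m, (forall M, projdim_le M m) -> (n <= m)%N.
End Dimensions.

Section ArtinSchelter.
Variable k : fieldType.

Definition gr_iso (V W : int -> lmodType k) : Prop :=
  exists phi : forall j, {linear V j -> W j}, forall j, bijective (phi j).

Definition gr_shift (l : int) (V : int -> lmodType k) : int -> lmodType k :=
  fun j => V (j + l).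

Definition gr_k : int -> lmodType k := fun j => 'rV[k]_(j == 0).
Definition gr_0 : int -> lmodType k := fun _ => 'rV[k]_0.

(* As R_(>= 1) acts by zero on a graded module concentrated in one degree, an
   isomorphism of graded vector spaces with [Sigma^l k] is one of modules. *)
Definition ext_condition (R : connGrAlg k) (d : nat) (l : int) : Prop :=
  forall i : int, gr_iso (fun j => ExtGr i j (trivMod R) (regMod R))
                         (if i == d%:Z then gr_shift l gr_k else gr_0).

Variable R : connGrAlg k.

Definition Gorenstein (d : nat) : Prop :=
  injdim_is (regMod (oppGrAlg R)) d /\ injdim_is (regMod R) d.

Definition ASGorenstein (d : nat) : Prop :=
  Gorenstein d /\
  exists l : int, ext_condition (oppGrAlg R) d l /\ ext_condition R d l.

Definition ASregular : Prop :=
  exists d, ASGorenstein d /\ gldim_is (oppGrAlg R) d /\ gldim_is R d.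
End ArtinSchelter.

(* Main.v *)
From HB Require Import structures.
Require Import Defs.
From mathcomp Require Import all_boot all_order all_algebra.
From mathcomp Require Import boolp classical_sets functions.
From mathcomp Require Import finmap monalg.
From mathcomp Require Import zify ring.
Set Implicit Arguments.
Unset Strict Implicit.
Unset Printing Implicit Defensive.
Import Order.TTheory GRing.Theory Num.Theory.
Local Open Scope ring_scope.

(** Let [B] be the opposite algebra, so that right modules are left [B]-modules,
    and let [P] be the minimal free resolution of the trivial [B]-module, with
    generating sets [X i].  By minimality a class of degree [j] in Ext^i(k, k) is
    a functional on the generators of [P i] of degree [- j], and the product of
    the classes of [g] and [f] is the class of [g F], for a chain map [F] lifting
    [f] ([rep_mul]).

    Both sides of the equivalence say the same thing about [P]: the sets [X i] are
    finite, [P] ends with a free module [P d] on one generator [e], and the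
    complex Hom(P, B) is exact except at its end, Hom(P d, B), where its homology is
    [k] ([dual_exact]).

    From the Frobenius property: the isomorphism of the Ext-algebra with its dual
    gives the form whose value on classes [y], [x] of complementary degrees is the value at
    [e] of the product [y x].  Its nondegeneracy means that a chain map is
    determined, up to homotopy, by its value at [e] modulo [B_(>= 1)], and that
    this value is arbitrary ([frob_inj], [frob_surj]).  A cocycle from [P i] to
    [B] can be seen as a chain map into [P 0], and comparing it with the chain
    maps of given value at [e] shows, by descending induction on [i] and
    induction on the degree, that it is a coboundary
    ([dual_exact_of_pairing]).

    To regularity: the exactness of Hom(P, B) determines Ext(k, B).  It also bounds
    the minimal free resolution [F] of any cyclic module [B / K]: a cocycle from
    [P d] to [F d] with values in boundaries is a coboundary of a cochain with
    values in boundaries, and as the coefficients of the differential of [P] have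
    positive degree, the boundaries in [F d] vanish ([syz_end]).  By Baer's
    criterion the [d]-th cosyzygy of any module is then injective
    ([cosyz_injective]), which bounds both the injective and the projective
    dimensions by [d].  Finally Hom(P, B) is
    itself a minimal free resolution, over the opposite ring, and its dual is [P]
    ([dualRes], [dualRes_exact]); so the other side needs no new argument.

    From regularity: the exactness of Hom(P, B) is a restatement of the condition
    on Ext(k, B) ([gor_exact]).  It makes [B_(>= 1)] generated by the finitely many
    entries of the last differential, hence [B] locally finite, and it bounds
    the degrees of the generators of [P] by that of [e]; so the [X i] are finite
    ([gor_finite]).  Homotopies, built with the exactness of Hom(P, B), then show
    that the form above is nondegenerate ([pairing_inj_of_dual],
    [pairing_surj_of_dual]), and being associative it defines the two Frobenius
    isomorphisms ([Frobenius_of_form]). *)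

(** * Linear algebra *)

Section Subspaces.
Variables (K : pzRingType) (V : lmodType K) (S : subspace V).

Lemma ss_sum (I : eqType) (r : seq I) (F : I -> V) :
  (forall i, i \in r -> S (F i)) -> S (\sum_(i <- r) F i).
Proof.
elim: r => [_|i r IH h]; first by rewrite big_nil; exact: ss0.
rewrite big_cons -[F i]scale1r; apply: ssP; first by apply: h; rewrite inE eqxx.
by apply: IH => j jr; apply: h; rewrite inE jr orbT.
Qed.

Lemma ssZ a u : S u -> S (a *: u).
Proof. by move=> Su; rewrite -[_ *: _]addr0; apply: ssP => //; exact: ss0. Qed.
Lemma ssB u v : S u -> S v -> S (u - v).
Proof. by move=> Su Sv; rewrite addrC -scaleN1r; apply: ssP. Qed.
Lemma ssD u v : S u -> S v -> S (u + v).
Proof. by move=> Su Sv; rewrite -[u]scale1r; apply: ssP. Qed.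
End Subspaces.

Section LinearAlgebra.
Variables (k : fieldType) (V : lmodType k).
Implicit Types (S T : subspace V).

Definition indep_mod S (A : set V) : Prop := forall (s : seq V) (c : V -> k),
  uniq s -> (forall x, x \in s -> A x) -> S (\sum_(x <- s) c x *: x) ->
  forall x, x \in s -> c x = 0.

(** A subset of [T] that is maximal, by Zorn's lemma, among those independent
    modulo [S] spans [T] modulo [S]. *)
Lemma basis_mod S T : exists A : set V,
  [/\ forall x, A x -> T x, indep_mod S A &
      forall v, T v -> exists (s : seq V) (c : V -> k),
        [/\ uniq s, forall x, x \in s -> A x & S (v - \sum_(x <- s) c x *: x)]].
Proof.
pose P (A : set V) := (forall x, A x -> T x) /\ indep_mod S A.
have [|A [[AT Ai] Amax]] := @Zorn_bigcup V P.
  move=> F FP Ftot; split=> [x [X FX]|s c us sA]; first exact: (FP _ FX).1.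
  have [-> //|] : s = [::] \/ exists2 X, F X & forall x, x \in s -> X x.
    elim: s {us} sA => [|x s IH] sA; [by left | right].
    have [X FX Xx] := sA x (mem_head _ _).
    have [y ys|s0|[Y FY sY]] := IH; first by apply: sA; rewrite inE ys orbT.
      by exists X => // y; rewrite s0 inE => /eqP ->.
    have [XY|YX] := Ftot _ _ FX FY.
      by exists Y => // y; rewrite inE => /orP[/eqP ->|/sY//]; exact: XY.
    by exists X => // y; rewrite inE => /orP[/eqP -> //|/sY/YX].
  by move=> [X /FP[_ Xi] sX]; exact: Xi.
exists A; split=> // v Tv; apply: contrapT => nv.
have Av : ~ A v.
  move=> Av; apply: nv; exists [:: v], (fun=> 1); split=> //.
    by move=> x; rewrite inE => /eqP ->.
  by rewrite big_seq1 scale1r subrr; exact: ss0.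
apply: (Amax (A `|` [set v])%classic).
  split; first by left.
  by move=> e; apply: Av; apply: e; right.
split=> [x [/AT//|->//]|s c us sA Ss].
have [vs|vs] := boolP (v \in s); last first.
  apply: (Ai s c us _ Ss) => x xs; have [//|xv] := sA x xs.
  by rewrite -xv xs in vs.
have sA' x : x \in rem v s -> A x.
  rewrite mem_rem_uniq // !inE => /andP[/eqP xv xs].
  by case: (sA x xs).
rewrite (big_rem v) //= in Ss.
have [cv|cv] := eqVneq (c v) 0.
  rewrite cv scale0r add0r in Ss => x xs.
  have [->//|xv] := eqVneq x v.
  apply: (Ai _ _ (rem_uniq v us) sA' Ss).
  by rewrite mem_rem_uniq // !inE xv.
case: nv; exists (rem v s), (fun x => - (c v)^-1 * c x); split=> //.
  exact: rem_uniq.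
have -> : v - \sum_(x <- rem v s) (- (c v)^-1 * c x) *: x =
   (c v)^-1 *: (c v *: v + \sum_(x <- rem v s) c x *: x).
  rewrite scalerDr scalerA mulVf // scale1r scaler_sumr -sumrN; congr (_ + _).
  by apply: eq_bigr => x _; rewrite scalerA -scaleNr mulNr opprK.
exact: ssZ.
Qed.

(** A linear map defined on a subspace extends, by 0 on a complement. *)
Lemma linear_extension (W : lmodType k) S (f : V -> W) :
  (forall a u v, S u -> S v -> f (a *: u + v) = a *: f u + f v) ->
  exists h : {linear V -> W}, forall x, S x -> h x = f x.
Proof.
move=> fl.
have fullP : exists T : subspace V, forall x, T x.
  by unshelve eexists (@Subspace k V (fun=> True) _ _).
have [T TT] := fullP.
have [A [_ Ai Asp]] := basis_mod S T.
(* [w] is the component of [v] on the complement of [S] spanned by [A]. *)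
pose co v (w : V) := exists (s : seq V) (c : V -> k),
  [/\ uniq s, forall x, x \in s -> A x, w = \sum_(x <- s) c x *: x & S (v - w)].
have co_ex v : exists w, co v w.
  have [s [c [us sA Ss]]] := Asp v (TT v).
  by exists (\sum_(x <- s) c x *: x), s, c.
have f0 : f 0 = 0.
  have := fl 1 0 0 (ss0 S) (ss0 S); rewrite !scale1r !addr0 => /eqP.
  by rewrite -subr_eq subrr eq_sym => /eqP.
have co_lin a u v w w' : co u w -> co v w' -> co (a *: u + v) (a *: w + w').
  move=> [s [c [us sA -> Su]]] [s' [c' [us' sA' -> Sv]]].
  pose t := undup (s ++ s').
  exists t, (fun x => a * (if x \in s then c x else 0) + (if x \in s' then c' x else 0)).
  have E (w0 : seq V) (F : V -> k) : uniq w0 -> {subset w0 <= s ++ s'} ->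
    \sum_(j <- w0) F j *: j = \sum_(j <- t) (if j \in w0 then F j else 0) *: j.
    move=> uw sub; rewrite [RHS](eq_bigr (fun j => if j \in w0 then F j *: j else 0)).
      rewrite -big_mkcond /= -[RHS]big_filter; apply: perm_big.
      apply: uniq_perm => //; first by rewrite filter_uniq ?undup_uniq.
      by move=> j; rewrite mem_filter mem_undup; case: (boolP (j \in w0)) => // /sub ->.
    by move=> j _; case: ifP => //; rewrite scale0r.
  split; first exact: undup_uniq.
  - by move=> x; rewrite mem_undup mem_cat => /orP[/sA|/sA'].
  - rewrite (E s) // => [|x xs]; last by rewrite mem_cat xs.
    rewrite (E s') // => [|x xs]; last by rewrite mem_cat xs orbT.
    rewrite scaler_sumr -big_split; apply: eq_bigr => x _ /=.
    by rewrite scalerA scalerDl.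
  - by rewrite opprD addrACA -scalerBr; apply: ssP.
have co0 u w : co u w -> S w -> w = 0.
  move=> [s [c [us sA -> _]]] Sw.
  rewrite big1_seq // => x /andP[_ xs].
  by rewrite (Ai s c us sA Sw x xs) scale0r.
have co_uniq v w w' : co v w -> co v w' -> w = w'.
  move=> h h'; have := co_lin (-1) _ _ _ _ h' h.
  rewrite !scaleN1r addNr => h0; apply/eqP; rewrite -subr_eq0 addrC; apply/eqP.
  apply: (co0 _ _ h0); have [_ [_ [_ _ _ S0]]] := h0.
  by move: S0; rewrite sub0r => /(ssZ (-1)); rewrite scaleN1r opprK.
pose g v := projT1 (cid (co_ex v)).
have gP v : co v (g v) by rewrite /g; case: cid.
have gS v : S (v - g v) by have [s [c []]] := gP v.
have g_lin a u v : g (a *: u + v) = a *: g u + g v.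
  by apply: co_uniq (gP _) _; apply: co_lin.
pose h v := f (v - g v).
have hl : linear h.
  move=> a u v; rewrite /h g_lin opprD addrACA -scalerBr; exact: fl.
exists (mklin hl) => x Sx /=; rewrite /h.
have -> : g x = 0; last by rewrite subr0.
apply: (co0 _ _ (gP x)); have := ssB Sx (gS x).
by rewrite opprB addrC subrK.
Qed.

Lemma lin_dep (n : nat) (b : 'I_n -> V) (v : 'I_n.+1 -> V) :
  (forall i, exists c : 'I_n -> k, v i = \sum_j c j *: b j) ->
  exists2 c : 'I_n.+1 -> k, (exists i, c i != 0) & \sum_i c i *: v i = 0.
Proof.
move=> /choice[m mE]; pose M := (\matrix_(i, j) m i j : 'M[k]_(n.+1, n)).
have : kermx M != 0.
  rewrite -mxrank_eq0 mxrank_ker subn_eq0 -ltnNge.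
  exact: leq_ltn_trans (rank_leq_col M) _.
have MK : kermx M *m M = 0 by exact: mulmx_ker.
move=> /matrix0Pn[r [i ri]]; exists (fun i => kermx M r i); first by exists i.
transitivity (\sum_j (\sum_i kermx M r i * m i j) *: b j).
  under eq_bigr do rewrite mE scaler_sumr.
  rewrite exchange_big; apply: eq_bigr => j _; rewrite scaler_suml.
  by apply: eq_bigr => l _; rewrite scalerA.
rewrite big1 // => j _; have /matrixP/(_ r j) := MK; rewrite [RHS]mxE [LHS]mxE => e.
have -> : \sum_i kermx M r i * m i j = 0; last by rewrite scale0r.
by rewrite -[RHS]e; apply: eq_bigr => l _; rewrite [M l j]mxE.
Qed.
End LinearAlgebra.

(** A duplicate-free list of maximal length contains everything. *)
Lemma finite_of_bound (X : eqType) (Q : X -> Prop) (n : nat) :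
  (forall s, uniq s -> (forall x, x \in s -> Q x) -> (size s <= n)%N) ->
  exists s : seq X, forall x, Q x -> x \in s.
Proof.
move=> H; pose R m := exists s : seq X, [/\ uniq s, forall x, x \in s -> Q x & size s = m].
have R0 : exists m, `[< R m >] by exists 0%N; apply/asboolP; exists [::].
have Rle m : `[< R m >] -> (m <= n)%N by move=> /asboolP[s [us sQ <-]]; exact: H.
case: (ex_maxnP R0 Rle) => m /asboolP[s [us sQ sz]] mmax.
exists s => x Qx; apply: contrapT => /negP xs.
suff : (m.+1 <= m)%N by rewrite ltnn.
apply: mmax; apply/asboolP; exists (x :: s); split=> /=; [by rewrite xs | | by rewrite sz].
by move=> y; rewrite inE => /orP[/eqP -> //|/sQ].
Qed.

(** * Graded modules *)

Section GradedMaps.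
Variables (k : fieldType) (B : connGrAlg k).
Implicit Types (M N L P I : grMod B).

Lemma gm0 M j : gm_comp j (0 : M).
Proof. exact: gr_zero (gm_grading M) j. Qed.
Lemma gmB M j (x y : M) : gm_comp j x -> gm_comp j y -> gm_comp j (x - y).
Proof. exact: gr_sub (gm_grading M) j x y. Qed.
Lemma gmD M j (x y : M) : gm_comp j x -> gm_comp j y -> gm_comp j (x + y).
Proof.
apply: gr_add => [i|i u v]; [exact: gr_zero (gm_grading M) i|].
exact: gr_sub (gm_grading M) i u v.
Qed.
Lemma gm_sum M j (J : eqType) (r : seq J) (F : J -> M) :
  (forall i, i \in r -> gm_comp j (F i)) -> gm_comp j (\sum_(i <- r) F i).
Proof.
elim: r => [_|i r IH h]; first by rewrite big_nil; exact: gm0.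
rewrite big_cons; apply: gmD; first by apply: h; rewrite inE eqxx.
by apply: IH => l lr; apply: h; rewrite inE lr orbT.
Qed.
Lemma gmZ M i j l (a : B) (x : M) :
  ga_comp i a -> gm_comp j x -> l = i + j -> gm_comp l (a *: x).
Proof. by move=> Ba Mx ->; exact: gm_act. Qed.

Lemma gr_ind M (Q : M -> Prop) : Q 0 -> (forall x y, Q x -> Q y -> Q (x + y)) ->
  (forall j x, gm_comp j x -> Q x) -> forall x, Q x.
Proof.
move=> Q0 QD Qh x; have [s [x_ [_ xM ->]]] := gr_span (gm_grading M) x.
by apply: big_ind => // i _; exact: Qh (xM i).
Qed.

(** Graded maps into [shift j N], without mentioning the shifted module. *)
Definition hdeg M N (j : int) (f : M -> N) : Prop :=
  forall a x, gm_comp a x -> gm_comp (a + j) (f x).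

Lemma hdeg_eq M N i j (f : M -> N) : hdeg i f -> i = j -> hdeg j f.
Proof. by move=> + <-. Qed.

Lemma graded_hdeg M N (f : M -> N) : graded_map f <-> hdeg 0 f.
Proof. by split=> h j x Mx; have := h j x Mx; rewrite addr0. Qed.

Lemma hdeg_comp M N L i j l (g : N -> L) (f : M -> N) :
  hdeg i f -> hdeg j g -> l = i + j -> hdeg l (g \o f).
Proof. by move=> hf hg -> a x Mx; rewrite addrA; apply: hg; exact: hf. Qed.

Lemma hdegB M N j (f g : {linear M -> N}) : hdeg j f -> hdeg j g -> hdeg j (f \- g).
Proof. by move=> hf hg a x Mx; apply: gmB; [exact: hf | exact: hg]. Qed.
Lemma hdegD M N j (f g : {linear M -> N}) : hdeg j f -> hdeg j g -> hdeg j (f \+ g).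
Proof. by move=> hf hg a x Mx; apply: gmD; [exact: hf | exact: hg]. Qed.

Lemma hdeg0 M N j : hdeg j (lin0 M N).
Proof. by move=> a x _; exact: gm0. Qed.

Lemma proj_lift P M N (j : int) (g : {linear M -> N}) (f : {linear P -> N}) :
  projective P -> graded_map g -> hdeg j f -> (forall x, exists y, g y = f x) ->
  exists2 h : {linear P -> M}, hdeg j h & forall x, g (h x) = f x.
Proof.
move=> prP gg fg im.
have gg' : @graded_map k B (shift j M) (shift j N) g by move=> a x; exact: gg.
by have [h [hg hE]] := @projective_lift k B P (shift j M) (shift j N) g f prP gg' fg im; exists h.
Qed.

(** As [q] factors through the image of [p], a submodule of [N], injectivity
    applies to that submodule. *)
Lemma inj_ext I M N (j : int) (p : {linear M -> N}) (q : {linear M -> I}) :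
  injective_mod I -> graded_map p -> hdeg j q -> (forall x, p x = 0 -> q x = 0) ->
  exists2 u : {linear N -> I}, hdeg j u & forall x, u (p x) = q x.
Proof.
move=> injI pg qg ker.
pose N' := shift (- j) N.
have pg' : @graded_map k B (shift (- j) M) N' p by move=> a x; exact: pg.
have hom := im_hom pg'.
pose J := subMod hom.
have [r rP] : exists r : N' -> M, forall x, p (r (p x)) = p x.
  have /choice[r rP] (y : N') : exists x : M, (exists z, p z = y) -> p x = y.
    have [[z <-]|ny] := pselect (exists z, p z = y); first by exists z.
    by exists 0 => /ny.
  by exists r => x; apply: rP; exists x.
have qr x : q (r (p x)) = q x.
  by apply/eqP; rewrite -subr_eq0 -linearB; apply/eqP/ker; rewrite linearB /= rP subrr.
pose f (y : J) := q (r (val y)).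
have vJ (y : J) : exists x, p x = val y by apply/(ss_predP (im p)); exact: valP.
have fl : linear f.
  move=> a x y; rewrite /f; have [u uE] := vJ x; have [v vE] := vJ y.
  by rewrite linearP /= -uE -vE -linearP !qr linearP.
have vl : linear (val : J -> N') by move=> a x y; rewrite linearP.
have gi : graded_map (mklin vl : J -> N') by move=> a x.
have fg : graded_map (mklin fl : J -> I).
  move=> a x Jx; rewrite /= /f; have [u uE] := vJ x.
  have Nx : gm_comp (a - j) (p u) by rewrite uE; exact: Jx.
  have [w [Mw wE]] := @graded_preim k B M N p (a - j) u pg Nx.
  by rewrite -uE -wE qr; have := qg _ _ Mw; rewrite subrK.
have vi : injective (mklin vl : J -> N') by exact: val_inj.
have [h [hg hE]] := injI J N' (mklin vl) (mklin fl) gi vi fg.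
exists h => [a x Nx|x].
  by apply: (hg (a + j)); rewrite /= /shift /= addrK.
have pJ : p x \in ss_pred (im p) by apply/ss_predP; exists x.
by have := hE (Sub (p x) pJ : J); rewrite /= /f /= qr.
Qed.

(** Graded submodules. *)
Definition hsub M (S : subspace M) : Prop :=
  forall x, S x -> in_gr_sum (fun j y => gm_comp j y /\ S y) x.

Lemma hsub_ind M (S : subspace M) (Q : M -> Prop) : hsub S ->
  Q 0 -> (forall x y, Q x -> Q y -> Q (x + y)) ->
  (forall j x, gm_comp j x -> S x -> Q x) -> forall x, S x -> Q x.
Proof.
move=> hS Q0 QD Qh x /hS[s [x_ [_ xM ->]]].
by apply: big_ind => // i _; have [] := xM i; exact: Qh.
Qed.

Section Kernel.
Variables (M N : grMod B) (g : {linear M -> N}).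
Fact ker0 : g 0 = 0. Proof. exact: linear0. Qed.
Fact kerP a u v : g u = 0 -> g v = 0 -> g (a *: u + v) = 0.
Proof. by move=> gu gv; rewrite linearP /= gu gv scaler0 addr0. Qed.
Definition kernel : subspace M := @Subspace B M (fun x => g x = 0) ker0 kerP.

Lemma kernel_hsub j : hdeg j g -> hsub kernel.
Proof.
move=> gg x gx; have [s [x_ [us xM xE]]] := gr_span (gm_grading M) x.
have gx' i : i \in s -> g (x_ i) = 0.
  have [_ _ _ H] := gm_grading (shift j N).
  apply: (H s (fun i => g (x_ i))) => // [i'|]; first exact: gg.
  by rewrite -linear_sum -xE.
exists s, (fun i => if i \in s then x_ i else 0); split=> //.
  move=> i; case: ifP => [/gx' is_|_]; first by split.
  by split; [exact: gm0 | exact: ker0].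
by rewrite xE; apply: eq_big_seq => i ->.
Qed.
End Kernel.
End GradedMaps.

(** * The augmentation and the trivial module *)

Section Augmentation.
Variables (k : fieldType) (B : connGrAlg k).

Lemma aug_scalar (c : k) : aug_ideal B (c%:A : B) -> c = 0.
Proof.
move=> [s [x_ [us xR e]]].
have c0 : ga_comp 0 (c%:A : B) by apply/ga_conn; exists c.
have := @gr_comp_uniq _ (@ga_comp k B) s x_ 0 (c%:A : B) (ga_grading B) us
  (fun j => (xR j).1) c0 (esym e).
have x00 : x_ 0 = 0 by have [_] := xR 0; apply.
rewrite x00 if_same => /eqP; rewrite scaler_eq0 oner_eq0 orbF.
by move=> /eqP.
Qed.

Lemma aug_ex (a : B) : exists c : k, aug_ideal B (a - c%:A).
Proof.
apply: (@gr_ind k B (regMod B) (fun a => exists c : k, aug_ideal B ((a : B) - c%:A))).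
- by exists 0; rewrite scale0r subr0; exact: ss0.
- move=> x y [c Sx] [c' Sy]; exists (c + c').
  by rewrite scalerDl opprD addrACA; exact: ssD Sx Sy.
move=> j x Bx; have [j0|j0] := eqVneq j 0.
  rewrite j0 in Bx; have [c ->] := (ga_conn x).1 Bx.
  by exists c; rewrite subrr; exact: ss0.
exists 0; rewrite scale0r subr0; apply: (@in_gr_sum1 _ _ (@aug_comp0 k B) j).
split=> //; rewrite le_eqVlt (negPf j0) /= => jneg; exact: ga_neg jneg Bx.
Qed.

Definition eps (a : B) : k := projT1 (cid (aug_ex a)).

Lemma epsP a : aug_ideal B (a - (eps a)%:A).
Proof. by rewrite /eps; case: cid. Qed.

Lemma eps_uniq a (c : k) : aug_ideal B (a - c%:A) -> eps a = c.
Proof.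
move=> h; apply/eqP; rewrite -subr_eq0; apply/eqP/aug_scalar.
have := ssB h (epsP a); rewrite opprB addrC addrA subrK.
by rewrite scalerBl.
Qed.

Lemma eps_aug a : eps a = 0 <-> aug_ideal B a.
Proof.
split=> [e|h]; first by have := epsP a; rewrite e scale0r subr0.
by apply: eps_uniq; rewrite scale0r subr0.
Qed.

Lemma epsA (c : k) : eps c%:A = c.
Proof. by apply: eps_uniq; rewrite subrr; exact: ss0. Qed.
Lemma eps1 : eps 1 = 1.
Proof. by rewrite -[1 in LHS]scale1r epsA. Qed.
Lemma eps0 : eps 0 = 0.
Proof. by rewrite -[0 in LHS](scale0r 1) epsA. Qed.
Lemma epsD a b : eps (a + b) = eps a + eps b.
Proof.
apply: eps_uniq; rewrite scalerDl opprD addrACA; apply: ssD; exact: epsP.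
Qed.
Lemma epsN a : eps (- a) = - eps a.
Proof. by apply/eqP; rewrite -addr_eq0 -epsD addNr eps0. Qed.
Lemma epsB a b : eps (a - b) = eps a - eps b.
Proof. by rewrite epsD epsN. Qed.
Lemma epsM a b : eps (a * b) = eps a * eps b.
Proof.
apply: eps_uniq.
have -> : a * b - (eps a * eps b)%:A =
  a * (b - (eps b)%:A) + (eps b)%:A * (a - (eps a)%:A).
  rewrite !mulrBr addrA; congr (_ + _).
    by rewrite -scalerAr mulr1 -scalerAl mul1r subrK.
  by rewrite -scalerAl mul1r scalerA mulrC.
by apply: ssD; apply: ssZ; exact: epsP.
Qed.
Lemma eps_sum (J : Type) (r : seq J) (P : pred J) (F : J -> B) :
  eps (\sum_(i <- r | P i) F i) = \sum_(i <- r | P i) eps (F i).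
Proof. by apply: (big_morph eps epsD eps0). Qed.

Lemma eps_deg j (a : B) : ga_comp j a -> j != 0 -> eps a = 0.
Proof.
move=> Ba j0; apply/eps_aug; apply: (@in_gr_sum1 _ _ (@aug_comp0 k B) j).
split=> //; rewrite le_eqVlt (negPf j0) /= => jneg; exact: ga_neg jneg Ba.
Qed.
Lemma eps_deg0 (a : B) : ga_comp 0 a -> a = (eps a)%:A.
Proof. by move=> /ga_conn[c ->]; rewrite epsA. Qed.

(** [tau] identifies [trivMod B] with [k], on which [B] acts through [eps]. *)
Definition tau (q : trivMod B) : k := eps (ss_repr q).
Definition tone : trivMod B := ss_pi (aug_ideal B) (1 : (B : algType k)^o).

Lemma tau_pi (a : B) : tau (ss_pi (aug_ideal B) (a : (B : algType k)^o)) = eps a.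
Proof.
rewrite /tau; apply/eqP; rewrite -subr_eq0 -epsB; apply/eqP/eps_aug.
by apply/ss_piE; rewrite ss_reprK.
Qed.

Lemma tau_one : tau tone = 1.
Proof. by rewrite tau_pi eps1. Qed.
Lemma tauD q r : tau (q + r) = tau q + tau r.
Proof.
by rewrite -[q]ss_reprK -[r]ss_reprK -ss_piD tau_pi epsD !tau_pi.
Qed.
Lemma tauZ (a : B) q : tau (a *: q) = eps a * tau q.
Proof. by rewrite -[q]ss_reprK -linearZ !tau_pi /= epsM. Qed.
Lemma tau0 : tau 0 = 0.
Proof. by rewrite -(scale0r tone) tauZ eps0 mul0r. Qed.
Lemma tau_inj q : tau q = 0 -> q = 0.
Proof.
move=> /eps_aug h; rewrite -[q]ss_reprK -[RHS](linear0 (ss_pi (aug_ideal B))).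
by apply/ss_piE; rewrite subr0.
Qed.
Lemma tauN q : tau (- q) = - tau q.
Proof. by apply/eqP; rewrite -addr_eq0 -tauD addNr tau0. Qed.
Lemma tauB q r : tau (q - r) = tau q - tau r.
Proof. by rewrite tauD tauN. Qed.
Lemma tau_eq q r : tau q = tau r -> q = r.
Proof.
by move=> e; apply/eqP; rewrite -subr_eq0; apply/eqP/tau_inj; rewrite tauB e subrr.
Qed.
Lemma tauE q : q = ((tau q)%:A : B) *: tone.
Proof. by apply: tau_eq; rewrite tauZ epsA tau_one mulr1. Qed.
Lemma tau_sum (J : Type) (r : seq J) (P : pred J) (F : J -> trivMod B) :
  tau (\sum_(i <- r | P i) F i) = \sum_(i <- r | P i) tau (F i).
Proof. by apply: (big_morph tau tauD tau0). Qed.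
Lemma triv_deg j (q : trivMod B) : gm_comp j q -> j != 0 -> tau q = 0.
Proof. by move=> h /h ->; rewrite tau0. Qed.
Lemma triv_deg0 (q : trivMod B) : gm_comp 0 q.
Proof. by []. Qed.
End Augmentation.

(** * Free modules *)

Section FreeModules.
Variables (k : fieldType) (B : connGrAlg k).
Local Notation reg := (regMod B).
Local Notation triv := (trivMod B).

Section One.
Variables (X : choiceType) (dg : X -> int).
Local Notation F := (freeMod B dg).

Definition U (x : X) : F := mkmalgU x 1.
Definition cf (x : X) (f : F) : B := mcoeff x (f : {malg B[X]}).

Lemma cfU x y : cf x (U y) = (y == x)%:R.
Proof. by rewrite /cf mcoeffU. Qed.
Lemma cfUU x : cf x (U x) = 1.
Proof. by rewrite cfU eqxx. Qed.
Lemma cfD x f g : cf x (f + g) = cf x f + cf x g.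
Proof. exact: mcoeffD. Qed.
Lemma cfZ x (a : B) f : cf x (a *: f) = a * cf x f.
Proof. exact: mcoeffZ. Qed.
Lemma cf0 x : cf x 0 = 0.
Proof. exact: mcoeff0. Qed.
Lemma cfN x f : cf x (- f) = - cf x f.
Proof. by apply/eqP; rewrite -addr_eq0 -cfD addNr cf0. Qed.
Lemma cfB x f g : cf x (f - g) = cf x f - cf x g.
Proof. by rewrite cfD cfN. Qed.
Lemma cf_sum x (J : Type) (r : seq J) (P : pred J) (G : J -> F) :
  cf x (\sum_(i <- r | P i) G i) = \sum_(i <- r | P i) cf x (G i).
Proof. by apply: (big_morph (cf x) (cfD x) (cf0 x)). Qed.
Lemma cf_eq (f g : F) : (forall x, cf x f = cf x g) -> f = g.
Proof. by move=> h; apply/malgP. Qed.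
Lemma cf_linear x : linear (cf x : F -> reg).
Proof. by move=> a f g; rewrite cfD cfZ. Qed.
Definition coefL x : {linear F -> reg} := mklin (cf_linear x).
Lemma cf_comp j x (f : F) : gm_comp j f -> ga_comp (j - dg x) (cf x f).
Proof. exact. Qed.
Lemma coefL_hdeg x : hdeg (- dg x) (coefL x).
Proof. by move=> a f Ff; exact: cf_comp. Qed.

Lemma U_comp x : gm_comp (dg x) (U x).
Proof. exact: freeU_comp. Qed.

Lemma free_sumU (f : F) : f = \sum_(x <- msupp (f : {malg B[X]})) cf x f *: U x.
Proof. exact: Defs.freeE. Qed.

Lemma free_eqP (M : lmodType B) (f g : {linear F -> M}) :
  (forall x, f (U x) = g (U x)) -> forall u, f u = g u.
Proof.
move=> h u; rewrite [u]free_sumU !linear_sum; apply: eq_bigr => x _.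
by rewrite !linearZ h.
Qed.

Lemma free_linE (M : grMod B) (phi : X -> M) x : free_lin dg phi (U x) = phi x.
Proof. exact: free_linU. Qed.

Lemma free_hdeg (M : grMod B) j (phi : X -> M) :
  (forall x, gm_comp (dg x + j) (phi x)) -> hdeg j (free_lin dg phi).
Proof.
move=> h.
by have := @free_lin_graded k B X dg (shift j M) phi h.
Qed.

Lemma cf_seq (s : seq X) (f : F) : uniq s -> (forall x, x \notin s -> cf x f = 0) ->
  f = \sum_(x <- s) cf x f *: U x.
Proof.
move=> us h; apply: cf_eq => y; rewrite cf_sum.
have [ys|ys] := boolP (y \in s); last first.
  rewrite h // big1_seq // => x /andP[_ xs]; rewrite cfZ cfU.
  by case: eqP => [e|_]; [rewrite -e xs in ys | rewrite mulr0].
rewrite (bigD1_seq y) //= cfZ cfUU mulr1 big1 ?addr0 // => x xy.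
by rewrite cfZ cfU (negPf xy) mulr0.
Qed.

Fact mini0 : forall x, eps (cf x 0) = 0.
Proof. by move=> x; rewrite cf0 eps0. Qed.
Fact miniP a u v : (forall x, eps (cf x u) = 0) -> (forall x, eps (cf x v) = 0) ->
  forall x, eps (cf x (a *: u + v)) = 0.
Proof. by move=> hu hv x; rewrite cfD cfZ epsD epsM hu hv mulr0 addr0. Qed.
(** The submodule [B_(>= 1) F]. *)
Definition mini : subspace F :=
  @Subspace B F (fun f => forall x, eps (cf x f) = 0) mini0 miniP.

Lemma mini_triv (g : {linear F -> triv}) u : mini u -> g u = 0.
Proof.
move=> mu; rewrite [u]free_sumU linear_sum big1 // => x _.
by apply: tau_inj; rewrite linearZ tauZ mu mul0r.
Qed.

Definition tcoord x : {linear F -> triv} :=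
  free_lin dg (fun y => if y == x then tone B else 0).
Lemma tau_tcoord x u : tau (tcoord x u) = eps (cf x u).
Proof.
have zl : linear (fun u : F => ((eps (cf x u))%:A : B) *: tone B).
  move=> a f g; apply: tau_eq; rewrite tauD !(tauZ, epsA, tau_one, mulr1).
  by rewrite cfD cfZ epsD epsM.
have zE v : mklin zl v = ((eps (cf x v))%:A : B) *: tone B by [].
have := @free_eqP triv (tcoord x) (mklin zl) _ u => ->; rewrite ?zE.
  by rewrite tauZ epsA tau_one mulr1.
move=> y; rewrite free_linE zE cfU; apply: tau_eq.
by case: eqP => _; rewrite tauZ epsA tau_one mulr1 ?tau_one ?tau0 ?eps1 ?eps0.
Qed.
Lemma tcoord_hdeg x : hdeg (- dg x) (tcoord x).
Proof.
apply: free_hdeg => y; case: eqP => [->|_]; last exact: gm0.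
by rewrite subrr; exact: triv_deg0.
Qed.

(** [g] depends on [u] only modulo [B_(>= 1) F]. *)
Lemma tau_free (g : {linear F -> triv}) (s : seq X) u : uniq s ->
  (forall x, x \notin s -> eps (cf x u) = 0) ->
  tau (g u) = \sum_(x <- s) eps (cf x u) * tau (g (U x)).
Proof.
move=> us h; have mu : mini (u - \sum_(x <- s) cf x u *: U x).
  move=> y; rewrite cfB cf_sum epsB eps_sum.
  have [ys|ys] := boolP (y \in s); last first.
    rewrite h // big1_seq ?subrr // => x /andP[_ xs]; rewrite cfZ cfU epsM.
    by case: eqP => [e|_]; [rewrite -e xs in ys | rewrite eps0 mulr0].
  rewrite (bigD1_seq y) //= cfZ cfUU mulr1 big1 ?addr0 ?subrr // => x xy.
  by rewrite cfZ cfU (negPf xy) mulr0 eps0.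
have := mini_triv g mu; rewrite linearB linear_sum /= => /eqP.
rewrite subr_eq0 => /eqP ->; rewrite tau_sum; apply: eq_bigr => x _.
by rewrite linearZ tauZ.
Qed.

(** [triv] is concentrated in degree 0. *)
Lemma hdeg_triv j (g : {linear F -> triv}) x : hdeg j g -> dg x + j != 0 ->
  g (U x) = 0.
Proof. by move=> gg; apply: gg; exact: U_comp. Qed.
End One.

Lemma mini_lin (X Y : choiceType) (dg : X -> int) (dg' : Y -> int)
  (f : {linear freeMod B dg -> freeMod B dg'}) u : mini dg u -> mini dg' (f u).
Proof.
move=> mu; rewrite [u]free_sumU linear_sum; apply: ss_sum => x _ y.
by rewrite linearZ cfZ epsM mu mul0r.
Qed.

Lemma mini_linU (X Y : choiceType) (dg : X -> int) (dg' : Y -> int)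
  (f : {linear freeMod B dg -> freeMod B dg'}) :
  (forall x, mini dg' (f (U dg x))) -> forall u, mini dg' (f u).
Proof.
move=> h u; rewrite [u]free_sumU linear_sum; apply: ss_sum => x _.
by rewrite linearZ; apply: ssZ.
Qed.
End FreeModules.
Arguments mini {k B X} dg.
Arguments U {k B X} dg x.
Arguments coefL {k B X} dg x.
Arguments tcoord {k B X} dg x.

(** * Minimal free resolutions *)

Section MinimalCover.
Variables (k : fieldType) (B : connGrAlg k) (M : grMod B) (K : subspace M).
Variable b : int.
Hypothesis hK : hsub K.
Hypothesis Kb : forall j x, gm_comp j x -> K x -> j < b -> x = 0.

(** The degree [n] part of [B_(>= 1) K]. *)
Let rad_set n (x : resk M) := exists s : seq (int * (B * M)),
  (forall p, p \in s -> [/\ 0 < p.1, ga_comp p.1 p.2.1, gm_comp (n - p.1) p.2.2 & K p.2.2])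
  /\ x = \sum_(p <- s) p.2.1 *: p.2.2.
Let rad0 n : rad_set n 0.
Proof. by exists [::]; rewrite big_nil. Qed.
Let radP n c u v : rad_set n u -> rad_set n v -> rad_set n (c *: u + v).
Proof.
move=> [s [sP ->]] [t [tP ->]].
exists ([seq (p.1, (c%:A * p.2.1, p.2.2)) | p <- s] ++ t); split.
  move=> p; rewrite mem_cat => /orP[/mapP[q /sP[q0 qa qm qK] ->]|/tP//]; split=> //=.
  by rewrite -[q.1]add0r; apply: ga_mul => //; apply/ga_conn; exists c.
rewrite big_cat big_map /= /GRing.scale /= /resk_scale scaler_sumr.
by congr (_ + _); apply: eq_bigr => p _; rewrite scalerA.
Qed.
Let rad n : subspace (resk M) := Subspace (rad0 n) (@radP n).

Let piece_set n (x : resk M) := gm_comp n (x : M) /\ K x.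
Let piece0 n : piece_set n 0.
Proof. split; [exact: gm0 | exact: ss0]. Qed.
Let pieceP n c u v : piece_set n u -> piece_set n v -> piece_set n (c *: u + v).
Proof.
move=> [ug uK] [vg vK]; split; last exact: ssP.
apply: gmD => //; apply: (gmZ (i := 0) (j := n)) => //; last by rewrite add0r.
by apply/ga_conn; exists c.
Qed.
Let piece n : subspace (resk M) := Subspace (piece0 n) (@pieceP n).

(** A bounded below graded submodule [K] is generated by homogeneous elements
    that form a basis of [K / B_(>= 1) K] (Nakayama); all the relations between
    them then have their coefficients in [B_(>= 1)]. *)
Lemma minimal_cover : exists (X : choiceType) (dg : X -> int) (phi : X -> M),
  [/\ forall x, gm_comp (dg x) (phi x) /\ K (phi x),
      forall x, b <= dg x,
      forall u, K u -> exists y, free_lin dg phi y = u &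
      forall y, free_lin dg phi y = 0 -> mini dg y].
Proof.
have /choice[A AP] n := basis_mod (rad n) (piece n).
pose X : choiceType := {p : int * M | `[< A p.1 p.2 >]}.
pose dg (x : X) := (val x).1; pose phi (x : X) := (val x).2.
have phiA x : A (dg x) (phi x) by have /asboolP := valP x.
have phiP x : gm_comp (dg x) (phi x) /\ K (phi x).
  by have [AT _ _] := AP (dg x); exact: AT (phiA x).
have phi_neq0 x : phi x <> 0.
  move=> x0; have [_ Ai _] := AP (dg x).
  have H := Ai [:: phi x : resk M] (fun=> 1) isT.
  have /eqP : (1 : k) = 0.
    apply: (H _ _ (phi x)); last by rewrite inE.
    - by move=> m; rewrite inE => /eqP ->.
    - by rewrite big_seq1 x0 scaler0; exact: ss0.
  by rewrite oner_eq0.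
exists X, dg, phi; split=> //.
- move=> x; rewrite leNgt; apply/negP => xb.
  by have [xM xK] := phiP x; apply: (phi_neq0 x); exact: Kb xM xK xb.
- pose I := im (free_lin dg phi).
  (* Nakayama: in degree [n], [K] is spanned by generators and by multiples of
     elements of lower degree. *)
  have gen N : forall n, n < b + N%:Z -> forall u, gm_comp n u -> K u -> I u.
    elim: N => [|N IH] n nb u uM uK.
      by rewrite addr0 in nb; rewrite (Kb uM uK nb); exact: ss0.
    have [AT _ Asp] := AP n; have [s [c [us sA [t [tP e]]]]] := Asp u (conj uM uK).
    have -> : u = (\sum_(p <- t) p.2.1 *: p.2.2 : M) + \sum_(x <- s) (c x)%:A *: (x : M).
      by rewrite -e; exact: esym (@subrK M _ _).
    apply: ssD.
      apply: ss_sum => p /tP[p0 pB pM pK]; apply: ssZ; apply: IH pM pK; lia.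
    apply: ss_sum => m ms; apply: ssZ.
    have h : `[< A (n, m : M).1 (n, m : M).2 >] by apply/asboolP/sA.
    by exists (U dg (Sub (n, m : M) h : X)); rewrite free_linE.
  move=> u; apply: (hsub_ind (Q := I)) => //; [exact: ss0|exact: ssD|].
  by move=> j x xM xK; apply: (gen `|j - b|.+1 j) xM xK; lia.
move=> y; have fg : hdeg 0 (free_lin dg phi).
  by apply: free_hdeg => x; rewrite addr0; case: (phiP x).
apply: (hsub_ind (S := kernel (free_lin dg phi)) (Q := mini dg)).
- exact: kernel_hsub fg.
- exact: ss0.
- exact: ssD.
(* In a relation of degree [n] the generators of degree [n] have scalar
   coefficients, and the other terms lie in [rad n]. *)
move=> n f fM fK x0.
have [x0n|x0n] := eqVneq (dg x0) n; last first.
  by apply: (@eps_deg _ _ (n - dg x0)); [exact: cf_comp | rewrite subr_eq0 eq_sym].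
have [x0f|x0f] := boolP (x0 \in msupp (f : {malg B[X]})); last first.
  by rewrite /cf mcoeff_outdom ?eps0.
pose sp := enum_fset (msupp (f : {malg B[X]})).
pose s := [seq x <- sp | dg x == n].
have usp : uniq sp by exact: fset_uniq.
pose c (m : resk M) : k := if insub (n, m : M) is Some x then eps (cf (x : X) f) else 0.
have cE x : dg x = n -> c (phi x) = eps (cf x f).
  move=> xn; rewrite /c; have -> : (n, phi x) = val x by rewrite -xn [RHS]surjective_pairing.
  by rewrite valK.
have phi_inj : {in s &, injective phi}.
  move=> x1 x2; rewrite !mem_filter => /andP[/eqP e1 _] /andP[/eqP e2 _] e12.
  apply: val_inj; rewrite [LHS]surjective_pairing [RHS]surjective_pairing.
  by congr pair => //; rewrite -[LHS]/(dg x1) -[RHS]/(dg x2) e1 e2.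
have [AT Ai _] := AP n.
have := Ai [seq (phi x : resk M) | x <- s] c.
rewrite map_inj_in_uniq // filter_uniq // => /(_ isT) H.
rewrite -cE //; apply: H; last by apply: map_f; rewrite mem_filter x0n eqxx.
  by move=> m /mapP[x]; rewrite mem_filter => /andP[/eqP xn _] ->; rewrite -xn; exact: phiA.
have : \sum_(x <- sp) cf x f *: phi x = 0 by exact: fK.
rewrite (bigID (fun x => dg x == n)) /= => /eqP; rewrite addr_eq0 => /eqP e.
have -> : \sum_(x <- [seq (phi x : resk M) | x <- s]) c x *: x =
   \sum_(i <- sp | dg i == n) cf i f *: phi i.
  rewrite big_map big_filter; apply: eq_bigr => x /eqP xn.
  rewrite cE //; rewrite /GRing.scale /= /resk_scale -eps_deg0 //.
  by have := cf_comp x fM; rewrite xn subrr.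
rewrite e -big_filter.
exists [seq (n - dg x, (- cf x f, phi x)) | x <- sp & (dg x != n) && (dg x <= n)]; split.
  move=> p /mapP[x]; rewrite mem_filter => /andP[/andP[xn xle] _] -> /=; split.
  - by rewrite subr_gt0 lt_neqAle xn.
  - have := cf_comp x fM; rewrite -[- cf x f]sub0r; apply: gr_sub (ga_grading B) _ _ _ _.
    exact: gr_zero (ga_grading B) _.
  - by have [+ _] := phiP x; rewrite opprB addrC subrK.
  - by have [] := phiP x.
rewrite big_map -sumrN !big_filter -[RHS]big_filter (bigID (fun x => dg x <= n)) /=.
rewrite [X in _ + X]big1 ?addr0; last first.
  move=> x /andP[_ xn]; rewrite (_ : cf x f = 0) ?scale0r ?oppr0 //.
  by apply: ga_neg (cf_comp x fM); rewrite subr_lt0 ltNge.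
by rewrite big_filter; apply: eq_bigr => x _; rewrite scaleNr.
Qed.
End MinimalCover.

(** A sequence of maps between the terms of nonnegative index of a family
    indexed by the integers, as an integer-indexed differential. *)
Section Glue.
Variables (k : fieldType) (B : connGrAlg k) (O : int -> grMod B).
Variable dn : forall n : nat, {linear O n.+1 -> O n}.

Definition int_diff (i j : int) : {linear O i -> O j} :=
  match j with
  | Posz m => match Posz m.+1 =P i with
      | ReflectT e => ecast z {linear O z -> O (Posz m)} e (dn m)
      | ReflectF _ => lin0 _ _
      end
  | Negz _ => lin0 _ _
  end.

Lemma int_diffE n : int_diff (Posz n.+1) (Posz n) = dn n.
Proof. by rewrite /int_diff; case: eqP => // e; rewrite (eq_axiomK e). Qed.

Lemma int_diff_shape i j x : i <> j + 1 -> int_diff i j x = 0.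
Proof.
case: j => [m|m] //= ij; case: eqP => // e.
by case: ij; rewrite -e -addn1 PoszD.
Qed.

Lemma int_diff_graded : (forall n, graded_map (dn n)) -> forall i j, graded_map (int_diff i j).
Proof.
move=> dg i [m|m]; last exact: lin0_graded.
by rewrite /int_diff; case: eqP => e; [case: i / e | exact: lin0_graded].
Qed.

Lemma int_diff_exact : (forall n x, dn n x = 0 <-> exists y, dn n.+1 y = x) ->
  forall (i j l : int) (x : O i), 0 < i -> i = j + 1 -> l = i + 1 ->
  int_diff i j x = 0 <-> exists y, int_diff l i y = x.
Proof.
move=> ex [[|n]|n] j l x // _.
rewrite -[X in Posz X = _]addn1 -[X in _ = Posz X + _]addn1.
move=> ij lE.
have {ij} -> : j = n by apply: (@addIr _ 1); rewrite -ij PoszD.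
have {lE} -> : l = n.+2 by rewrite lE -PoszD !addn1.
by rewrite !int_diffE; exact: ex.
Qed.
End Glue.

(** Minimal free resolutions of the trivial module, indexed by the integers like
    [projRes]; [fr_base] says that the module in position 0 is [B]. *)
Record freeRes (k : fieldType) (B : connGrAlg k) := FreeRes {
  fr_X : int -> choiceType;
  fr_dg : forall i, fr_X i -> int;
  fr_d : forall i j, {linear freeMod B (@fr_dg i) -> freeMod B (@fr_dg j)};
  fr_aug : {linear freeMod B (@fr_dg 0) -> trivMod B};
  fr_d_graded : forall i j, graded_map (fr_d i j);
  fr_aug_graded : graded_map fr_aug;
  fr_shape : forall i j x, i <> j + 1 -> fr_d i j x = 0;
  fr_neg : forall i (x : fr_X i), 0 <= i;
  fr_aug_surj : Defs.surj fr_aug;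
  fr_exact0 : forall x, fr_aug x = 0 <-> exists y, fr_d 1 0 y = x;
  fr_exact : forall i j l x, 0 < i -> i = j + 1 -> l = i + 1 ->
    fr_d i j x = 0 <-> exists y, fr_d l i y = x;
  fr_min : forall i j x, mini (@fr_dg j) (fr_d i j x);
  fr_base : exists x0 : fr_X 0, (forall x, x = x0) /\ fr_dg x0 = 0 }.

Section FreeResTheory.
Variables (k : fieldType) (B : connGrAlg k) (c : freeRes B).

Definition fr_obj (i : int) : grMod B := freeMod B (@fr_dg k B c i).

Fact fr_neg0 i (x : fr_obj i) : i < 0 -> x = 0.
Proof. by move=> i0; apply: cf_eq => y; have := fr_neg y; rewrite leNgt i0. Qed.
Fact fr_projective i : projective (fr_obj i).
Proof. exact: free_projective. Qed.
Fact fr_exact1 i (x : fr_obj i) : 0 < i ->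
  fr_d c i (i - 1) x = 0 <-> exists y, fr_d c (i + 1) i y = x.
Proof. by move=> i0; apply: fr_exact => //; rewrite subrK. Qed.

Definition toRes : projRes (trivMod B) :=
  @ProjRes k B (trivMod B) fr_obj (fr_d c) (fr_aug c) (@fr_d_graded k B c)
    (@fr_aug_graded k B c) (@fr_shape k B c) fr_neg0 fr_projective
    (@fr_aug_surj k B c) (@fr_exact0 k B c) fr_exact1.
End FreeResTheory.

Section MinimalResolution.
Variables (k : fieldType) (B : connGrAlg k).

Section Iterate.
Variable b : int.

(** One step of a minimal resolution: the next one is a minimal cover of the
    kernel.  The bound [b] on the degrees of the generators makes minimal covers
    available. *)
Record mstate := MState {
  ms_X : choiceType;
  ms_dg : ms_X -> int;
  ms_tgt : grMod B;
  ms_map : {linear freeMod B ms_dg -> ms_tgt};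
  ms_gr : graded_map ms_map;
  ms_ge : forall x, b <= ms_dg x;
  ms_min : forall y, ms_map y = 0 -> mini ms_dg y }.

Record mcover (st : mstate) := MCover {
  mc_X : choiceType;
  mc_dg : mc_X -> int;
  mc_map : {linear freeMod B mc_dg -> freeMod B (@ms_dg st)};
  mc_gr : graded_map mc_map;
  mc_ge : forall x, b <= mc_dg x;
  mc_rel : forall y, mc_map y = 0 -> mini mc_dg y;
  mc_exact : forall x, ms_map st x = 0 <-> exists y, mc_map y = x }.

Lemma mcover_ex (st : mstate) : exists _ : mcover st, True.
Proof.
have hK : hsub (kernel (ms_map st)).
  by apply: (@kernel_hsub _ _ _ _ _ 0); apply/graded_hdeg; exact: ms_gr.
have [j x xj _ j0|X [dg [phi [phiP dg0 gen rel]]]] := @minimal_cover k B _ _ b hK.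
  by apply: cf_eq => y; rewrite cf0; apply: ga_neg (cf_comp y xj); have := ms_ge y; lia.
have gr : graded_map (free_lin dg phi).
  by apply: free_lin_graded => x; have [] := phiP x.
unshelve eexists (@MCover st X dg (free_lin dg phi) gr dg0 rel _) => // x.
split=> [/gen//|[y <-]].
by rewrite /= /free_ext; apply: (ss_sum (S := kernel (ms_map st))) => i _; apply: ssZ; have [] := phiP i.
Qed.

Definition mcov st : mcover st := projT1 (cid (mcover_ex st)).
Definition mnext (st : mstate) : mstate :=
  @MState (mc_X (mcov st)) (@mc_dg _ (mcov st)) _ (mc_map (mcov st))
    (@mc_gr _ _) (@mc_ge _ _) (@mc_rel _ _).

Definition mst (st : mstate) (n : nat) : mstate := iter n mnext st.
End Iterate.

Definition dg_unit (_ : unit) : int := 0.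
Definition aug_unit : {linear freeMod B dg_unit -> trivMod B} :=
  free_lin dg_unit (fun=> tone B).
Fact aug_unit_graded : graded_map aug_unit.
Proof. by apply: free_lin_graded => x; exact: triv_deg0. Qed.
Lemma tau_aug_unit u : tau (aug_unit u) = eps (cf tt u).
Proof. exact: (@tau_tcoord _ _ _ dg_unit tt u). Qed.
Fact aug_unit_min y : aug_unit y = 0 -> mini dg_unit y.
Proof. by move=> y0 []; rewrite -tau_aug_unit y0 tau0. Qed.

Definition mstart : mstate 0 :=
  @MState 0 unit dg_unit _ aug_unit aug_unit_graded (fun=> lexx 0) aug_unit_min.

Definition mres_X (i : int) : choiceType :=
  match i with Posz n => ms_X (mst mstart n) | Negz _ => void end.
Definition mres_dg (i : int) : mres_X i -> int :=
  match i with Posz n => @ms_dg _ (mst mstart n) | Negz _ => fun=> 0 end.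
Definition mres_dn (n : nat) :
    {linear freeMod B (@mres_dg n.+1) -> freeMod B (@mres_dg n)} := mc_map (mcov (mst mstart n)).
Definition mres_d := int_diff (O := fun i => freeMod B (@mres_dg i)) mres_dn.

Fact mres_dn_exact n x : mres_dn n x = 0 <-> exists y, mres_dn n.+1 y = x.
Proof. exact: (mc_exact (mcov (mst mstart n.+1))). Qed.

Fact mres_min i j x : mini (@mres_dg j) (mres_d i j x).
Proof.
case: j => [m|m] /=; last by case.
rewrite /mres_d /int_diff; case: eqP => e; last exact: (ss0 (mini _)).
move: x; case: i / e => x; apply: (@ms_min _ (mst mstart m)).
by apply/(mc_exact (mcov (mst mstart m))); exists x.
Qed.

Lemma minimal_resolution : exists c : freeRes B,
  forall i (x : fr_X c i), 0 <= fr_dg x.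
Proof.
unshelve eexists (@FreeRes k B mres_X mres_dg mres_d aug_unit _ _ _ _ _ _ _ _ _).
- by apply: int_diff_graded => n; exact: mc_gr.
- exact: aug_unit_graded.
- exact: int_diff_shape.
- by case.
- move=> q; exists (((tau q)%:A : B) *: U dg_unit tt).
  have e : aug_unit (U dg_unit tt) = tone B by exact: free_linE.
  by apply: etrans (esym (tauE q)); rewrite -e; exact: linearZ.
- move=> x; have -> : mres_d 1 0 = mres_dn 0 by exact: int_diffE.
  exact: (mc_exact (mcov mstart)).
- by apply: int_diff_exact; exact: mres_dn_exact.
- exact: mres_min.
- by exists tt; split=> // -[].
by case=> [n|n] //=; exact: ms_ge.
Qed.
End MinimalResolution.

(** * Ext groups and products on an arbitrary resolution *)

Section ChainMaps.
Variables (k : fieldType) (B : connGrAlg k).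

(** Chain maps lifting the same map are homotopic, hence agree after a
    cocycle, up to a coboundary. *)
Lemma lift_uniq (M N : grMod B) (P : projRes M) (Q : projRes N) (i j : int)
  (f : {linear P i -> N}) (F F' : forall n m, {linear P n -> Q m})
  (L : grMod B) (i1 j1 n : int) (g : {linear Q i1 -> L}) :
  is_lift j f F -> is_lift j f F' -> hdeg j1 g -> is_cocycle g -> n = i1 + i ->
  exists2 s : {linear P (n - 1) -> L}, hdeg (j1 + j) s &
    forall x, g (F n i1 x) - g (F' n i1 x) = s (pr_d P n (n - 1) x).
Proof.
move=> FL FL' gg gc nE.
pose G a b : {linear P a -> Q b} := lcomb (-1) (F' a b) (F a b).
have GL : is_lift j (lcomb (-1) f f) G.
  split=> [a b ab|u|a b u ab].
  - apply: (@lcomb_graded k B (P a) (shift j (Q b))).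
      exact: (lift_graded FL' ab).
    exact: (lift_graded FL ab).
  - by rewrite /= linearP /= (lift_aug FL) (lift_aug FL').
  - by rewrite /= linearP /= (lift_comm FL _ ab) (lift_comm FL' _ ab).
have fE u : lcomb (-1) f f u = lin0 _ N (pr_d P i (i - 1) u).
  by rewrite /= scaleN1r scaleN1r addNr.
have zg : @graded_map k B (P (i - 1)) (shift j N) (lin0 _ N) by exact: hdeg0.
have [t [tg tE]] := lift_cobound GL zg fE gg gc nE.
exists t => // x; rewrite -tE /= linearP /= scaleN1r scaleN1r addrC.
by [].
Qed.

Section IdLift.
Variables (M : grMod B) (P : projRes M).
Definition id_fam (n m : int) : {linear P n -> P m} :=
  match n =P m with
  | ReflectT e => ecast z {linear P n -> P z} e idfun
  | ReflectF _ => lin0 _ _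
  end.
Lemma id_famE n x : id_fam n n x = x.
Proof. by rewrite /id_fam; case: eqP => // e; rewrite (eq_axiomK e). Qed.
Lemma id_fam_lift : is_lift 0 (pr_aug P) id_fam.
Proof.
split=> [n m|x|n m x]; last 2 first.
- by rewrite id_famE.
- by rewrite addr0 => nm; move: x; rewrite {}nm => x; rewrite !id_famE.
by rewrite addr0 => -> a x; rewrite id_famE /= addr0.
Qed.
End IdLift.

Lemma aug_cocycle (M : grMod B) (P : projRes M) : is_cocycle (pr_aug P).
Proof. by move=> x; apply/(pr_exact0); exists x. Qed.

Lemma aug_lift_ex (M : grMod B) (P Q : projRes M) :
  exists A : forall n m, {linear P n -> Q m}, is_lift 0 (pr_aug P) A.
Proof.
have h : hdeg 0 (pr_aug P) by apply/graded_hdeg; exact: pr_aug_graded.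
by apply: lift_ex; [exact: h | exact: aug_cocycle].
Qed.

Lemma lift_compL (M N : grMod B) (P : projRes M) (Q Q' : projRes N) (i j : int)
  (f : P i -> N) (F : forall n m, {linear P n -> Q m})
  (A : forall n m, {linear Q n -> Q' m}) :
  is_lift j f F -> is_lift 0 (pr_aug Q) A -> is_lift j f (fun n m => A m m \o F n m).
Proof.
move=> FL AL; have z (m : int) : m = m + 0 by rewrite addr0.
split=> [n m nm a x Px|x|n m x nm].
- have := lift_graded AL (z m) (lift_graded FL nm Px).
  by rewrite /shift /= addr0.
- by rewrite /= (lift_aug AL) (lift_aug FL).
- by rewrite /= (lift_comm AL _ (z m)) (lift_comm FL _ nm).
Qed.

Lemma lift_compR (M N : grMod B) (P P' : projRes M) (Q : projRes N) (i j : int)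
  (f : P i -> N) (F : forall n m, {linear P n -> Q m})
  (A : forall n m, {linear P' n -> P m}) :
  is_lift j f F -> is_lift 0 (pr_aug P') A ->
  is_lift j (f \o A i i) (fun n m => F n m \o A n n).
Proof.
move=> FL AL; have z (m : int) : m = m + 0 by rewrite addr0.
split=> [n m nm a x Px|x|n m x nm].
- have := lift_graded AL (z n) Px; rewrite /shift /= addr0.
  exact: (lift_graded FL nm).
- by rewrite /= (lift_aug FL).
- by rewrite /= (lift_comm FL _ nm) (lift_comm AL _ (z n)).
Qed.

Lemma comp_cocycle (M N L : grMod B) (P : projRes M) (Q : projRes N) (i j : int)
  (f : P i -> N) (F : forall n m, {linear P n -> Q m}) i1 n (g : {linear Q i1 -> L}) :
  is_lift j f F -> is_cocycle g -> n = i1 + i -> is_cocycle (g \o F n i1).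
Proof.
move=> FL gc nE x /=.
rewrite -(@lift_commE _ _ _ _ _ _ _ _ _ _ (n + 1) (i1 + 1) _ _ _ FL) //.
by rewrite nE addrAC.
Qed.
End ChainMaps.

Section ExtRepresentatives.
Variables (k : fieldType) (B : connGrAlg k) (M : grMod B) (P : projRes M).
Local Notation Q := (res M).

Let beta : forall n m, {linear Q n -> P m} := projT1 (cid (aug_lift_ex Q P)).
Let betaL : is_lift 0 (pr_aug Q) beta. Proof. by rewrite /beta; case: cid. Qed.
Let alpha : forall n m, {linear P n -> Q m} := projT1 (cid (aug_lift_ex P Q)).
Let alphaL : is_lift 0 (pr_aug P) alpha. Proof. by rewrite /alpha; case: cid. Qed.
Let z (m : int) : m = m + 0. Proof. by rewrite addr0. Qed.

(** The cocycle [g] on the resolution [P] represents the class [x], computed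
    with the resolution [res M]. *)
Definition rep (N : grMod B) (i j : int) (g : {linear P i -> N}) (x : ExtGr i j M N) :=
  [/\ hdeg j g, is_cocycle g & @is_class k B M i (shift j N) (g \o beta i i) x].

Let beta_hdeg n : hdeg 0 (beta n n). Proof. by move=> a x; exact: (lift_graded betaL (z n)). Qed.
Let alpha_hdeg n : hdeg 0 (alpha n n). Proof. by move=> a x; exact: (lift_graded alphaL (z n)). Qed.

Lemma rep_ex (N : grMod B) (i j : int) (g : {linear P i -> N}) : hdeg j g -> is_cocycle g ->
  exists x, @rep N i j g x.
Proof.
move=> gg gc.
have gg' : hdeg j (g \o beta i i).
  by apply: hdeg_comp (@beta_hdeg i) gg _; rewrite add0r.
have [x xP] := @class_of k B M i (shift j N) _ gg' (comp_cocycle betaL gc (z i)).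
by exists x.
Qed.

Let is_class_cob (N : grMod B) (i j : int) (g g' : {linear Q i -> N}) (h : {linear Q (i - 1) -> N}) x :
  @is_class k B M i (shift j N) g x -> hdeg j g' -> is_cocycle g' -> hdeg j h ->
  (forall y, g y - g' y = h (pr_d Q i (i - 1) y)) -> @is_class k B M i (shift j N) g' x.
Proof.
move=> gx gg' gc' hg hE.
have [x' x'P] := @class_of k B M i (shift j N) _ gg' gc'.
by have -> : x = x'; first by apply/(is_class_eq gx x'P); exists h.
Qed.

Lemma rep_surj (N : grMod B) (i j : int) (x : ExtGr i j M N) : exists g, rep g x.
Proof.
have [g gx] : exists g : {linear Q i -> N}, @is_class k B M i (shift j N) g x.
  exact: (@is_class_ex k B M i (shift j N) x).
have [gg0 gc] := @is_class_cocycle k B M i (shift j N) g x gx.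
have gg : hdeg j g by exact: gg0.
have gag : hdeg j (g \o alpha i i) by apply: hdeg_comp (@alpha_hdeg i) gg _; rewrite add0r.
have gac := comp_cocycle alphaL gc (z i).
exists (g \o alpha i i); split=> //.
have abL := lift_compL betaL alphaL.
have [s sg sE] := lift_uniq (id_fam_lift Q) abL gg gc (z i).
rewrite addr0 in sg.
apply: (is_class_cob gx _ _ sg) => [||y].
- by apply: hdeg_comp (@beta_hdeg i) gag _; rewrite add0r.
- exact: comp_cocycle betaL gac (z i).
- by rewrite -sE id_famE.
Qed.

Lemma rep_eq (N : grMod B) (i j : int) (g g' : {linear P i -> N}) (x x' : ExtGr i j M N) :
  rep g x -> rep g' x' -> x = x' <-> exists2 u : {linear P (i - 1) -> N},
    hdeg j u & forall y, g y - g' y = u (pr_d P i (i - 1) y).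
Proof.
move=> [gg gc gx] [gg' gc' gx'].
apply: (iff_trans (is_class_eq gx gx')); split=> [[h [hg hE]]|[u ug uE]].
  pose G := g \- g'.
  have Gc : is_cocycle G by move=> y; rewrite /= gc gc' subrr.
  have [s sg sE] := lift_uniq (id_fam_lift P) (lift_compL alphaL betaL)
    (hdegB gg gg') Gc (z i).
  exists (s \+ (h \o alpha (i - 1) (i - 1))).
    apply: hdegD; first by apply: hdeg_eq sg _; rewrite addr0.
    by apply: hdeg_comp (@alpha_hdeg _) hg _; rewrite add0r.
  move=> y /=; rewrite -sE id_famE /= -(lift_comm alphaL _ (z i)) -hE /=.
  by rewrite subrK.
exists (u \o beta (i - 1) (i - 1)); split.
  by apply: hdeg_comp (@beta_hdeg _) ug _; rewrite add0r.
by move=> y; rewrite /= uE (lift_comm betaL _ (z i)).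
Qed.

Lemma rep_lcomb (N : grMod B) (i j : int) (a : k) (g g' : {linear P i -> N}) (x x' : ExtGr i j M N) :
  rep g x -> rep g' x' -> rep (lcomb a g g') (a *: x + x').
Proof.
move=> [gg gc gx] [gg' gc' gx']; split.
- exact: (@lcomb_graded k B (P i) (shift j N)).
- exact: lcomb_cocycle.
- apply: is_class_ext (is_class_lcomb a gx gx') => y //.
Qed.

Lemma rep_uniq (N : grMod B) (i j : int) (g : {linear P i -> N}) (x x' : ExtGr i j M N) :
  rep g x -> rep g x' -> x = x'.
Proof.
move=> gx gx'; apply/(rep_eq gx gx'); exists (lin0 _ _); first exact: hdeg0.
by move=> y; rewrite subrr.
Qed.

Lemma rep_ext (N : grMod B) (i j : int) (g g' : {linear P i -> N}) (x : ExtGr i j M N) :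
  rep g x -> (forall u, g u = g' u) -> rep g' x.
Proof.
move=> [gg gc gx] e; split=> [a u Pu|u|].
- by rewrite -e; exact: gg.
- by rewrite -e.
- by apply: is_class_ext gx => u /=.
Qed.

(** The Yoneda product can be computed with chain maps of any resolution. *)
Lemma rep_mul (i1 j1 i2 j2 i j : int) (ei : i = i1 + i2) (ej : j = j1 + j2)
  (g : {linear P i1 -> M}) (f : {linear P i2 -> M}) (F : forall n m, {linear P n -> P m})
  (x : ExtGr i1 j1 M M) (y : ExtGr i2 j2 M M) :
  rep g x -> rep f y -> is_lift j2 f F -> rep (g \o F i i1) (ext_mul ei ej x y).
Proof.
move=> [gg gc gx] [fg fc fy] FL.
have F'L := lift_compL (lift_compR FL betaL) alphaL.
have c := yonedaE ei ej gx fy F'L.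
have gFg : hdeg j (g \o F i i1).
  apply: hdeg_comp gg _; last by rewrite ej addrC.
  by move=> a u; exact: (lift_graded FL ei).
have gFc := comp_cocycle FL gc ei.
have gFbg : hdeg j ((g \o F i i1) \o beta i i).
  by apply: hdeg_comp (@beta_hdeg i) gFg _; rewrite add0r.
split=> //.
have [u ug uE] := lift_uniq (lift_compL alphaL betaL) (id_fam_lift P) gg gc (z i1).
pose h := u \o (F (i - 1) (i1 - 1) \o beta (i - 1) (i - 1)).
apply: (is_class_cob (h := h) c gFbg (comp_cocycle betaL gFc (z i))).
  rewrite /h ej [j1 + j2]addrC; rewrite addr0 in ug.
  apply: hdeg_comp ug erefl; rewrite -[j2]add0r.
  apply: hdeg_comp (@beta_hdeg _) _ erefl => a v; apply: (lift_graded FL).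
  by rewrite ei addrAC.
move=> v; rewrite /= -(lift_comm betaL _ (z i)) -(lift_comm FL _ ei) -uE id_famE.
by [].
Qed.

Lemma rep_one : rep (pr_aug P) (ext_one M).
Proof.
split; [by apply/graded_hdeg; exact: pr_aug_graded | exact: aug_cocycle |].
by apply: is_class_ext (ext_oneE M) => u; rewrite /= (lift_aug betaL).
Qed.
End ExtRepresentatives.

(** * Exactness of the dual complex, from a perfect pairing *)

Section DualExactness.
Variables (k : fieldType) (B : connGrAlg k) (c : freeRes B) (d : int).
Local Notation P := (fr_obj c).
Local Notation X := (fr_X c).
Local Notation D := (fr_d c).
Local Notation dgr := (@fr_dg k B c _).
Local Notation reg := (regMod B).
Local Notation triv := (trivMod B).

Lemma fr_dd i j l x : D j l (D i j x) = 0.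
Proof. exact: (@pr_dd k B _ (toRes c)). Qed.
Lemma fr_d_hdeg i j : hdeg 0 (D i j).
Proof. by apply/graded_hdeg; exact: fr_d_graded. Qed.
Lemma fr_aug_hdeg : hdeg 0 (fr_aug c).
Proof. by apply/graded_hdeg; exact: fr_aug_graded. Qed.
Lemma fr_aug_mini (u : P 0) : fr_aug c u = 0 -> mini (@fr_dg k B c 0) u.
Proof. by move=> /fr_exact0[y <-]; exact: fr_min. Qed.
Lemma fr_triv_d i j (g : {linear P j -> triv}) u : g (D i j u) = 0.
Proof. by apply: mini_triv; exact: fr_min. Qed.

(** Exactness at [Hom (P i, reg)], in degree [j], of the complex dual to [P];
    at [i = d] its homology is [k], detected by [eps]. *)
Definition dual_exact (i j : int) : Prop :=
  forall (i0 : int) (w : {linear P i -> reg}), i = i0 + 1 -> hdeg j w ->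
  (forall n u, w (D n i u) = 0) -> (i = d -> forall u, eps (w u) = 0) ->
  exists2 s : {linear P i0 -> reg}, hdeg j s & forall u, w u = s (D i i0 u).

(** The coordinates of a cocycle are cocycles; only finitely many of them are
    nonzero, so that the cochains found for them define a map. *)
Lemma dual_exact_free (Y : choiceType) (dY : Y -> int) (sy : seq Y) (i i0 j : int)
  (w : {linear P i -> freeMod B dY}) :
  (forall y, y \in sy -> dual_exact i (j - dY y)) ->
  i = i0 + 1 -> hdeg j w -> (forall n u, w (D n i u) = 0) ->
  (i = d -> forall u, mini dY (w u)) ->
  (forall u y, y \notin sy -> cf y (w u) = 0) ->
  exists2 s : {linear P i0 -> freeMod B dY}, hdeg j s & forall u, w u = s (D i i0 u).
Proof.
move=> ex iE wg wc wm wsup.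
have /choice[s_ sP] y : exists s : {linear P i0 -> reg}, y \in sy ->
    hdeg (j - dY y) s /\ forall u, cf y (w u) = s (D i i0 u).
  have [ys|_] := boolP (y \in sy); last by exists (lin0 _ _).
  have [||u|s sg sE] := ex y ys i0 (coefL dY y \o w) iE.
  - by apply: hdeg_comp wg (@coefL_hdeg _ _ _ _ _) _.
  - by move=> n u /=; rewrite wc cf0.
  - by move=> v /=; rewrite wm.
  by exists s.
have sl : linear (fun u => \sum_(y <- undup sy) (s_ y u : B) *: U dY y).
  move=> a u v; rewrite scaler_sumr -big_split; apply: eq_bigr => y _.
  by rewrite linearP scalerDl scalerA.
have slE u : mklin sl u = \sum_(y <- undup sy) (s_ y u : B) *: U dY y by [].
exists (mklin sl) => [a u Pu|u]; rewrite slE.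
  apply: gm_sum => y; rewrite mem_undup => ys; have [sg _] := sP y ys.
  apply: (gmZ (i := a + (j - dY y)) (j := dY y)); [exact: sg | exact: U_comp |].
  by rewrite -addrA subrK.
rewrite [LHS](@cf_seq _ _ _ _ (undup sy)) ?undup_uniq //; last first.
  by move=> y; rewrite mem_undup; exact: wsup.
by apply: eq_big_seq => y; rewrite mem_undup => /sP[_ ->].
Qed.

(** The family of maps that is [z] in position [(n0, m0)] and zero elsewhere. *)
Definition at_pos (M N : int -> grMod B) (n0 m0 : int) (z : {linear M n0 -> N m0})
    (n m : int) : {linear M n -> N m} :=
  match n0 =P n with
  | ReflectT e => ecast n {linear M n -> N m} e
      (match m0 =P m with
       | ReflectT e => ecast m {linear M n0 -> N m} e z
       | ReflectF _ => lin0 _ _ end)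
  | ReflectF _ => lin0 _ _
  end.
Lemma at_posE M N n0 m0 z : @at_pos M N n0 m0 z n0 m0 = z.
Proof.
rewrite /at_pos; case: eqP => // e; rewrite (eq_axiomK e) /=.
by case: eqP => // e'; rewrite (eq_axiomK e').
Qed.
Lemma at_pos0 M N n0 m0 z n m u : m <> m0 -> @at_pos M N n0 m0 z n m u = 0.
Proof.
move=> mm; rewrite /at_pos; case: eqP => // e.
by case: n / e u => u; case: eqP => // e; case: mm.
Qed.

(** A cocycle into [P 0] is a chain map, zero in the other degrees. *)
Lemma cocycle_lift (i j : int) (z : {linear P i -> P 0}) : hdeg j z ->
  (forall n u, z (D n i u) = 0) ->
  is_lift (P := toRes c) (Q := toRes c) j (fr_aug c \o z) (at_pos (M := P) (N := P) z).
Proof.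
move=> zg zc; split=> [n m nm a u Pu|u|n m u nm].
- have [m0|/eqP m0] := eqVneq m 0; last by rewrite at_pos0 //; exact: gm0.
  have {nm} ni : n = i by rewrite nm m0 add0r.
  by subst n m; rewrite at_posE; exact: zg.
- by rewrite /= at_posE.
- have [m0|/eqP m0] := eqVneq m 0.
    rewrite [LHS](@fr_neg0 _ _ c) ?m0 // [RHS](@fr_neg0 _ _ c) //.
  rewrite at_pos0 // linear0; have [m1|/eqP m1] := eqVneq (m - 1) 0; last by rewrite at_pos0.
  have ni : n - 1 = i by rewrite nm addrAC m1 add0r.
  by move: (m - 1) (n - 1) m1 ni => m' n' -> ni; subst n'; rewrite at_posE zc.
Qed.

Hypothesis top : forall i, d < i -> X i -> False.
Variable e : X d.
Hypothesis e_uniq : forall x, x = e.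
Hypothesis fin : forall i, exists s : seq (X i), forall x, x \in s.

Lemma above_top i (u : P i) : d < i -> u = 0.
Proof. by move=> di; apply: cf_eq => x; case: (top di x). Qed.
Lemma d_top n i u : d <= i -> D n i u = 0.
Proof.
move=> di; have [ni|/eqP ni] := eqVneq n (i + 1); last by rewrite fr_shape.
by rewrite (above_top u) ?linear0 // ni; lia.
Qed.

(** The product of the classes of [g : P a -> triv] and [f : P b -> triv] is
    determined by the value of [g] at [F e].  So [pairing_inj] says that a class
    whose products with all of [Ext^a] vanish is zero, and [pairing_surj] that
    every functional on [Ext^a], given by an element [v], is the product with
    some class. *)
Definition pairing_inj := forall (b a j : int) (f : {linear P b -> triv})
  (F : forall n m, {linear P n -> P m}), d = a + b -> hdeg j f ->
  is_lift (P := toRes c) (Q := toRes c) j f F ->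
  mini dgr (F d a (U dgr e)) -> forall u, f u = 0.
Definition pairing_surj := forall (a b n : int) (v : P a), d = a + b -> gm_comp n v ->
  exists (f : {linear P b -> triv}) (F : forall n m, {linear P n -> P m}),
  [/\ hdeg (n - dgr e) f,
      is_lift (P := toRes c) (Q := toRes c) (n - dgr e) f F &
      mini dgr (F d a (U dgr e) - v)].

(** The differential of a generator of degree at most 0 would have scalar, hence
    zero, coefficients; by minimality no generator is a cycle. *)
Lemma gen1_pos (x : X 1) : 0 < dgr x.
Proof.
rewrite ltNge; apply/negP => x0.
have [x0' [x0'E dg0]] := fr_base c.
have : D 1 0 (U dgr x) = 0.
  apply: cf_eq => y; rewrite cf0 (x0'E y).
  have := cf_comp x0' (fr_d_graded (f := c) (i := 1) (j := 0) (U_comp B dgr x)).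
  rewrite dg0 subr0; have [xn|xp] := ltP (dgr x) 0; first exact: ga_neg.
  have -> : dgr x = 0 by lia.
  by move=> /eps_deg0 ->; rewrite (@fr_min _ _ c 1 0) scale0r.
move=> /(fr_exact (f := c) (l := 2) _)[]// y yE.
have := @fr_min _ _ c 2 1 y x; rewrite yE cfUU eps1 => /eqP.
by rewrite oner_eq0.
Qed.

Section FromPairing.
Hypothesis pinj : pairing_inj.
Hypothesis psurj : pairing_surj.

(** Write [z = D y].  At the top, subtract from [y] a chain map with the same value
    at [e] modulo [B_(>= 1)]: the difference [kp] is the required cocycle.  Below
    the top, the induction hypothesis applies to [y D], one step higher; the
    cocycle that it provides is a coboundary [s D], and [kp] is [y] corrected by
    the chain map and by [D s]. *)
Lemma correction (b : int) : (forall i j, b + 1 < i -> dual_exact i j) ->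
  forall (N : nat) (q q0 t t0 j : int) (z : {linear P q -> P t0}),
  d = q + N%:Z -> q = t + b -> t = t0 + 1 -> q = q0 + 1 -> 0 <= t0 ->
  hdeg j z -> (forall n u, z (D n q u) = 0) -> (forall u, exists p, D t t0 p = z u) ->
  exists (f : {linear P b -> triv}) (F : forall n m, {linear P n -> P m})
    (kp : {linear P q -> P t}),
  [/\ hdeg j f, is_lift (P := toRes c) (Q := toRes c) j f F,
     hdeg j kp /\ (forall n u, kp (D n q u) = 0),
     (q = d -> forall u, mini dgr (kp u)) &
     forall u, z u = F q0 t0 (D q q0 u) + D t t0 (kp u)].
Proof.
move=> IHex; elim=> [|N IH] q q0 t t0 j z qd qE tE q0E t00 zg zc zim.
  have {}qd : q = d by rewrite qd addr0.
  move: z zg zc zim qE q0E; rewrite {q}qd => z zg zc zim qE q0E.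
  have [y yg yE] := proj_lift (@fr_projective _ _ c d) (@fr_d_graded _ _ c t t0) zg zim.
  have [f [F [fg FL Fm]]] := psurj qE (yg _ _ (U_comp B dgr e)).
  have jE : dgr e + j - dgr e = j by lia.
  rewrite jE in fg FL.
  exists f, F, (y \- F d t); split=> //.
  - split=> [|n u]; last by rewrite d_top ?lexx // linear0.
    by apply: hdegB => // a u; exact: (lift_graded FL qE).
  - move=> _; apply: mini_linU => x; rewrite (e_uniq x) /=.
    by have := ssZ (-1) Fm; rewrite scaleN1r opprB.
  - move=> u /=; rewrite linearB /= yE.
    have := @lift_commE _ _ _ _ (toRes c) (toRes c) _ _ _ _ _ _ _ _ u FL qE tE q0E.
    by rewrite /= => ->; rewrite addrC subrK.
have [y yg yE] := proj_lift (@fr_projective _ _ c q) (@fr_d_graded _ _ c t t0) zg zim.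
have z'c n u : (y \o D (q + 1) q) (D n (q + 1) u) = 0 by rewrite /= fr_dd linear0.
have z'im u : exists p, D (t + 1) t p = (y \o D (q + 1) q) u.
  apply/(fr_exact (f := c) (i := t) (j := t0) (l := t + 1)) => //; first lia.
  by rewrite /= yE zc.
have z'g : hdeg j (y \o D (q + 1) q).
  by apply: hdeg_comp (@fr_d_hdeg _ _) yg _; rewrite add0r.
have [|||||f [F [kp [fg FL [kg kc] km kE]]]] := IH (q + 1) q (t + 1) t j (y \o D (q + 1) q) _ _ _ _ _ z'g z'c z'im; try lia.
have [st stP] := fin (t + 1).
have [||||||s sg sE] := @dual_exact_free _ _ st (q + 1) q j kp; try by [].
- by move=> x _; apply: IHex; lia.
- by move=> u x; rewrite stP.
exists f, F, ((y \- F q t) \- (D (t + 1) t \o s)); split=> //.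
- split.
    apply: hdegB; first by apply: hdegB => // a u; exact: (lift_graded FL qE).
    by apply: hdeg_comp sg (@fr_d_hdeg _ _) _; rewrite addr0.
  move=> n u; have [nE|/eqP nE] := eqVneq n (q + 1); last by rewrite fr_shape ?linear0.
  subst n; rewrite /= -sE; have := kE u; rewrite /= => ->.
  by rewrite [X in X - _ - _]addrC addrK subrr.
- lia.
- move=> u /=; rewrite !linearB /= fr_dd subr0 yE.
  have := @lift_commE _ _ _ _ (toRes c) (toRes c) _ _ _ _ _ _ _ _ u FL qE tE q0E.
  by rewrite /= => ->; rewrite addrC subrK.
Qed.

(** By descending induction on [i].  A cocycle [w] from [P i] to [B], that is, to
    [P 0], is a chain map.  The functional that it lifts is zero, by the injectivity
    of the pairing if [i < d] and by assumption if [i = d].  So [w] takes its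
    values in boundaries, and [correction] writes it as [F D + D kp] with a cocycle
    [kp] from [P i] to [P 1].  Generators of [P 1] have positive degree, so the
    coordinates of [kp] have a lower degree than [w], and [kp] is a coboundary by
    induction on the degree. *)
Lemma dual_exact_of_pairing i j : dual_exact i j.
Proof.
suff H (N : nat) : forall i j, d < i + N%:Z -> dual_exact i j.
  by apply: (H `|d - i|.+1); lia.
elim: N => [|N IH] {}i {}j.
  rewrite addr0 => di i0 w _ _ _ _; exists (lin0 _ _); first exact: hdeg0.
  by move=> u; rewrite (above_top u di) linear0.
move=> dN; have [dN'|iN] := ltP d (i + N%:Z); first exact: IH.
have {dN iN} iN : d = i + N%:Z by lia.
have [x0 [x0E dg0]] := fr_base c.
have [Mx MxP] : exists Mx : int, forall x : X i, dgr x <= Mx.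
  have [s sP] := fin i; exists (\sum_(x <- s) `|dgr x|) => x.
  apply: le_trans (ler_norm _) _; rewrite (big_rem x) ?sP //= lerDl.
  by apply: sumr_ge0 => y _.
(* In degrees below [- Mx] every map from [P i] to [B] is zero. *)
suff Hj (J : nat) : forall j, Mx + j < J%:Z -> dual_exact i j.
  by apply: (Hj `|Mx + j|.+1); lia.
elim: J => [|J IHj] {}j jJ i0 w iE wg wc wm.
  exists (lin0 _ _); first exact: hdeg0.
  move=> u; transitivity (lin0 (P i) reg u) => //.
  apply: free_eqP => x; rewrite [RHS]/=.
  by apply: ga_neg (wg _ _ (U_comp B dgr x)); have := MxP x; lia.
have il : linear (fun a : reg => (a : B) *: U dgr x0 : P 0).
  by move=> a u v; rewrite scalerDl scalerA.
pose z : {linear P i -> P 0} := mklin il \o w.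
have zE u : z u = (w u : B) *: U dgr x0 by [].
have zg : hdeg j z.
  move=> a u Pu; rewrite zE; apply: (gmZ (i := a + j) (j := 0)).
  - exact: wg.
  - by have := U_comp B dgr x0; rewrite dg0.
  - by rewrite addr0.
have zc n u : z (D n i u) = 0 by rewrite zE wc scale0r.
have zaug u : fr_aug c (z u) = 0.
  have [id|/eqP id] := eqVneq i d.
    rewrite zE linearZ; apply: tau_inj; rewrite tauZ wm //.
    by rewrite mul0r.
  have fg : hdeg j (fr_aug c \o z) by apply: hdeg_comp zg fr_aug_hdeg _; rewrite addr0.
  apply: (@pinj i (d - i) j (fr_aug c \o z) _ _ fg (cocycle_lift zg zc)); first lia.
  rewrite at_pos0; first exact: ss0.
  lia.
have zim u : exists p, D 1 0 p = z u by apply/fr_exact0; exact: zaug.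
have IHex i' j' : i0 + 1 < i' -> dual_exact i' j' by move=> h; apply: IH; lia.
have [||||f [F [kp [fg FL [kg kc] km kE]]]] := correction IHex (N := N) (q := i)
  (q0 := i0) (t := 1) (t0 := 0) (j := j) _ _ _ iE _ zg zc zim; try lia.
have [s1 s1P] := fin 1.
have [||||||s sg sE] := @dual_exact_free _ _ s1 i i0 j kp; try by [].
- by move=> x _; apply: IHj; have := gen1_pos x; lia.
- by move=> u x; rewrite s1P.
exists (coefL dgr x0 \o (F i0 0 \+ (D 1 0 \o s))).
  apply: (@hdeg_comp _ _ _ _ _ j (- dgr x0)); first 1 last.
  - exact: coefL_hdeg.
  - by rewrite dg0 oppr0 addr0.
  apply: hdegD; first by move=> a u; apply: (lift_graded FL); rewrite add0r.
  by apply: hdeg_comp sg (@fr_d_hdeg _ _) _; rewrite addr0.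
move=> u; have := kE u; rewrite sE zE => /(congr1 (cf x0)).
by rewrite cfZ cfUU mulr1.
Qed.
End FromPairing.
End DualExactness.

(** * The Ext-algebra of the trivial module *)

Section ExtOfTrivial.
Variables (k : fieldType) (B : connGrAlg k) (c : freeRes B).
Local Notation P := (fr_obj c).
Local Notation X := (fr_X c).
Local Notation D := (fr_d c).
Local Notation dgr := (@fr_dg k B c _).
Local Notation triv := (trivMod B).
Local Notation H := (ExtAlg triv).

(** As [P] is minimal, a class in [H] is the same as a homogeneous functional
    on the generators of [P]. *)
Definition hrep (i j : int) (g : {linear P i -> triv}) (x : H i j) : Prop :=
  rep (P := toRes c) g (x : ExtGr i j triv triv).

Lemma hrep_ex i j (g : {linear P i -> triv}) : hdeg j g -> exists x, @hrep i j g x.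
Proof. by move=> gg; apply: rep_ex => // u; exact: fr_triv_d. Qed.

Lemma hrep_surj i j (x : H i j) : exists g, hrep g x.
Proof. exact: (@rep_surj k B triv (toRes c) triv i j x). Qed.

Lemma hrep_hdeg i j g (x : H i j) : hrep g x -> hdeg j g.
Proof. by case. Qed.

Lemma hrep_eq i j g g' (x x' : H i j) : hrep g x -> hrep g' x' ->
  x = x' <-> forall u, g u = g' u.
Proof.
move=> gx gx'; apply: iff_trans (rep_eq gx gx') _; split=> [[u _ uE] y|e].
  by apply/eqP; rewrite -subr_eq0 uE fr_triv_d.
by exists (lin0 _ _); [exact: hdeg0 | move=> y; rewrite e subrr].
Qed.

Lemma hrep_lcomb i j (a : k) g g' (x x' : H i j) : hrep g x -> hrep g' x' ->
  hrep (lcomb a g g') (a *: x + x').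
Proof. exact: rep_lcomb. Qed.

Lemma hrep0 i j : @hrep i j (lin0 _ _) 0.
Proof.
have [x gx] := @hrep_ex i j (lin0 _ _) (@hdeg0 _ _ _ _ _).
have := hrep_lcomb (-1) gx gx; rewrite scaleN1r addNr => h.
by apply: rep_ext h _ => u; rewrite /= scaler0 addr0.
Qed.

Lemma hrep_eq0 i j g (x : H i j) : hrep g x -> x = 0 <-> forall u, g u = 0.
Proof. by move=> gx; apply: iff_trans (hrep_eq gx (hrep0 i j)) _. Qed.

Lemma hrep_basis i j g (x : H i j) : hrep g x -> (forall y, g (U dgr y) = 0) -> x = 0.
Proof.
move=> gx g0; apply/(hrep_eq0 gx) => u.
by transitivity (lin0 (P i) triv u) => //; apply: free_eqP => y; rewrite g0.
Qed.

Lemma hrep_mul i1 j1 i2 j2 i j (ei : i = i1 + i2) (ej : j = j1 + j2)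
  (g : {linear P i1 -> triv}) (f : {linear P i2 -> triv}) F (x : H i1 j1) (y : H i2 j2) :
  hrep g x -> hrep f y -> is_lift (P := toRes c) (Q := toRes c) j2 f F ->
  hrep (g \o F i i1) (bg_mul ei ej x y).
Proof. exact: rep_mul. Qed.

Lemma hrep_lift i j g (x : H i j) : hrep g x ->
  exists F, is_lift (P := toRes c) (Q := toRes c) j g F.
Proof.
move=> [gg gc _]; exact: (@lift_ex k B triv triv (toRes c) (toRes c) i j g gg gc).
Qed.

Definition hfun i j (x : H i j) : {linear P i -> triv} := projT1 (cid (hrep_surj x)).
Lemma hfunP i j (x : H i j) : hrep (hfun x) x.
Proof. by rewrite /hfun; case: cid. Qed.
Lemma hfunE i j g (x : H i j) u : hrep g x -> hfun x u = g u.
Proof. by move=> gx; exact: ((hrep_eq (hfunP x) gx).1 erefl). Qed.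
Lemma hfun_lin i j (a : k) (x x' : H i j) u :
  tau (hfun (a *: x + x') u) = a * tau (hfun x u) + tau (hfun x' u).
Proof.
rewrite (hfunE u (hrep_lcomb a (hfunP x) (hfunP x'))) /=.
by rewrite tauD tauZ epsA.
Qed.
Lemma hfun_linear i j (u : P i) : linear (fun x : H i j => tau (hfun x u) : k^o).
Proof. by move=> a x x'; rewrite hfun_lin. Qed.

Definition hval i j (u : P i) : {linear H i j -> k^o} := mklin (@hfun_linear i j u).
Lemma hvalE i j u (x : H i j) : hval j u x = tau (hfun x u).
Proof. by []. Qed.

Lemma hvalZ i j u (a : k) (x : H i j) : hval j u (a *: x) = a * tau (hfun x u).
Proof. by rewrite linearZ. Qed.

(** The class of the functional dual to the generator [y]. *)
Definition hcoord i (y : X i) : H i (- dgr y) := projT1 (cid (hrep_ex (@tcoord_hdeg k B _ (@fr_dg k B c i) y))).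
Lemma hcoordP i (y : X i) : hrep (tcoord dgr y) (hcoord y).
Proof. by rewrite /hcoord; case: cid. Qed.
Lemma hcoord_neq0 i (y : X i) : hcoord y <> 0.
Proof.
move=> /(hrep_eq0 (hcoordP y))/(_ (U dgr y))/(congr1 (@tau k B)).
by rewrite tau_tcoord cfUU eps1 tau0 => /eqP; rewrite oner_eq0.
Qed.

Lemma hom_neq0 i j (x : H i j) : x <> 0 -> exists y : X i, dgr y = - j.
Proof.
move=> x0; apply: contrapT => ny; apply: x0; apply: (hrep_basis (hfunP x)) => y.
apply: hdeg_triv (hrep_hdeg (hfunP x)) _; apply/eqP => e; apply: ny; exists y.
by apply/eqP; rewrite -addr_eq0 e.
Qed.

Lemma aug_base (x : X 0) : tau (fr_aug c (U dgr x)) != 0.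
Proof.
have [x0 [x0E _]] := fr_base c; rewrite (x0E x).
apply/eqP => /tau_inj h.
have := @fr_aug_mini k B c (U dgr x0) h x0.
by rewrite cfUU eps1 => /eqP; rewrite oner_eq0.
Qed.

Lemma hone_val (x : X 0) : tau (hfun (bg_one H) (U dgr x)) != 0.
Proof. by rewrite (hfunE _ (rep_one (toRes c))); exact: aug_base. Qed.

Section Finiteness.
Hypothesis HF : bg_findim H.

(** The functionals dual to distinct generators of degree [- j] are linearly
    independent in [H i j]. *)
Lemma gens_in_degree i j : exists s : seq (X i), forall x, dgr x = - j -> x \in s.
Proof.
have [n [b bP]] := HF.1 i j; apply: (@finite_of_bound _ _ n) => s us sj.
rewrite leqNgt; apply/negP => ns.
have s0 : exists x0 : X i, x0 \in s by case: (s) ns => // x0 ? _; exists x0; rewrite inE eqxx.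
have [x0 _] := s0.
pose v (r : 'I_n.+1) := nth x0 s r.
have vs r : v r \in s by apply: mem_nth; exact: leq_trans (ltn_ord r) ns.
have tg r : hdeg j (tcoord (B := B) (@fr_dg k B c i) (v r)).
  by apply: hdeg_eq (@tcoord_hdeg _ _ _ _ _) _; rewrite sj // opprK.
have /choice[w wP] r := hrep_ex (tg r).
have [r|a [r ar] e] := @lin_dep k (H i j) n b w.
  by have [cc ->] := bP (w r); exists cc.
have := congr1 (hval j (U dgr (v r))) e; rewrite linear0 linear_sum (bigD1 r) //.
rewrite hvalZ (hfunE _ (wP r)) tau_tcoord cfUU eps1 mulr1 big1 => [h|q qr].
  by case/eqP: ar; rewrite -[LHS]addr0; exact: h.
rewrite hvalZ (hfunE _ (wP q)) tau_tcoord cfU.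
have -> : (v r == v q) = false; last by rewrite eps0 mulr0.
apply: contraNF qr; rewrite nth_uniq //; [by rewrite eq_sym|..];
  exact: leq_trans (ltn_ord _) ns.
Qed.

Lemma gens_finite i : exists s : seq (X i), forall x, x \in s.
Proof.
have [_ [n nP]] := HF.
have /choice[s sP] j := gens_in_degree i j.
have xn (x : X i) : (`|dgr x| <= n)%N.
  rewrite leqNgt; apply/negP => h; apply: (hcoord_neq0 (y := x)).
  by apply: nP; rewrite abszN h orbT.
exists (flatten [seq s (- r%:Z) ++ s r%:Z | r <- iota 0 n.+1]) => x.
apply/flattenP; exists (s (- `|dgr x|%:Z) ++ s `|dgr x|%:Z).
  by apply/mapP; exists `|dgr x|%N => //; rewrite mem_iota ltnS xn.
rewrite mem_cat; have [x0|x0] := leP 0 (dgr x).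
  by rewrite sP // opprK; lia.
by rewrite [X in _ || X]sP ?orbT //; lia.
Qed.
End Finiteness.
End ExtOfTrivial.
Arguments hfun {k B c i j} x.
Arguments hfunP {k B c i j} x.
Arguments hval {k B c i} j u.

Lemma linear_funext (K : pzRingType) (U V : lmodType K) (f g : {linear U -> V}) :
  (forall x, f x = g x) -> f = g.
Proof.
case: f g => f cf [g cg] /= /funext e; rewrite /= in e; subst g.
congr GRing.Linear.Pack.
case: cf cg => [[a] [b]] [[a'] [b']].
by rewrite (Prop_irrelevance a a') (Prop_irrelevance b b').
Qed.

(** * The pairing defined by a Frobenius isomorphism *)

Section FrobeniusPairing.
Variables (k : fieldType) (B : connGrAlg k) (c : freeRes B).
Local Notation P := (fr_obj c).
Local Notation X := (fr_X c).
Local Notation dgr := (@fr_dg k B c _).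
Local Notation triv := (trivMod B).
Local Notation H := (ExtAlg triv).
Variables (l dd : int) (phi : forall i j, H (i + l) (j + dd) -> gdual H i j).
Hypotheses (phiI : linear_iso phi) (phiL : left_linear phi).

Let phi_lin i j a x x' y : phi (a *: x + x') y = a * @phi i j x y + phi x' y.
Proof. exact: phiI.1. Qed.
Let phi0 i j y : @phi i j 0 y = 0.
Proof.
have /eqP := phi_lin 1 0 0 y; rewrite scaler0 addr0 mul1r => /eqP e.
by apply: (@addrI _ (@phi i j 0 y)); rewrite addr0.
Qed.
Let phi_inj0 i j x : (forall y, @phi i j x y = 0) -> x = 0.
Proof.
move=> h; apply: (bij_inj (phiI.2 i j)); apply: linear_funext => y.
by rewrite h phi0.
Qed.
Let phi_surj i j (f : {linear H (- i) (- j) -> k^o}) : exists x, @phi i j x = f.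
Proof. by have [g _ gK] := phiI.2 i j; exists (g f). Qed.

(** The class dual to [x] pairs nontrivially with some element of [H (- i)]. *)
Let dual_gens i (x : X (i + l)) : exists y : X (- i), dgr y = - dgr x - dd.
Proof.
have tg : hdeg (- dgr x - dd + dd) (tcoord (B := B) (@fr_dg k B c (i + l)) x).
  by apply: hdeg_eq (@tcoord_hdeg _ _ _ _ _) _; rewrite subrK.
have [w wP] := hrep_ex tg.
have w0 : w <> 0.
  move=> /(hrep_eq0 wP)/(_ (U dgr x))/(congr1 (@tau k B)).
  by rewrite tau_tcoord cfUU eps1 tau0 => /eqP; rewrite oner_eq0.
have [h h0] : exists h, phi w h <> 0.
  apply: contrapT => nh; apply: w0; apply: phi_inj0 => y.
  by apply: contrapT => yn; apply: nh; exists y.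
have [|y yE] := @hom_neq0 k B c (- i) (- (- dgr x - dd)) h.
  by move=> e; apply: h0; rewrite e linear0.
by exists y; rewrite yE opprK.
Qed.

Lemma frob_top i : 0 + l < i -> X i -> False.
Proof.
move=> li x; have [i' iE] : exists i', i = i' + l by exists (i - l); rewrite subrK.
by subst i; have [y _] := dual_gens x; have := fr_neg y; lia.
Qed.

Lemma frob_deg (x : X (0 + l)) : dgr x = - dd.
Proof.
have [y] := dual_gens x; have [x0 [x0E dg0]] := fr_base c.
by move: y; rewrite oppr0 => y; rewrite (x0E y) dg0 => /esym/eqP;
  rewrite subr_eq0 => /eqP <-; rewrite opprK.
Qed.

Let top_deg (x : X (0 + l)) : hdeg (0 + dd) (tcoord (B := B) (@fr_dg k B c (0 + l)) x).
Proof. by apply: hdeg_eq (@tcoord_hdeg _ _ _ _ _) _; rewrite frob_deg; lia. Qed.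

Let wtop (x : X (0 + l)) : H (0 + l) (0 + dd) := projT1 (cid (hrep_ex (top_deg x))).
Let wtopP x : hrep (tcoord (@fr_dg k B c (0 + l)) x) (wtop x).
Proof. by rewrite /wtop; case: cid. Qed.

Let H00 (h : H 0 0) : exists a : k, h = a *: bg_one H.
Proof.
have [x0 [x0E dg0]] := fr_base c.
have u0 := hone_val x0; set t1 := tau _ in u0.
pose a := tau (hfun h (U dgr x0)) / t1; exists a; rewrite -[RHS]addr0.
apply/(hrep_eq (hfunP h) (hrep_lcomb a (hfunP (bg_one H)) (hrep0 c 0 0))) => u.
apply: (@free_eqP _ _ _ _ _ (hfun h) (lcomb a (hfun (bg_one H)) (lin0 _ _))) => y.
rewrite /= addr0 (x0E y); apply: tau_eq.
by rewrite tauZ epsA -/t1 divfK.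
Qed.

(** [phi] sends the classes dual to [x] and [y] to functionals on the line [H 0 0],
    so that these classes are proportional. *)
Lemma frob_uniq (x y : X (0 + l)) : x = y.
Proof.
apply/eqP; apply: contrapT => /negP xy.
pose t z := @phi 0 0 (wtop z) (bg_one H).
have Wz a b : (a != 0) || (b != 0) -> a *: wtop x + (b *: wtop y + 0) <> 0.
  move=> ab e.
  have h := hrep_lcomb a (wtopP x) (hrep_lcomb b (wtopP y) (hrep0 c _ _)).
  have /(hrep_eq0 h) e' := e.
  have := congr1 (@tau k B) (e' (U dgr x)); have := congr1 (@tau k B) (e' (U dgr y)).
  rewrite /= !(tauD, tauZ, epsA, tau_tcoord, cfU, tau0) !eqxx (eq_sym y x).
  rewrite (negPf xy) /= mulr1n mulr0n eps0 eps1 !(mulr0, mulr1, addr0, add0r).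
  by move=> b0 a0; rewrite a0 b0 eqxx in ab.
have z a b : a * t x + b * t y = 0 -> a *: wtop x + (b *: wtop y + 0) = 0.
  move=> e; apply: (@phi_inj0 0 0) => h; have [s ->] := H00 h.
  by rewrite linearZ phi_lin phi_lin phi0 addr0 -/(t x) -/(t y) e; exact: mulr0.
have [tx|tx] := eqVneq (t x) 0.
  by apply: (Wz 1 0); [rewrite oner_eq0 | apply: z; rewrite tx mulr0 mul0r addr0].
apply: (Wz (- t y) (t x)); first by rewrite tx orbT.
by apply: z; rewrite mulNr mulrC addNr.
Qed.

Lemma frob_nonempty : exists x : X (0 + l), True.
Proof.
have [x0 [x0E dg0]] := fr_base c.
have [w wE] := @phi_surj 0 0 (hval 0 (U dgr x0)).
have w0 : w <> 0.
  move=> w0; have := hone_val x0; rewrite -hvalE.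
  have : @phi 0 0 w (bg_one H) = 0 by rewrite w0 phi0.
  by rewrite wE => ->; rewrite eqxx.
by have [x _] := hom_neq0 c w0; exists x.
Qed.

Variable e : X (0 + l).
Let c0 : k := @phi 0 0 (wtop e) (bg_one H).

Let top_val (w : H (0 + l) (0 + dd)) g : hrep g w ->
  @phi 0 0 w (bg_one H) = c0 * tau (g (U dgr e)).
Proof.
move=> gw; have -> : w = tau (g (U dgr e)) *: wtop e + 0.
  apply/(hrep_eq gw (hrep_lcomb (tau (g (U dgr e))) (wtopP e) (hrep0 c _ _))) => u.
  apply: (@free_eqP _ _ _ _ _ g (lcomb (tau (g (U dgr e))) (tcoord dgr e) (lin0 _ _))) => y.
  rewrite /= addr0 (frob_uniq y e); apply: tau_eq.
  by rewrite tauZ epsA tau_tcoord cfUU eps1 mulr1.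
by rewrite phi_lin phi0 addr0 mulrC.
Qed.

Let c0_neq0 : c0 != 0.
Proof.
have [x0 [x0E dg0]] := fr_base c.
have [w wE] := @phi_surj 0 0 (hval 0 (U dgr x0)).
have := top_val (hfunP w); rewrite wE hvalE => E.
by have := hone_val x0; rewrite E mulf_eq0 negb_or => /andP[].
Qed.

(** As [phi] is left linear, [phi x h] is the value of [phi (h x)] at 1, and [c0]
    relates it to the value of the product at [e]. *)
Let phi_prod i j (x : H (i + l) (j + dd)) (f : {linear P (i + l) -> triv})
    (F : forall n m, {linear P n -> P m}) (h : H (- i) (- j)) g :
  hrep f x -> is_lift (P := toRes c) (Q := toRes c) (j + dd) f F -> hrep g h ->
  phi x h = c0 * tau (g (F (0 + l) (- i) (U dgr e))).
Proof.
move=> fx FL gh.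
have ei : - i + i + l = - i + (i + l) by rewrite addrA.
have ej : - j + j + dd = - j + (j + dd) by rewrite addrA.
have ei' : - i = - (- i + i) + - i by rewrite addNr oppr0 add0r.
have ej' : - j = - (- j + j) + - j by rewrite addNr oppr0 add0r.
have gF := hrep_mul ei ej gh fx FL.
have phiE y := phiL h x y ei ej ei' ej'.
move: phiE; move: (bg_mul ei ej h x) gF; move: ei' ej'.
have {ei ej} : - i + i = 0 by rewrite addNr.
have : - j + j = 0 by rewrite addNr.
move: (- i + i) (- j + j) => p q -> -> ei' ej' w gF phiE.
rewrite -(@bg_mul1l k H _ _ ei' ej' h) -[LHS]phiE.
exact: top_val gF.
Qed.

Lemma frob_inj : pairing_inj e.
Proof.
move=> b a j f F dE fg FL Fm u.
have [i aE] : exists i, a = - i by exists (- a); rewrite opprK.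
have [j' jE] : exists j', j = j' + dd by exists (j - dd); rewrite subrK.
have bE : b = i + l by lia.
subst a j b; have [x fx] := hrep_ex fg.
have x0 : x = 0; last exact: (hrep_eq0 fx).1 x0 u.
apply: phi_inj0 => h; rewrite (phi_prod fx FL (hfunP h)).
by rewrite (mini_triv _ Fm) tau0 mulr0.
Qed.

(** The class [x] is the one that [phi] sends to [c0] times the functional
    defined by [v]. *)
Lemma frob_surj : pairing_surj e.
Proof.
move=> a b n v dE vn.
have [i aE] : exists i, a = - i by exists (- a); rewrite opprK.
have bE : b = i + l by lia.
subst a b.
have cl : linear (fun h : H (- i) (- n) => c0 * tau (hfun h v) : k^o).
  by move=> a h h'; rewrite hfun_lin mulrDr mulrCA.
have [x xE] := @phi_surj i n (mklin cl).
have xP := hfunP (c := c) x; have [F FL] := hrep_lift xP.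
have nE : n - dgr e = n + dd by rewrite frob_deg opprK.
exists (hfun x), F; rewrite nE; split=> //; first exact: hrep_hdeg xP.
move=> y; rewrite cfB epsB -!(tau_tcoord (dg := @fr_dg k B c _)).
apply/eqP; rewrite subr_eq0; apply/eqP.
have [yn|yn] := eqVneq (dgr y) n; last first.
  rewrite [RHS](@triv_deg _ _ (n - dgr y)); first 1 last.
  - exact: (@tcoord_hdeg k B _ (@fr_dg k B c _) y).
  - by rewrite subr_eq0 eq_sym.
  apply: (@triv_deg _ _ (n - dgr y)); last by rewrite subr_eq0 eq_sym.
  apply: (@tcoord_hdeg k B _ (@fr_dg k B c _) y).
  have := lift_graded FL dE (U_comp B dgr e); rewrite /shift /= frob_deg.
  by rewrite (_ : - dd + (n + dd) = n) //; lia.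
have tg : hdeg (- n) (tcoord (B := B) (@fr_dg k B c (- i)) y).
  by apply: hdeg_eq (@tcoord_hdeg _ _ _ _ _) _; rewrite yn.
have [h hP] := hrep_ex tg.
have := phi_prod xP FL hP; rewrite xE /= (hfunE _ hP).
by move=> /(mulfI c0_neq0) <-.
Qed.
End FrobeniusPairing.

(** * Homogeneous components, quotients and coinduced modules *)

Section HomogeneousComponents.
Variables (k : fieldType) (B : connGrAlg k) (M : grMod B).

Let dec (x : M) : {sx : seq int * (int -> M) |
  [/\ uniq sx.1, forall j, gm_comp j (sx.2 j) & x = \sum_(j <- sx.1) sx.2 j]}.
Proof.
apply: cid; have [s [x_ [us xM e]]] := gr_span (gm_grading M) x.
by exists (s, x_).
Qed.

(** [hc j x] is the component of degree [j]; [hsupp x] is a duplicate-free list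
    outside of which it vanishes. *)
Definition hsupp (x : M) : seq int := (projT1 (dec x)).1.
Definition hc (j : int) (x : M) : M :=
  if j \in hsupp x then (projT1 (dec x)).2 j else 0.

Lemma hsupp_uniq x : uniq (hsupp x).
Proof. by rewrite /hsupp; case: (dec x) => -[s x_] []. Qed.
Lemma hc_comp j x : gm_comp j (hc j x).
Proof.
rewrite /hc /hsupp; case: (dec x) => -[s x_] [_ xM _] /=.
by case: ifP => _ //; exact: gm0.
Qed.
Lemma hc_sum x : x = \sum_(j <- hsupp x) hc j x.
Proof.
rewrite {1}(_ : x = \sum_(j <- hsupp x) (projT1 (dec x)).2 j).
  by apply: eq_big_seq => j js; rewrite /hc js.
by rewrite /hsupp; case: (dec x) => -[s x_] [].
Qed.

Lemma sum_extend (V : zmodType) (w u : seq int) (F : int -> V) : uniq w -> uniq u ->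
  {subset w <= u} -> \sum_(j <- w) F j = \sum_(j <- u) (if j \in w then F j else 0).
Proof.
move=> uw uu sub; rewrite -big_mkcond /= -[RHS]big_filter; apply: perm_big.
apply: uniq_perm => //; first by rewrite filter_uniq.
by move=> j; rewrite mem_filter; case: (boolP (j \in w)) => // /sub ->.
Qed.

Lemma hc_uniq (t : seq int) (y_ : int -> M) x : uniq t ->
  (forall j, gm_comp j (y_ j)) -> x = \sum_(j <- t) y_ j ->
  forall j, hc j x = if j \in t then y_ j else 0.
Proof.
move=> ut yM xE j; pose u := undup (hsupp x ++ t).
pose z_ i := hc i x - (if i \in t then y_ i else 0).
have uu : uniq u by exact: undup_uniq.
have [ju|ju] := boolP (j \in u); last first.
  move: ju; rewrite mem_undup mem_cat negb_or => /andP[js /negPf ->].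
  by rewrite /hc (negPf js).
apply/eqP; rewrite -subr_eq0; apply/eqP; rewrite -/(z_ j).
apply: (gr_indep (gm_grading M) uu) => // [i|].
  by apply: gmB; [exact: hc_comp | case: ifP => _ //; exact: gm0].
rewrite sumrB -(@sum_extend _ t u y_) //; last by move=> i it; rewrite mem_undup mem_cat it orbT.
rewrite -xE [X in _ - X]hc_sum.
rewrite [X in _ - X](@sum_extend _ _ u) ?hsupp_uniq //; last first.
  by move=> i it; rewrite mem_undup mem_cat it.
rewrite -sumrB big1 // => i _; case: ifP => [_|h]; first by rewrite subrr.
by rewrite /hc h subr0.
Qed.

Lemma hc_hom i j x : gm_comp i x -> hc j x = if j == i then x else 0.
Proof.
move=> xM; have := @hc_uniq [:: i] (fun l => if l == i then x else 0) x isT.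
move=> -> //; first by rewrite inE; case: eqP.
- by move=> l; case: eqP => [->|_] //; exact: gm0.
- by rewrite big_seq1 eqxx.
Qed.

Lemma hc_lin j (a : k) x y :
  hc j ((a%:A : B) *: x + y) = (a%:A : B) *: hc j x + hc j y.
Proof.
pose u := undup (hsupp x ++ hsupp y).
have := @hc_uniq u (fun l => (a%:A : B) *: hc l x + hc l y) ((a%:A : B) *: x + y)
  (undup_uniq _) => ->.
- case: ifPn => // ; rewrite mem_undup mem_cat negb_or => /andP[jx jy].
  by rewrite /hc (negPf jx) (negPf jy) scaler0 addr0.
- move=> l; apply: gmD; last exact: hc_comp.
  apply: (gmZ (i := 0) (j := l)); [|exact: hc_comp|by rewrite add0r].
  by apply/ga_conn; exists a.
rewrite big_split -scaler_sumr; congr (_ *: _ + _); rewrite [LHS]hc_sum.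
  rewrite (@sum_extend _ _ u) ?hsupp_uniq ?undup_uniq //; last first.
    by move=> i it; rewrite mem_undup mem_cat it.
  by apply: eq_bigr => i _; case: ifP => // h; rewrite /hc h.
rewrite (@sum_extend _ _ u) ?hsupp_uniq ?undup_uniq //; last first.
  by move=> i it; rewrite mem_undup mem_cat it orbT.
by apply: eq_bigr => i _; case: ifP => // h; rewrite /hc h.
Qed.

Lemma hsub_hc (S : subspace M) j x : hsub S -> S x -> S (hc j x).
Proof.
move=> hS /hS[s [x_ [us xM xE]]].
rewrite (hc_uniq us _ xE) => [|i]; last by case: (xM i).
by case: ifP => _; [case: (xM j) | exact: ss0].
Qed.
End HomogeneousComponents.

Section QuotientModule.
Variables (k : fieldType) (B : connGrAlg k) (M : grMod B) (S : subspace M).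
Hypothesis hS : hsub S.
Let comp (j : int) (q : ss_quot S) : Prop := exists2 x, gm_comp j x & ss_pi S x = q.

Fact quot_grading : is_grading comp.
Proof.
split=> [j|j q r [x xM <-] [y yM <-]|q|s q_ us qM sq j js].
- by exists 0; [exact: gm0 | rewrite linear0].
- by exists (x - y); [exact: gmB | rewrite linearB].
- rewrite -[q]ss_reprK; have [s [x_ [us xM ->]]] := gr_span (gm_grading M) (ss_repr q).
  exists s, (fun j => ss_pi S (x_ j)); split=> //; last by rewrite linear_sum.
  by move=> j; exists (x_ j).
have /choice[x_ xP] i : exists x, gm_comp i x /\ ss_pi S x = q_ i.
  by have [x] := qM i; exists x.
have Ss : S (\sum_(i <- s) x_ i).
  have : ss_pi S (\sum_(i <- s) x_ i) = ss_pi S 0.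
    rewrite linear0 linear_sum -[RHS]sq; apply: eq_bigr => i _.
    by case: (xP i).
  by move=> /ss_piE; rewrite subr0.
have := hsub_hc j hS Ss; rewrite (hc_uniq us _ erefl) => [|i]; last by case: (xP i).
rewrite js => Sx; have [_ <-] := xP j.
by rewrite -[RHS](linear0 (ss_pi S)); apply/ss_piE; rewrite subr0.
Qed.

Fact quot_act i j (a : B) q : ga_comp i a -> comp j q -> comp (i + j) (a *: q).
Proof.
by move=> Ba [x xM <-]; exists (a *: x); [exact: gm_act | rewrite linearZ].
Qed.
Definition quotMod : grMod B := GrMod quot_grading quot_act.
Definition quotPi : {linear M -> quotMod} := ss_pi S.

Lemma quotPi_graded : graded_map quotPi.
Proof. by move=> j x xM; exists x. Qed.
Lemma quotPi_surj : Defs.surj quotPi.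
Proof. by move=> q; exists (ss_repr q); exact: ss_reprK. Qed.
Lemma quotPi_ker x : quotPi x = 0 <-> S x.
Proof.
rewrite -[0](linear0 quotPi); apply: iff_trans (ss_piE S x 0) _.
by rewrite subr0.
Qed.
End QuotientModule.

(** The graded [k]-linear maps from [B] to [N], on which [B] acts through its
    right multiplication on itself; as [N] is recovered by evaluating at 1,
    this module is injective and contains [N]. *)
Section Coinduced.
Variables (k : fieldType) (B : connGrAlg k) (N : grMod B).
Local Notation V := (B -> resk N).

Definition cohom (j : int) (f : V) : Prop :=
  (forall (c : k) (a b : B), f (c *: a + b) = c *: f a + f b) /\
  forall n a, ga_comp n a -> gm_comp (n + j) (f a : N).

Fact cohom0 j : cohom j 0.
Proof.
split=> [c a b|n a _]; last exact: gm0.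
by rewrite scaler0 addr0.
Qed.
Lemma resk_comp (c : k) j (x : resk N) : gm_comp j (x : N) -> gm_comp j (c *: x : N).
Proof.
move=> xN; apply: (gmZ (i := 0) (j := j)) => //; last by rewrite add0r.
by apply/ga_conn; exists c.
Qed.
Fact cohomP j c f g : cohom j f -> cohom j g -> cohom j (c *: f + g).
Proof.
move=> [fl fg] [gl gg]; split=> [e a b|n a Ba].
  rewrite -[LHS]/(c *: f (e *: a + b) + g (e *: a + b)) fl gl.
  rewrite -[RHS]/(e *: (c *: f a + g a) + (c *: f b + g b)).
  by rewrite !scalerDr !scalerA mulrC addrACA.
by apply: gmD; [apply: resk_comp; exact: fg | exact: gg].
Qed.
Fact cohomB j f g : cohom j f -> cohom j g -> cohom j (f - g).
Proof. by move=> hf hg; rewrite addrC -scaleN1r; apply: cohomP. Qed.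

Fact coindP c f g : in_gr_sum cohom f -> in_gr_sum cohom g -> in_gr_sum cohom (c *: f + g).
Proof.
move=> [s [x_ [us xM ->]]]; apply: (in_gr_sumD cohom0 cohomB).
rewrite scaler_sumr; apply: (in_gr_sum_sum cohom0 cohomB) => i _.
apply: (@in_gr_sum1 _ _ cohom0 i); rewrite -[_ *: _]addr0.
by apply: cohomP => //; exact: cohom0.
Qed.
Definition coind_space : subspace V := Subspace (in_gr_sum0 cohom0) coindP.

Lemma coind_lin f : in_gr_sum cohom f ->
  forall (c : k) (a b : B), f (c *: a + b) = c *: f a + f b.
Proof.
move=> [s [x_ [us xM ->]]] c a b; rewrite !fct_sumE scaler_sumr -big_split.
by apply: eq_bigr => i _; have [->] := xM i.
Qed.

Let tr (b : B) (f : V) : V := fun a => f (a * b).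
Let tr_sum b (s : seq int) (F : int -> V) :
  tr b (\sum_(i <- s) F i) = \sum_(i <- s) tr b (F i).
Proof. by apply/funext => a; rewrite /tr !fct_sumE. Qed.

Let lin_sum (f : V) (s : seq int) (F : int -> B) : (forall (c : k) (a b : B),
  f (c *: a + b) = c *: f a + f b) -> f (\sum_(i <- s) F i) = \sum_(i <- s) f (F i).
Proof.
move=> fl; have f0 : f 0 = 0.
  have := fl 1 0 0; rewrite !scale1r addr0 => /eqP.
  by rewrite -subr_eq subrr eq_sym => /eqP.
apply: (big_morph f) => // a b; have := fl 1 a b; by rewrite !scale1r.
Qed.

Lemma cohom_tr i j b f : ga_comp i b -> cohom j f -> cohom (i + j) (tr b f).
Proof.
move=> Bb [fl fg]; split=> [c x y|n x Bx]; rewrite /tr.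
  by rewrite mulrDl -scalerAl fl.
by rewrite addrA; apply: fg; exact: ga_mul.
Qed.

Fact coind_tr b f : in_gr_sum cohom f -> in_gr_sum cohom (tr b f).
Proof.
move=> [s [x_ [_ xM ->]]]; have [t [b_ [_ bB ->]]] := gr_span (ga_grading B) b.
rewrite tr_sum; apply: (in_gr_sum_sum cohom0 cohomB) => j _.
have -> : tr (\sum_(i <- t) b_ i) (x_ j) = \sum_(i <- t) tr (b_ i) (x_ j).
  apply/funext => a; rewrite fct_sumE /tr mulr_sumr lin_sum //.
  by have [] := xM j.
apply: (in_gr_sum_sum cohom0 cohomB) => i _.
apply: (@in_gr_sum1 _ _ cohom0 (i + j)); exact: cohom_tr.
Qed.

Definition coind_type := ss_sub coind_space.
HB.instance Definition _ := GRing.Zmodule.on coind_type.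
Implicit Types (f g : coind_type).
Lemma coind_in f : in_gr_sum cohom (val f).
Proof. exact: (ss_predP _ _ (valP f)). Qed.
Definition coind_scale (b : B) f : coind_type :=
  Sub (tr b (val f)) (introT (ss_predP coind_space _) (coind_tr b (coind_in f))).
Lemma coind_scaleE b f a : val (coind_scale b f) a = val f (a * b).
Proof. by []. Qed.
Lemma coind_ext f g : (forall a, val f a = val g a) -> f = g.
Proof. by move=> h; apply: val_inj; apply/funext. Qed.
Lemma coind_add f g a : val (f + g) a = val f a + val g a.
Proof. by []. Qed.

Fact coind_scaleA a b f : coind_scale a (coind_scale b f) = coind_scale (a * b) f.
Proof. by apply: coind_ext => x; rewrite !coind_scaleE mulrA. Qed.
Fact coind_scale1 : left_id 1 coind_scale.
Proof. by move=> f; apply: coind_ext => x; rewrite coind_scaleE mulr1. Qed.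
Fact coind_scaleDr : right_distributive coind_scale +%R.
Proof. by move=> a f g; apply: coind_ext => x. Qed.
Fact coind_scaleDl f : {morph coind_scale^~ f : a b / a + b}.
Proof.
move=> a b; apply: coind_ext => x; rewrite coind_add !coind_scaleE mulrDr.
by have := coind_lin (coind_in f) 1 (x * a) (x * b); rewrite !scale1r.
Qed.
HB.instance Definition _ := GRing.Zmodule_isLmodule.Build B coind_type
  coind_scaleA coind_scale1 coind_scaleDr coind_scaleDl.

Let comp (j : int) f := cohom j (val f).
Fact coind_grading : is_grading comp.
Proof.
split=> [j|j f g hf hg|f|s f_ us fM sf j js].
- exact: cohom0.
- exact: cohomB.
- have [s [x_ [us xM e]]] := coind_in f.
  have xin j : in_gr_sum cohom (x_ j) by exact: (in_gr_sum1 cohom0 (xM j)).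
  exists s, (fun j => Sub (x_ j) (introT (ss_predP coind_space _) (xin j))); split=> //.
  by apply: val_inj; rewrite {1}e raddf_sum.
have z n a : ga_comp n a -> val (f_ j) a = 0.
  move=> Ba; have [_ _ _ H] := gm_grading (shift n N).
  apply: (H s (fun i => val (f_ i) a : N) us) => // [i|].
    by have [_ /(_ n a Ba)] := fM i; rewrite /= addrC.
  have /(congr1 (fun f => val f a)) := sf.
  by rewrite raddf_sum fct_sumE.
apply: coind_ext => a; have [t [a_ [_ aB ->]]] := gr_span (ga_grading B) a.
rewrite lin_sum; last exact: coind_lin (coind_in _).
by rewrite big1 // => i _; exact: z (aB i).
Qed.
Fact coind_act i j (b : B) f : ga_comp i b -> comp j f -> comp (i + j) (b *: f).
Proof. exact: cohom_tr. Qed.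
Definition coind : grMod B := GrMod coind_grading coind_act.

Let emb_fun (x : N) : V := fun a => (a : B) *: (x : N).
Let emb_cohom j x : gm_comp j x -> cohom j (emb_fun x).
Proof.
move=> xN; split=> [c a b|n a Ba]; last exact: gm_act.
have -> : c *: a = (c%:A : B) * a by rewrite -scalerAl mul1r.
by rewrite /emb_fun scalerDl -scalerA.
Qed.
Let emb_in x : in_gr_sum cohom (emb_fun x).
Proof.
have [s [x_ [_ xM ->]]] := gr_span (gm_grading N) x.
have -> : emb_fun (\sum_(j <- s) x_ j) = \sum_(j <- s) emb_fun (x_ j).
  by apply/funext => a; rewrite fct_sumE /emb_fun scaler_sumr.
apply: (in_gr_sum_sum cohom0 cohomB) => j _.
exact: (in_gr_sum1 cohom0 (emb_cohom (xM j))).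
Qed.
Let emb_f (x : N) : coind := Sub (emb_fun x) (introT (ss_predP coind_space _) (emb_in x)).
Fact coind_emb_linear : linear emb_f.
Proof.
move=> b x y; apply: coind_ext => a.
by rewrite -[LHS]/(a *: (b *: x + y)) -[RHS]/((a * b) *: x + a *: y) scalerDr scalerA.
Qed.
Definition coind_emb : {linear N -> coind} := mklin coind_emb_linear.
Lemma coind_emb_graded : graded_map coind_emb.
Proof. by move=> j x xN; exact: emb_cohom. Qed.
Lemma coind_emb_inj : injective coind_emb.
Proof.
move=> x y /(congr1 (fun f : coind => val f 1)).
by rewrite -[LHS]/(1 *: x) -[RHS]/(1 *: y) !scale1r.
Qed.
End Coinduced.

Section CoinducedInjective.
Variables (k : fieldType) (B : connGrAlg k) (N : grMod B).

(** A graded map to [coind N] amounts to a graded [k]-linear map to [N], its value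
    at 1, and graded [k]-linear maps extend. *)
Lemma coind_injective : injective_mod (coind N).
Proof.
move=> M L g f gg gi fg.
pose f1 (x : resk M) : resk N := val (f x) 1.
have f1_lin (c : k) x y : f1 (c *: x + y) = c *: f1 x + f1 y.
  rewrite /f1 -[c *: x + y]/((c%:A : B) *: (x : M) + y) linearP.
  rewrite -[LHS]/(val (f x) (1 * c%:A) + val (f y) 1) mul1r; congr (_ + _).
  have fl := coind_lin (coind_in (f x)).
  have f0 : val (f x) (0 : B) = 0.
    have := fl 1 0 0; rewrite !scale1r addr0 => /eqP.
    by rewrite -subr_eq subrr eq_sym => /eqP.
  by have := fl c 1 0; rewrite addr0 f0 addr0.
have f1_gr j x : gm_comp j (x : M) -> gm_comp j (f1 x : N).
  move=> /fg[_ h]; rewrite -[j]add0r; apply: h.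
  by apply/ga_conn; exists 1; rewrite scale1r.
have [S SP] : exists S : subspace (resk L), forall y, S y <-> exists x, g x = y.
  unshelve eexists (@Subspace k (resk L) (fun y => exists x, g x = y) _ _) => //.
    by exists 0; rewrite linear0.
  by move=> c u v [x <-] [y <-]; exists ((c%:A : B) *: x + y); rewrite linearP.
have /choice[r rP] (y : resk L) : exists x : resk M, S y -> g x = y.
  have [/SP[x <-]|ny] := pselect (S y); first by exists x.
  by exists 0.
have rg x : r (g x) = x by apply: gi; apply: rP; apply/SP; exists x.
have [Phi PhiE] : exists h : {linear resk L -> resk N}, forall y, S y -> h y = f1 (r y).
  apply: linear_extension => a u v /SP[x <-] /SP[y <-].
  have -> : a *: (g x : resk L) + g y = g ((a%:A : B) *: x + y) by rewrite linearP.
  by rewrite !rg -f1_lin.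
(* [h1], the sum of the [G j], is the part of [Phi] that preserves degrees. *)
pose G j (y : L) : N := hc j (Phi (hc j y)).
have Glin j (c : k) x y : G j ((c%:A : B) *: x + y) = (c%:A : B) *: G j x + G j y.
  rewrite /G hc_lin -[RHS]hc_lin; congr (hc j _).
  exact: (linearP Phi c (hc j x : resk L) (hc j y)).
have G0 j y : j \notin hsupp y -> G j y = 0.
  move=> h; rewrite /G {2}/hc (negPf h).
  have -> : Phi (0 : resk L) = 0 by exact: linear0.
  by rewrite (hc_hom j (gm0 N j)) if_same.
pose h1 (y : L) : N := \sum_(j <- hsupp y) G j y.
have h1E u y : uniq u -> {subset hsupp y <= u} -> h1 y = \sum_(j <- u) G j y.
  move=> uu sub; rewrite /h1 (sum_extend _ (hsupp_uniq y) uu sub).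
  by apply: eq_bigr => i _; case: ifP => // /negbT/G0.
have h1_lin (c : k) x y : h1 ((c%:A : B) *: x + y) = (c%:A : B) *: h1 x + h1 y.
  pose u := undup (hsupp x ++ hsupp y ++ hsupp ((c%:A : B) *: x + y)).
  have uu : uniq u by exact: undup_uniq.
  rewrite !(@h1E u) //; try by move=> i iu; rewrite mem_undup !mem_cat iu ?orbT.
  by rewrite scaler_sumr -big_split; apply: eq_bigr => i _; exact: Glin.
have h1D x y : h1 (x + y) = h1 x + h1 y.
  by have := h1_lin 1 x y; rewrite !scale1r.
have h10 : h1 0 = 0 by apply: (@addrI _ (h1 0)); rewrite -h1D !addr0.
have h1_hom n y : gm_comp n y -> h1 y = hc n (Phi y).
  move=> yn; have sub : {subset hsupp y <= undup (n :: hsupp y)}.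
    by move=> i iy; rewrite mem_undup inE iy orbT.
  rewrite (h1E _ _ (undup_uniq _) sub).
  have nu : n \in undup (n :: hsupp y) by rewrite mem_undup inE eqxx.
  rewrite (bigD1_seq n nu (undup_uniq _)).
  rewrite {1}/G (hc_hom n yn) eqxx big1 => [|i ni]; first exact: addr0.
  rewrite /G (hc_hom i yn) (negPf ni).
  have -> : Phi (0 : resk L) = 0 by exact: linear0.
  by rewrite (hc_hom i (gm0 N i)) if_same.
have h1g x : h1 (g x) = f1 x.
  move: x; apply: gr_ind => [|x y hx hy|n x xn].
  - rewrite linear0 h10.
    by apply: (@addrI _ (f1 0)); have := f1_lin 1 0 0; rewrite !scale1r !addr0.
  - by rewrite linearD /= h1D hx hy; have := f1_lin 1 x y; rewrite !scale1r.
  - rewrite (h1_hom n) ?PhiE ?rg; last exact: gg.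
      by rewrite (hc_hom n (f1_gr _ _ xn)) eqxx.
    by apply/SP; exists x.
have Hhom j y : gm_comp j y -> cohom j (fun a : B => h1 (a *: y) : resk N).
  move=> yj; split=> [c a b|n a Ba].
    have -> : (c *: a + b) *: y = (c%:A : B) *: (a *: y) + b *: y.
      by rewrite scalerDl -[c *: a](_ : (c%:A : B) * a = _) -?scalerA // -scalerAl mul1r.
    exact: h1_lin.
  by rewrite (h1_hom (n + j)); [exact: hc_comp | exact: gm_act].
have Hin (y : L) : in_gr_sum (@cohom k B N) (fun a : B => h1 (a *: y) : resk N).
  have [s [y_ [_ yM ->]]] := gr_span (gm_grading L) y.
  have -> : (fun a : B => h1 (a *: \sum_(j <- s) y_ j) : resk N) =
            \sum_(j <- s) (fun a : B => h1 (a *: y_ j) : resk N).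
    apply/funext => a; rewrite fct_sumE scaler_sumr.
    by apply: (big_morph h1).
  apply: (in_gr_sum_sum (@cohom0 k B N) (@cohomB k B N)) => j _.
  exact: (in_gr_sum1 (@cohom0 k B N) (Hhom _ _ (yM j))).
pose h (y : L) : coind N := Sub (fun a : B => h1 (a *: y) : resk N)
  (introT (ss_predP (coind_space N) _) (Hin y)).
have hl : linear h.
  move=> b x y; apply: coind_ext => a.
  rewrite -[LHS]/(h1 (a *: (b *: x + y))) scalerDr h1D scalerA.
  by [].
exists (mklin hl); split=> [j y yj|x]; first exact: Hhom.
apply: coind_ext => a; rewrite -[LHS]/(h1 (a *: g x)) -linearZ h1g.
rewrite /f1 linearZ -[LHS]/(val (f x) (1 * a)) mul1r.
by [].
Qed.
End CoinducedInjective.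

(** * Cosyzygies and dimension shifting *)

Section Cosyzygy.
Variables (k : fieldType) (B : connGrAlg k).
Implicit Types (C : grMod B).

Definition cosyz C : grMod B := quotMod (im_hom (@coind_emb_graded k B C)).
Definition cosyz_pi C : {linear coind C -> cosyz C} := quotPi _.
Lemma cosyz_pi_ker C x : cosyz_pi C x = 0 <-> exists y, coind_emb C y = x.
Proof. exact: quotPi_ker. Qed.

Section Shift.
Variables (F : nat -> grMod B) (p : forall n, {linear F n.+1 -> F n}).
Hypothesis pg : forall n, graded_map (p n).
Hypothesis pex : forall n x, p n x = 0 <-> exists y, p n.+1 y = x.
Hypothesis Fpr : forall n, projective (F n).

(** Every cocycle on [F i.+1] with values in [C] is a coboundary: the
    vanishing of the Ext group in degree [i + 1] of the cokernel of [p 0]. *)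
Definition ext_vanish (i : nat) C : Prop := forall j (f : {linear F i.+1 -> C}),
  hdeg j f -> (forall x, f (p i.+1 x) = 0) ->
  exists2 h : {linear F i -> C}, hdeg j h & forall x, f x = h (p i x).

Let pp n x : p n (p n.+1 x) = 0. Proof. by apply/pex; exists x. Qed.
Let phd n : hdeg 0 (p n). Proof. by apply/graded_hdeg; exact: pg. Qed.

Lemma injective_vanish i C : injective_mod C -> ext_vanish i C.
Proof.
move=> Ci j f fg fc.
have ker x : p i x = 0 -> f x = 0 by move=> /pex[y <-].
by have [h hg hE] := inj_ext Ci (@pg i) fg ker; exists h.
Qed.

Variables (C I C' : grMod B) (iota : {linear C -> I}) (pi : {linear I -> C'}).
Hypotheses (iota_gr : graded_map iota) (pi_gr : graded_map pi).
Hypotheses (iota_inj : injective iota) (pi_surj : Defs.surj pi).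
Hypothesis ker_pi : forall x, pi x = 0 <-> exists y, iota y = x.
Hypothesis Iinj : injective_mod I.

Let iota0 x : iota x = 0 -> x = 0.
Proof. by move=> e; apply: iota_inj; rewrite e linear0. Qed.
Let pi_iota x : pi (iota x) = 0. Proof. by apply/ker_pi; exists x. Qed.

(** Dimension shifting along [0 -> C -> I -> C' -> 0]. *)
Lemma shift_down i : ext_vanish i.+1 C -> ext_vanish i C'.
Proof.
move=> ex j f fg fc.
have [x|g gg gE] := @proj_lift _ _ _ _ _ j pi f (@Fpr i.+1) pi_gr fg; first exact: pi_surj.
have gpg : hdeg j (g \o p i.+1) by apply: hdeg_comp (@phd _) gg _; rewrite add0r.
have [x|g' g'g g'E] := @proj_lift _ _ _ _ _ j iota (g \o p i.+1) (@Fpr i.+2) iota_gr gpg.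
  by apply/ker_pi; rewrite /= gE fc.
have [x|h' h'g h'E] := ex j g' g'g.
  by apply: iota0; rewrite g'E /= pp linear0.
have hg : hdeg j (g \- (iota \o h')).
  apply: hdegB => //; apply: (hdeg_comp (i := j) (j := 0)) => //; last by rewrite addr0.
  exact/graded_hdeg.
have [x /pex[y <-]|u ug uE] := inj_ext Iinj (@pg i) hg.
  by rewrite /= -h'E g'E subrr.
exists (pi \o u) => [|x].
  apply: (hdeg_comp (i := j) (j := 0)) => //; last by rewrite addr0.
  exact/graded_hdeg.
by rewrite /= uE /= linearB /= pi_iota subr0 gE.
Qed.

Lemma shift_up i : ext_vanish i C' -> ext_vanish i.+1 C.
Proof.
move=> ex j f fg fc.
have ig : hdeg 0 iota by exact/graded_hdeg.
have ifg : hdeg j (iota \o f) by apply: hdeg_comp fg ig _; rewrite addr0.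
have [x /pex[y <-]|g gg gE] := inj_ext Iinj (@pg i.+1) ifg; first by rewrite /= fc linear0.
have pgg : hdeg j (pi \o g).
  by apply: (hdeg_comp (i := j) (j := 0)) => //; [exact/graded_hdeg | rewrite addr0].
have [x|h hg hE] := ex j (pi \o g) pgg; first by rewrite /= gE /= pi_iota.
have [x|h' h'g h'E] := @proj_lift _ _ _ _ _ j pi h (@Fpr i) pi_gr hg; first exact: pi_surj.
have dg : hdeg j (g \- (h' \o p i)).
  by apply: hdegB => //; apply: hdeg_comp (@phd _) h'g _; rewrite add0r.
have [x|g' g'g g'E] := @proj_lift _ _ _ _ _ j iota _ (@Fpr i.+1) iota_gr dg.
  by apply/ker_pi; rewrite /= linearB /= h'E -hE subrr.
exists g' => // x; apply: iota_inj; rewrite g'E /= pp linear0 subr0 gE.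
by [].
Qed.
End Shift.

(** The [n]-th cosyzygy, in the resolution of [C] by coinduced modules. *)
Definition cosyz_n n C := iter n cosyz C.

Section ShiftN.
Variables (F : nat -> grMod B) (p : forall n, {linear F n.+1 -> F n}).
Hypothesis pg : forall n, graded_map (p n).
Hypothesis pex : forall n x, p n x = 0 <-> exists y, p n.+1 y = x.
Hypothesis Fpr : forall n, projective (F n).

Lemma cosyz_down n i C : ext_vanish p (n + i) C -> ext_vanish p i (cosyz_n n C).
Proof.
elim: n i => [|n IH] i // ex; rewrite /cosyz_n iterS.
apply: (shift_down pg pex Fpr (@coind_emb_graded k B _) (quotPi_graded _)
  (@coind_emb_inj k B _) (@quotPi_surj _ _ _ _ _) (@cosyz_pi_ker _)).
  exact: coind_injective.
by apply: IH; rewrite addnS.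
Qed.

Lemma cosyz_up n i C : ext_vanish p i (cosyz_n n C) -> ext_vanish p (n + i) C.
Proof.
elim: n i => [|n IH] i // ex; rewrite addSnnS; apply: IH; move: ex.
rewrite /cosyz_n iterS.
apply: (shift_up pg pex Fpr (@coind_emb_graded k B _) (quotPi_graded _)
  (@coind_emb_inj k B _) (@quotPi_surj _ _ _ _ _) (@cosyz_pi_ker _)).
exact: coind_injective.
Qed.
End ShiftN.
End Cosyzygy.

(** * Baer's criterion *)

Section Baer.
Variables (k : fieldType) (B : connGrAlg k) (C : grMod B).

(** [B], with its generator in degree [j]. *)
Definition cyc (j : int) : grMod B := freeMod B (fun _ : unit => j).

(** Extension of graded maps from proper graded left ideals [K] of a shift of [B]. *)
Definition baer : Prop := forall j (K : subspace (cyc j)) (f : cyc j -> C),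
  hsub K -> (forall u, K u -> mini (fun _ : unit => j) u) ->
  (forall a u v, K u -> K v -> f (a *: u + v) = a *: f u + f v) ->
  (forall n u, gm_comp n u -> K u -> gm_comp n (f u)) ->
  exists h : {linear cyc j -> C}, graded_map h /\ forall u, K u -> h u = f u.

Lemma hc_map (M N : grMod B) (f : {linear M -> N}) j x :
  graded_map f -> f (hc j x) = hc j (f x).
Proof.
move=> fg; rewrite [RHS](@hc_uniq _ _ _ (hsupp x) (fun i => f (hc i x))).
- by case: ifPn => // h; rewrite /hc (negPf h) linear0.
- exact: hsupp_uniq.
- by move=> i; apply: fg; exact: hc_comp.
- by rewrite -linear_sum -hc_sum.
Qed.
Lemma hcD (M : grMod B) j (x y : M) : hc j (x + y) = hc j x + hc j y.
Proof. by have := hc_lin j 1 x y; rewrite !scale1r. Qed.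
Lemma hc_hsub (M : grMod B) (S : subspace M) : (forall j x, S x -> S (hc j x)) -> hsub S.
Proof.
move=> h x Sx; exists (hsupp x), (fun j => hc j x); split; first exact: hsupp_uniq.
- by move=> j; split; [exact: hc_comp | exact: h].
- exact: hc_sum.
Qed.

(** A maximal graded extension of [f] is everywhere defined: otherwise [K], the
    elements of [cyc j] that multiply some homogeneous [y] outside of the domain
    into it, is a proper left ideal, and an extension of the resulting map from
    [K] allows to add [y] to the domain. *)
Lemma baer_injective : baer -> injective_mod C.
Proof.
move=> bC M N g f gg gi fg.
(* Graphs of graded extensions of [f]; the empty set is admitted below as the
   union of the empty chain. *)
pose good (A : set (N * C)) := [/\ forall x, A (g x, f x),
  forall a p q, A p -> A q -> A (a *: p.1 + q.1, a *: p.2 + q.2),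
  forall j p, A p -> A (hc j p.1, hc j p.2) &
  forall z, A (0, z) -> z = 0].
pose P A := A = set0 \/ good A.
have good0 : good [set p | exists x, p = (g x, f x)]%classic.
  split=> [x|a p q [x ->] [y ->]|j p [x ->]|z [x [e ->]]].
  - by exists x.
  - by exists (a *: x + y); rewrite !linearP.
  - by exists (hc j x); rewrite !hc_map.
  - by rewrite (gi x 0) ?linear0.
have [|A [PA Amax]] := @Zorn_bigcup (N * C)%type P.
  move=> Fs FP Ftot.
  have [[X FX [X0 X0P]]|nX] := pselect (exists2 X, Fs X & (X !=set0)%classic); last first.
    left; apply/seteqP; split=> // q [X FX Xq]; case: nX; exists X => //.
    by exists q.
  have gX Y q : Fs Y -> Y q -> good Y.
    by move=> FY Yq; case: (FP _ FY) => // Y0; rewrite Y0 in Yq.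
  right; split=> [x|a q r [Y FY Yq] [Z FZ Zr]|j q [Y FY Yq]|z [Y FY Yz]].
  - by exists X => //; have [] := gX _ _ FX X0P.
  - have [YZ|ZY] := Ftot _ _ FY FZ.
      by exists Z => //; have [_ h _ _] := gX _ _ FZ Zr; apply: h => //; exact: YZ.
    by exists Y => //; have [_ h _ _] := gX _ _ FY Yq; apply: h => //; exact: ZY.
  - by exists Y => //; have [_ _ h _] := gX _ _ FY Yq; apply: h.
  - by have [_ _ _ h] := gX _ _ FY Yz; apply: h.
have [Ag Al Ah Af] : good A.
  case: PA => // A0; exfalso; apply: (Amax [set p | exists x, p = (g x, f x)]%classic); last by right.
  rewrite A0; split=> [//|h].
  by apply: (h (g 0, f 0)); exists 0.
have A00 : A (0, 0) by have := Ag 0; rewrite !linear0.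
have Auniq y z z' : A (y, z) -> A (y, z') -> z = z'.
  move=> h h'; apply/eqP; rewrite -subr_eq0; apply/eqP/Af.
  have := Al (-1) _ _ h' h; rewrite /= !scaleN1r addNr.
  by rewrite addrC.
pose dom y := exists z, A (y, z).
have domP a u v : dom u -> dom v -> dom (a *: u + v).
  by move=> [z hz] [z' hz']; exists (a *: z + z'); exact: (Al a _ _ hz hz').
have domall y : dom y.
  move: y; apply: gr_ind => [|x y hx hy|j y yj].
  - by exists 0.
  - by have := domP 1 _ _ hx hy; rewrite scale1r.
  apply: contrapT => ny.
  pose dgj := fun _ : unit => j.
  have [lam [lamg lamU]] : exists lam : {linear cyc j -> N},
      graded_map lam /\ lam (U dgj tt) = y.
    exists (free_lin dgj (fun=> y)); split; last exact: free_linE.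
    by apply: free_lin_graded.
  have K0 : dom (lam 0) by rewrite linear0; exists 0.
  have KP a u v : dom (lam u) -> dom (lam v) -> dom (lam (a *: u + v)).
    by move=> du dv; rewrite linearP; exact: domP.
  pose K : subspace (cyc j) := @Subspace B (cyc j) (fun u => dom (lam u)) K0 KP.
  have hK : hsub K.
    apply: hc_hsub => i u [z hz]; exists (hc i z); rewrite hc_map //.
    exact: (Ah i _ hz).
  have Kmini u : K u -> mini dgj u.
    apply: (hsub_ind hK); [exact: ss0 | exact: ssD | move=> n v vn Kv []].
    have [nj|nj] := eqVneq n j; last first.
      by apply: (@eps_deg _ _ (n - j)); [exact: (cf_comp tt vn) | rewrite subr_eq0].
    have vE : v = ((eps (cf tt v))%:A : B) *: U dgj tt.
      apply: cf_eq => -[]; rewrite cfZ cfUU mulr1; apply: eps_deg0.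
      by have := cf_comp tt vn; rewrite nj subrr.
    apply/eqP; apply: contrapT => /negP e0; apply: ny.
    have := domP (((eps (cf tt v))^-1)%:A : B) _ 0 Kv (ex_intro _ 0 A00).
    have -> : lam v = ((eps (cf tt v))%:A : B) *: y by rewrite -lamU -linearZ -vE.
    rewrite addr0 scalerA -scalerAl mul1r scalerA.
    by rewrite mulVf // !scale1r.
  have /choice[fk fkP] (u : cyc j) : exists z, K u -> A (lam u, z).
    by have [[z hz]|nu] := pselect (K u); [exists z | exists 0].
  have [||h [hg hE]] := bC j K fk hK Kmini.
  - move=> a u v Ku Kv; apply: (Auniq (lam (a *: u + v))); first by apply: fkP; exact: ssP.
    by rewrite linearP; exact: (Al a _ _ (fkP _ Ku) (fkP _ Kv)).
  - move=> n u un Ku; have lu : hc n (lam u) = lam u.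
      by rewrite (hc_hom n (lamg _ _ un)) eqxx.
    have : A (lam u, hc n (fk u)) by rewrite -lu; exact: (Ah n _ (fkP _ Ku)).
    by move=> /(Auniq _ _ _ (fkP _ Ku)) ->; exact: hc_comp.
  pose A' : set (N * C) := [set q | exists p u, A p /\ q = (p.1 + lam u, p.2 + h u)]%classic.
  apply: (Amax A').
    split=> [q Aq|sub].
      by exists q, 0; rewrite !linear0 !addr0; split=> //; case: (q).
    apply: ny; exists (h (U dgj tt)); apply: sub; exists (0, 0), (U dgj tt).
    by split=> //; rewrite lamU; congr pair; exact: esym (add0r _).
  right; split=> [x|a q r [p [u [Ap ->]]] [p' [u' [Ap' ->]]]|i q [p [u [Ap ->]]]|z [p [u [Ap [e ->]]]]].
  - by exists (g x, f x), 0; rewrite !linear0 !addr0; split.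
  - exists (a *: p.1 + p'.1, a *: p.2 + p'.2), (a *: u + u'); split; first exact: Al.
    by rewrite /= !linearP /= !scalerDr; congr pair; rewrite addrACA.
  - exists (hc i p.1, hc i p.2), (hc i u); split; first exact: Ah.
    by rewrite /= !hcD (hc_map i u lamg) (hc_map i u hg).
  have Np : A (- p.1, - p.2).
    by have := Al (-1) _ _ Ap A00; rewrite /= !scaleN1r !addr0.
  have lu : lam u = - p.1 by apply/eqP; rewrite -addr_eq0 addrC; apply/eqP.
  have Ku : K u by exists (- p.2); rewrite lu.
  have := fkP _ Ku; rewrite lu -hE // => /(Auniq _ _ _ Np) <-.
  by rewrite subrr.
have /choice[H HP] := domall.
have Hl : linear H.
  move=> a x y; apply: (Auniq (a *: x + y)) => //.
  exact: (Al a _ _ (HP x) (HP y)).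
exists (mklin Hl); split=> [j y yj|x]; last exact: (Auniq (g x)).
have := Ah j _ (HP y); rewrite /= (hc_hom j yj) eqxx.
by move=> /(Auniq _ _ _ (HP y)) ->; exact: hc_comp.
Qed.
End Baer.

(** * The dimension bounds given by dual exactness *)

Section GlobalDimension.
Variables (k : fieldType) (B : connGrAlg k) (c : freeRes B) (d : nat).
Local Notation P := (fr_obj c).
Local Notation X := (fr_X c).
Local Notation D := (fr_d c).
Local Notation dgr := (@fr_dg k B c _).
Hypothesis top : forall i : int, d%:Z < i -> X i -> False.
Variable e : X d.
Hypothesis e_uniq : forall x, x = e.
Hypothesis fin : forall i, exists s : seq (X i), forall x, x \in s.
Hypothesis dex : forall i j, dual_exact c d i j.

Lemma dual_exact_fin (Y : choiceType) (dY : Y -> int) (i i0 j : int)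
  (w : {linear P i -> freeMod B dY}) :
  i = i0 + 1 -> hdeg j w -> (forall n u, w (D n i u) = 0) ->
  (i = d -> forall u, mini dY (w u)) ->
  exists2 s : {linear P i0 -> freeMod B dY}, hdeg j s & forall u, w u = s (D i i0 u).
Proof.
move=> iE wg wc wm; have [s sP] := fin i.
pose sy := flatten [seq enum_fset (msupp (w (U dgr x) : {malg B[Y]})) | x <- s].
apply: (dual_exact_free (sy := sy)) => // u y ys.
rewrite (@cf_seq _ _ _ _ (undup s) u) ?undup_uniq //; last first.
  by move=> x; rewrite mem_undup sP.
rewrite linear_sum cf_sum big1 // => x _; rewrite linearZ cfZ.
rewrite (_ : cf y (w (U dgr x)) = 0) ?mulr0 // /cf mcoeff_outdom //.
apply: contra ys => yx; apply/flattenP.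
exists (enum_fset (msupp (w (U dgr x) : {malg B[Y]}))) => //.
by apply/mapP; exists x.
Qed.

Section Syzygies.
Variables (j0 : int) (X1 : choiceType) (dg1 : X1 -> int).
Variable m1 : {linear freeMod B dg1 -> cyc B j0}.
Hypotheses (m1g : graded_map m1) (dg1_ge : forall x, j0 <= dg1 x).
Hypothesis m1_rel : forall y, m1 y = 0 -> mini dg1 y.
Hypothesis m1_mini : forall y, mini (fun _ : unit => j0) (m1 y).

Let st : mstate B j0 := MState m1g dg1_ge m1_rel.
(** The minimal free resolution of the cokernel of [m1]. *)
Definition syz_obj (n : nat) : grMod B :=
  if n is m.+1 then freeMod B (@ms_dg _ _ _ (mst st m)) else cyc B j0.
Definition syz_map (n : nat) : {linear syz_obj n.+1 -> syz_obj n} :=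
  match n with 0 => m1 | m.+1 => mc_map (mcov (mst st m)) end.
Local Notation F := syz_obj.
Local Notation p := syz_map.

Lemma syz_graded n : graded_map (p n).
Proof. by case: n => [|n]; [exact: m1g | exact: mc_gr]. Qed.
Lemma syz_exact n x : p n x = 0 <-> exists y, p n.+1 y = x.
Proof. by case: n x => [|n] x; [exact: (mc_exact (mcov st)) | exact: (mc_exact (mcov (mst st n.+1)))]. Qed.
Lemma syz_projective n : projective (F n).
Proof. by case: n => [|n]; exact: free_projective. Qed.
Let pp n x : p n (p n.+1 x) = 0. Proof. by apply/syz_exact; exists x. Qed.

Lemma syz_bounded n j (x : F n) : gm_comp j x -> j < j0 -> x = 0.
Proof.
case: n x => [|n] x xj jj.
  by apply: cf_eq => y; rewrite cf0; apply: ga_neg (cf_comp y xj); lia.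
apply: cf_eq => y; rewrite cf0; apply: ga_neg (cf_comp y xj).
by have := ms_ge y; lia.
Qed.

(** Boundaries lie in [B_(>= 1) F], as required at the top of [P]. *)
Lemma syz_dual_exact n (i i0 j : int) (w : {linear P i -> F n}) :
  i = i0 + 1 -> hdeg j w -> (forall m u, w (D m i u) = 0) ->
  (forall u, exists y, p n y = w u) ->
  exists2 s : {linear P i0 -> F n}, hdeg j s & forall u, w u = s (D i i0 u).
Proof.
case: n w => [|n] w iE wg wc wim.
  by apply: dual_exact_fin => // _ u; have [y <-] := wim u; exact: m1_mini.
apply: dual_exact_fin => // _ u; have [y yE] := wim u.
by apply: (@ms_min _ _ _ (mst st n)); rewrite -yE; apply/(mc_exact (mcov (mst st n))); exists y.
Qed.

(** By induction on [i].  If [w = s D], then [p s] is a cocycle one position lower, so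
    that [p s = s' D] with [s'] valued in boundaries, [s' = p h]; then [s - h D] is
    valued in cycles, which are boundaries. *)
Lemma syz_cobound (i : nat) (i0 j : int) (w : {linear P i -> F i}) :
  i%:Z = i0 + 1 -> hdeg j w -> (forall m u, w (D m i u) = 0) ->
  (forall u, exists y, p i y = w u) ->
  exists2 s : {linear P i0 -> F i}, hdeg j s &
    (forall u, w u = s (D i i0 u)) /\ (forall u, exists y, p i y = s u).
Proof.
elim: i i0 j w => [|i IH] i0 j w iE wg wc wim.
  have [s sg sE] := syz_dual_exact iE wg wc wim.
  exists (lin0 _ _); first exact: hdeg0.
  split=> u; last by exists 0; rewrite linear0.
  by rewrite sE [D _ _ _]fr_neg0 ?linear0 //; lia.
have {iE} i0E : i0 = i%:Z by lia.
subst i0; have iE : i.+1 = i%:Z + 1 :> int by rewrite -addn1 PoszD.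
have [s sg sE] := syz_dual_exact iE wg wc wim.
have w1g : hdeg j (p i \o s).
  by apply: (hdeg_comp (i := j) (j := 0)) => //; [exact/graded_hdeg/syz_graded | rewrite addr0].
have [m u|u|s' s'g [s'E s'im]] := IH (i%:Z - 1) j (p i \o s) (esym (subrK _ _)) w1g.
- have [mE|/eqP mE] := eqVneq m (i%:Z + 1); last by rewrite fr_shape // linear0.
  subst m; rewrite /= -PoszD addn1 in u *.
  by rewrite -sE; have [y <-] := wim u; exact: pp.
- by exists (s u).
have [h hg hE] := proj_lift (@fr_projective _ _ c (i%:Z - 1)) (@syz_graded i) s'g s'im.
exists (s \- (h \o D i (i%:Z - 1))).
  apply: hdegB => //; apply: hdeg_comp (@fr_d_hdeg _ _ c _ _) hg _.
  by rewrite add0r.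
split=> u; first by rewrite /= fr_dd linear0 subr0.
by apply/syz_exact; rewrite /= linearB /= hE -s'E subrr.
Qed.

(** Minimality of [P] makes [F] end in position [d]. Map [e] to the boundary
    [p y]: by [syz_cobound] this extends to a coboundary [s D], with [s] valued in
    boundaries. The coefficients of [D e] have positive degree, so the boundaries
    involved have a lower degree than [y] and vanish by induction. *)
Lemma syz_end (x : F d.+1) : p d x = 0.
Proof.
have H (N : nat) : forall n (y : F d.+1), n < j0 + N%:Z -> gm_comp n y -> p d y = 0.
  elim: N => [|N IH] n y nN yn.
    by apply: (@syz_bounded d n); [exact: syz_graded | rewrite addr0 in nN].
  pose w : {linear P d -> F d} := p d \o free_lin dgr (fun=> y).
  have wU x' : w (U dgr x') = p d y by congr (p d _); exact: free_linE.
  have wg : hdeg (n - dgr e) w.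
    apply: (hdeg_comp (i := n - dgr e) (j := 0)); last by rewrite addr0.
      by apply: free_hdeg => x'; rewrite (e_uniq x') addrC subrK.
    exact/graded_hdeg/syz_graded.
  have [m u|u|s sg [sE sim]] := syz_cobound (esym (subrK 1 d%:Z)) wg.
  - by rewrite (d_top top) ?lexx ?linear0.
  - by exists (free_lin dgr (fun=> y) u).
  rewrite -(wU e) sE; set De := D _ _ _.
  rewrite [De]free_sumU linear_sum big1 // => v _; rewrite linearZ.
  have av : ga_comp (dgr e - dgr v) (cf v De).
    exact: cf_comp (@fr_d_graded _ _ c d (d%:Z - 1) _ _ (U_comp B dgr e)).
  have [ev|ev] := leP (dgr e - dgr v) 0.
    have -> : cf v De = 0; last exact: scale0r.
    have [e0|e0] := ltP (dgr e - dgr v) 0; first exact: ga_neg e0 av.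
    have e00 : dgr e - dgr v = 0 by apply/eqP; rewrite eq_le ev e0.
    rewrite e00 in av; rewrite (eps_deg0 av).
    by rewrite (@fr_min _ _ c) scale0r.
  have [y' y'E] := sim (U dgr v).
  have svg := sg _ _ (U_comp B dgr v); rewrite -y'E in svg.
  have [y'' [y''g y''E]] := graded_preim (@syz_graded d) svg.
  rewrite -y'E -y''E (IH _ _ _ y''g); first exact: scaler0.
  by move: ev nN; move: (dgr v) (dgr e) => a b; lia.
move: x; apply: gr_ind => [|y z hy hz|n y yn]; first exact: linear0.
  by rewrite linearD hy hz addr0.
by apply: (H `|n - j0|.+1 n) => //; lia.
Qed.

Lemma syz_vanish C : ext_vanish p d C.
Proof.
move=> j f fg fc; exists (lin0 _ _); first exact: hdeg0.
move=> x; have /syz_exact[y <-] := syz_end x.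
by rewrite fc.
Qed.
End Syzygies.

(** Baer's criterion for [cosyz_n d C] is the vanishing of Ext^1 from cyclic
    modules to it, that is, by dimension shifting, of Ext^(d + 1) to [C]; the
    minimal resolutions of cyclic modules end in position [d]. *)
Lemma cosyz_injective (C : grMod B) : injective_mod (cosyz_n d C).
Proof.
apply: baer_injective => j0 K f hK Km fl fg.
have [X1 [dg1 [m1 [m1g dg1_ge m1K [gen rel]]]]] : exists (X1 : choiceType)
    (dg1 : X1 -> int) (m1 : {linear freeMod B dg1 -> cyc B j0}),
    [/\ graded_map m1, forall x, j0 <= dg1 x, forall y, K (m1 y) &
        (forall u, K u -> exists y, m1 y = u) /\ forall y, m1 y = 0 -> mini dg1 y].
  have [n x xn _ nj|X1 [dg1 [phi [phiP dg1_ge gen rel]]]] :=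
      @minimal_cover k B (cyc B j0) K j0 hK.
    by apply: cf_eq => y; rewrite cf0; apply: ga_neg (cf_comp y xn); lia.
  exists X1, dg1, (free_lin dg1 phi); split=> // [|y].
    by apply: free_lin_graded => x; have [] := phiP x.
  rewrite [y]free_sumU linear_sum; apply: ss_sum => x _; rewrite linearZ.
  by apply: ssZ; rewrite free_linE; have [] := phiP x.
have m1m y : mini (fun _ : unit => j0) (m1 y) by apply: Km.
have f0 : f 0 = 0.
  have := fl 1 0 0 (ss0 K) (ss0 K); rewrite !scale1r !addr0 => /eqP.
  by rewrite -subr_eq subrr eq_sym => /eqP.
have f1l : linear (f \o m1).
  by move=> a u v; rewrite /= linearP fl.
have f1g : hdeg 0 (mklin f1l).
  by apply/graded_hdeg => n u un; apply: fg => //; exact: m1g.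
have van := @syz_vanish j0 X1 dg1 m1 m1g dg1_ge rel m1m.
have ex := cosyz_down (@syz_graded j0 X1 dg1 m1 m1g dg1_ge rel)
  (@syz_exact j0 X1 dg1 m1 m1g dg1_ge rel) (@syz_projective j0 X1 dg1 m1 m1g dg1_ge rel)
  (n := d) (i := 0) (C := C).
rewrite addn0 in ex; have [|h hg hE] := ex (van C) 0 (mklin f1l) f1g.
  move=> x; have := @syz_exact j0 X1 dg1 m1 m1g dg1_ge rel 0 (syz_map m1g dg1_ge rel 1 x).
  by case=> _ h; rewrite /= (h (ex_intro _ x erefl)).
exists h; split; first exact/graded_hdeg.
by move=> u /gen[y <-]; exact: esym (hE y).
Qed.
End GlobalDimension.

(** * Finite injective and projective resolutions *)

Section InjectiveResolutions.
Variables (k : fieldType) (B : connGrAlg k).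

(** A stage of the construction of a finite injective resolution: [is_len] more
    coinduced modules, then the injective cosyzygy, then zero modules. *)
Record istate := IState {
  is_C : grMod B;
  is_len : nat;
  is_inj : injective_mod (cosyz_n is_len is_C) }.

Record istep (st : istate) := IStep {
  ip_I : grMod B;
  ip_next : istate;
  ip_emb : {linear is_C st -> ip_I};
  ip_prj : {linear ip_I -> is_C ip_next};
  ip_Iinj : injective_mod ip_I;
  ip_emb_gr : graded_map ip_emb;
  ip_prj_gr : graded_map ip_prj;
  ip_emb_inj : injective ip_emb;
  ip_prj_surj : Defs.surj ip_prj;
  ip_ker : forall x, ip_prj x = 0 <-> exists y, ip_emb y = x;
  ip_len : is_len ip_next = (is_len st).-1;
  ip_end : is_len st = 0%N -> forall x : is_C ip_next, x = 0;
  ip_zero : is_len st = 0%N -> (forall x : is_C st, x = 0) -> forall x : ip_I, x = 0 }.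

Lemma zero_injective : injective_mod (zeroMod B).
Proof.
move=> M N g f _ _ _; exists (lin0 _ _); split; first exact: lin0_graded.
by move=> x; rewrite [LHS]thinmx0 [RHS]thinmx0.
Qed.

Lemma istep_ex (st : istate) : exists _ : istep st, True.
Proof.
case: st => C [|n] inj.
  unshelve eexists (@IStep (@IState C 0 inj) C (@IState (zeroMod B) 0 zero_injective)
    idfun (lin0 _ _) inj _ _ _ _ _ _ _ _) => //.
  - by move=> x; exists 0; rewrite [LHS]thinmx0 [RHS]thinmx0.
  - by move=> x; split=> // _; exists x.
  - by move=> _ x; exact: thinmx0.
have inj' : injective_mod (cosyz_n n (cosyz C)) by rewrite -[cosyz_n _ _]/(iter n (@cosyz k B) (cosyz C)) -iterSr.
unshelve eexists (@IStep (@IState C n.+1 inj) (coind C) (@IState (cosyz C) n inj')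
   (coind_emb C) (cosyz_pi C) _ _ _ _ _ _ _ _ _) => //.
- exact: coind_injective.
- exact: coind_emb_graded.
- exact: quotPi_graded.
- exact: coind_emb_inj.
- exact: quotPi_surj.
- exact: cosyz_pi_ker.
Qed.

Definition ist_step st : istep st := projT1 (cid (istep_ex st)).
Definition ist (st : istate) n := iter n (fun st => ip_next (ist_step st)) st.

Lemma injdim_of_cosyz (C : grMod B) n : injective_mod (cosyz_n n C) -> injdim_le C n.
Proof.
move=> inj; pose s i := ist (IState inj) i; pose t i := ist_step (s i).
pose dif i : {linear ip_I (t i) -> ip_I (t i.+1)} := ip_emb (t i.+1) \o ip_prj (t i).
have emb0 i x : ip_emb (t i) x = 0 -> x = 0.
  by move=> e; apply: (@ip_emb_inj _ (t i)); rewrite e linear0.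
have difE i x : dif i x = 0 <-> exists y, ip_emb (t i) y = x.
  apply: iff_trans _ (ip_ker x); split=> [/emb0//|e].
  by rewrite /dif /= e linear0.
unshelve eexists (@InjRes k B C (fun i => ip_I (t i)) dif (ip_emb (t 0%N)) _ _ _ _ _ _).
- move=> i j x xj; apply: (@ip_emb_gr _ (t i.+1)); exact: (@ip_prj_gr _ (t i)).
- exact: (@ip_emb_gr _ (t 0%N)).
- by move=> i; exact: (@ip_Iinj _ (t i)).
- exact: (@ip_emb_inj _ (t 0%N)).
- exact: difE.
- move=> i x; apply: iff_trans (difE i.+1 x) _; split=> [[y <-]|[y <-]].
    by have [z <-] := @ip_prj_surj _ (t i) y; exists z.
  by exists (ip_prj (t i) y).
have len i : is_len (s i) = (n - i)%N.
  elim: i => [|i IH]; first by rewrite subn0.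
  by rewrite subnS -IH; exact: (ip_len (t i)).
move=> i x ni /=; apply: ip_zero; first by rewrite len; apply/eqP; rewrite subn_eq0 ltnW.
case: i ni x => // i ni _; apply: (@ip_end _ (t i)).
by rewrite len; apply/eqP; rewrite subn_eq0.
Qed.
End InjectiveResolutions.

Section ProjectiveResolutions.
Variables (k : fieldType) (B : connGrAlg k).

(** The submodule [K] of [T] has a projective resolution of length [n]. *)
Fixpoint res_le (n : nat) (T : grMod B) (K : T -> Prop) : Prop :=
  exists (Q : grMod B) (q : {linear Q -> T}),
  [/\ projective Q, graded_map q, forall x, K x <-> exists y, q y = x &
      match n with
      | 0 => forall y, q y = 0 -> y = 0
      | m.+1 => res_le m (fun y : Q => q y = 0)
      end].

(** A stage of the construction of a finite projective resolution; its length is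
    [None] when only zero modules remain. *)
Record pstate := PState {
  ps_T : grMod B;
  ps_K : ps_T -> Prop;
  ps_len : option nat;
  ps_res : match ps_len with
    | Some n => res_le n ps_K
    | None => forall x, ps_K x <-> x = 0
    end }.

Record pstep (st : pstate) := PStep {
  pp_Q : grMod B;
  pp_q : {linear pp_Q -> ps_T st};
  pp_len : option nat;
  pp_proj : projective pp_Q;
  pp_gr : graded_map pp_q;
  pp_im : forall x, ps_K x <-> exists y, pp_q y = x;
  pp_lenE : pp_len = if ps_len st is Some n.+1 then Some n else None;
  pp_zero : ps_len st = None -> forall x : pp_Q, x = 0;
  pp_res : match pp_len with
    | Some n => res_le n (fun y => pp_q y = 0)
    | None => forall x, pp_q x = 0 <-> x = 0
    end }.

Lemma pstep_ex (st : pstate) : exists _ : pstep st, True.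
Proof.
case: st => T K [[|n]|] res.
- have [Q [q [pQ gq im ker]]] := res.
  unshelve eexists (@PStep (@PState T K (Some 0%N) res) Q q None pQ gq im _ _ _) => //.
  by move=> x; split=> [/ker|->]; rewrite ?linear0.
- have [Q [q [pQ gq im ker]]] := res.
  by unshelve eexists (@PStep (@PState T K (Some n.+1) res) Q q (Some n) pQ gq im _ _ _).
unshelve eexists (@PStep (@PState T K None res) (zeroMod B) (lin0 _ _) None
  (@zero_projective k B) _ _ _ _ _) => //.
- exact: lin0_graded.
- move=> x; apply: iff_trans (res x) _.
  by split=> [->|[y <-]]; first by exists 0; rewrite linear0.
- by move=> _ x; exact: thinmx0.
- by move=> x; split=> // _; exact: thinmx0.
Qed.

Definition pst_step st : pstep st := projT1 (cid (pstep_ex st)).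
Definition pst_next st : pstate := PState (pp_res (pst_step st)).

Lemma projdim_of_res (M : grMod B) n : res_le n (fun _ : M => True) -> projdim_le M n.
Proof.
move=> res; pose s0 := @PState M (fun=> True) (Some n) res.
pose s i := iter i pst_next s0; pose t i := pst_step (s i).
pose O (i : int) : grMod B := match i with Posz m => pp_Q (t m) | Negz _ => zeroMod B end.
pose dn (m : nat) : {linear O m.+1 -> O m} := pp_q (t m.+1).
have dnE m x : dn m x = 0 <-> exists y, dn m.+1 y = x by exact: (pp_im (t m.+2)).
have ex := int_diff_exact dnE.
have lenE m : ps_len (s m) = if (m <= n)%N then Some (n - m)%N else None.
  elim: m => [|m IH]; first by rewrite leq0n subn0.
  rewrite -[LHS]/(pp_len (t m)) pp_lenE IH; case: (leqP m n) => mn; last first.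
    by rewrite leqNgt ltnW.
  by case E: (n - m)%N => [|r]; case: (leqP m.+1 n) => mn'; [lia|by []|congr Some; lia|lia].
unshelve eexists (@ProjRes k B M O (int_diff dn) (pp_q (t 0%N)) _ _ _ _ _ _ _ _).
- by apply: int_diff_graded => m; exact: pp_gr.
- exact: pp_gr.
- exact: int_diff_shape.
- by case=> // m x _; exact: thinmx0.
- by case=> m; [exact: pp_proj | exact: zero_projective].
- by move=> x; apply/(pp_im (t 0%N) x).
- move=> x; have -> : int_diff dn 1 0 = dn 0%N by exact: int_diffE.
  exact: (pp_im (t 1%N)).
- by move=> i x i0; apply: ex => //; rewrite subrK.
case=> // m x nm; apply: (@pp_zero _ (t m)); rewrite lenE.
by rewrite leqNgt; move: nm; rewrite ltz_nat => ->.
Qed.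

Lemma res_le_ext n (T : grMod B) (K K' : T -> Prop) : (forall x, K x <-> K' x) ->
  res_le n K -> res_le n K'.
Proof.
move=> KK; case: n => [|n] [Q [q [pQ gq im ker]]]; exists Q, q; split=> // x;
  by apply: iff_trans (iff_sym (KK x)) (im x).
Qed.

(** Let [K] be the image of the differential with source [F d.+1].  As a map to [K],
    this differential is a cocycle, hence extends to a retraction [h] of [F d] onto
    [K].  The kernel [Q] of [h] is projective, and replaces [F d] in a resolution of
    length [d]. *)
Lemma projdim_of_vanish (M : grMod B) (d : nat) :
  (forall N, ext_vanish (rd M) d N) -> projdim_le M d.
Proof.
move=> van; pose F n := rs_src (rs M n).
have Kim := im_hom (@rd_graded k B M d).
pose K := subMod Kim.
have rS x : im (rd M d) (rd M d x) by exists x.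
pose f : {linear F d.+1 -> K} := mklin (corestr_linear Kim rS).
have vf x : val (f x) = rd M d x by [].
have fg : hdeg 0 f by apply/graded_hdeg => j x xj; exact: rd_graded.
have [x|h hg hE] := van K 0 f fg.
  by apply: val_inj; rewrite vf raddf0; apply/rd_exact; exists x.
have hval (y : K) : h (val y) = y.
  have /ss_predP[x xE] := valP y; apply: val_inj.
  by rewrite -xE -hE vf.
have hom := kernel_hsub hg.
pose Q := subMod hom.
have vl : linear (val : Q -> F d) by move=> a x y; rewrite linearP.
have vQ (y : Q) : h (val y) = 0 by exact: (ss_predP _ _ (valP y)).
have sp u : kernel h (u - val (h u)) by rewrite /= linearB /= hval subrr.
have prQ : projective Q.
  move=> A A' g q gg sg gq.
  have sl : linear (fun u => u - val (h u) : F d).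
    move=> a u v; rewrite (linearP h).
    have -> : val (a *: h u + h v) = a *: val (h u) + val (h v) by exact: (linearP val).
    by rewrite scalerBr opprD addrACA.
  pose s : {linear F d -> Q} := mklin (corestr_linear hom (f := mklin sl) sp).
  have s_gr : graded_map s.
    move=> j x xj; apply: gmB => //.
    by have := hg j x xj; rewrite addr0.
  have [|x|l [lg lE]] := projective_lift (g := g) (f := q \o s) (@rs_projective k B M d) gg.
  - by move=> j x xj; apply: gq; exact: s_gr.
  - exact: sg.
  have lQg : graded_map (l \o mklin vl) by move=> j x xj; exact: lg.
  exists (l \o mklin vl); split=> // x; rewrite /= lE /=; congr (q _); apply: val_inj.
  have v0 : val (0 : K) = 0 by exact: (raddf0 val).
  by rewrite /= vQ v0 subr0.
have H (m i : nat) : (m + i)%N = d -> res_le m (fun x : rs_tgt (rs M i) => exists y, rs_map (rs M i) y = x).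
  elim: m i => [|m IH] i mi.
    rewrite add0n in mi; subst i.
    have ex x : rs_map (rs M d) x = 0 <-> exists y, rd M d y = x.
      exact: (cover_exact (@rs_gr k B (rs M d))).
    exists Q, (rs_map (rs M d) \o mklin vl); split=> //.
    - by move=> j x xj; apply: rs_gr.
    - move=> x; split=> [[y <-]|[y <-]]; last by exists (val y).
      exists (Sub (y - val (h y)) (introT (ss_predP (kernel h) _) (sp y))).
      rewrite /= linearB /= [X in _ - X](_ : _ = 0) ?subr0 //.
      by apply/ex; exact: (ss_predP _ _ (valP (h y))).
    move=> y yker; have [x xE] := (ex (val y)).1 yker.
    have fx0 : f x = 0 by rewrite -[f x]hval vf xE; exact: vQ.
    apply: val_inj; rewrite -[LHS]xE -vf fx0.
    by rewrite !raddf0.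
  exists (F i), (rs_map (rs M i)); split=> //.
  - exact: rs_projective.
  - exact: rs_gr.
  apply: res_le_ext (IH i.+1 _); last by rewrite addnS -addSn.
  by move=> x; apply: iff_sym; exact: (cover_exact (@rs_gr k B (rs M i))).
apply: projdim_of_res; apply: res_le_ext (H d 0%N (addn0 d)) => x.
by split=> // _; exact: raug_surj.
Qed.

Lemma gldim_of_cosyz d : (forall C : grMod B, injective_mod (cosyz_n d C)) ->
  forall M : grMod B, projdim_le M d.
Proof.
move=> inj M; apply: projdim_of_vanish => N; rewrite -[d]addn0.
apply: (cosyz_up (@rd_graded k B M) (@rd_exact k B M) (@rs_projective k B M)).
by apply: injective_vanish => //; [exact: rd_graded | exact: rd_exact].
Qed.
End ProjectiveResolutions.

(** * Lower bounds and the Ext groups of the regular module *)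

Section LowerBounds.
Variables (k : fieldType) (B : connGrAlg k).

Lemma rep0 (M N : grMod B) (P : projRes M) (i j : int) :
  @rep k B M P N i j (lin0 _ _) 0.
Proof.
have zc : is_cocycle (Q := P) (lin0 (P i) N) by move=> x.
have [x gx] := @rep_ex k B M P N i j _ (@hdeg0 _ _ _ _ _) zc.
have := rep_lcomb (-1) gx gx; rewrite scaleN1r addNr => h.
by apply: rep_ext h _ => u; rewrite /= scaler0 addr0.
Qed.

Lemma rep_cobound (M N : grMod B) (P : projRes M) (i j : int) (g : {linear P i -> N})
  (x : ExtGr i j M N) : rep g x -> x = 0 <-> exists2 u : {linear P (i - 1) -> N},
    hdeg j u & forall y, g y = u (pr_d P i (i - 1) y).
Proof.
move=> gx; apply: iff_trans (rep_eq gx (rep0 _ _ _ _)) _.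
by split=> -[u ug uE]; exists u => // y; have := uE y; rewrite subr0.
Qed.

Lemma ext_above (M N : grMod B) (P : projRes M) (i j : int) :
  (forall y : P i, y = 0) -> forall x : ExtGr i j M N, x = 0.
Proof.
move=> z x; have [g gx] := rep_surj P x; apply/(rep_cobound gx).
exists (lin0 _ _); first exact: hdeg0.
by move=> y; rewrite (z y) !linear0.
Qed.

Section FromInjectiveResolution.
Variables (F : nat -> grMod B) (p : forall n, {linear F n.+1 -> F n}).
Hypothesis pg : forall n, graded_map (p n).
Hypothesis pex : forall n x, p n x = 0 <-> exists y, p n.+1 y = x.
Hypothesis Fpr : forall n, projective (F n).
Variables (C : grMod B) (I : injRes C) (m : nat).
Hypothesis Iz : forall i (x : I i), (m < i)%N -> x = 0.

Let Zhs j : hsub (kernel (ir_d I j)).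
Proof. by apply: (@kernel_hsub _ _ _ _ _ 0); apply/graded_hdeg; exact: ir_d_graded. Qed.
Let Z j : grMod B := subMod (@Zhs j).
Let incl_lin j : linear (val : Z j -> I j).
Proof. by move=> a x y; rewrite linearP. Qed.
Let incl j : {linear Z j -> I j} := mklin (@incl_lin j).
Let incl_ker j (z : Z j) : ir_d I j (incl j z) = 0.
Proof. exact: (ss_predP _ _ (valP z)). Qed.
Let incl_im j y : ir_d I j y = 0 -> exists z, incl j z = y.
Proof. by move=> e; exists (Sub y (introT (ss_predP (kernel (ir_d I j)) _) e)). Qed.
Let dd j x : ir_d I j.+1 (ir_d I j x) = 0. Proof. by apply/ir_exact; exists x. Qed.
Let prj j : {linear I j -> Z j.+1} := mklin (corestr_linear (@Zhs j.+1) (@dd j)).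
Let prjE j x : incl j.+1 (prj j x) = ir_d I j x. Proof. by []. Qed.
Let incl_inj j : injective (incl j). Proof. exact: val_inj. Qed.

(** Dimension shifting along the sequences [Z j -> I j -> Z j.+1], from [C = Z 0]
    to [Z m = I m]. *)
Lemma injres_vanish i : (m <= i)%N -> ext_vanish p i C.
Proof.
move=> mi.
have phd n : hdeg 0 (p n) by apply/graded_hdeg; exact: pg.
have H (t j : nat) : (j + t = m)%N -> forall i, (t <= i)%N -> ext_vanish p i (Z j).
  elim: t j => [|t IH] j jt l tl.
    move=> r f fg fc.
    have fg' : hdeg r (incl j \o f) by move=> a x xa; exact: fg.
    have [x /pex[y <-]|u ug uE] := inj_ext (@ir_injective k B C I j) (@pg l) fg'.
      by transitivity (incl j 0); [congr (incl j _); exact: fc | exact: linear0].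
    have uk x : kernel (ir_d I j) (u x) by apply: Iz; rewrite -jt addn0.
    exists (mklin (corestr_linear (@Zhs j) uk)); first by move=> a x xa; exact: ug.
    by move=> x; apply: incl_inj; rewrite -[LHS]uE.
  case: l tl => // l tl.
  apply: (@shift_up k B F p pg pex Fpr (Z j) (I j) (Z j.+1) (incl j) (prj j)) => //.
  - by move=> a x xa; exact: ir_d_graded.
  - move=> z; have [x xE] := (ir_exact (incl j.+1 z)).1 (incl_ker z).
    by exists x; apply: incl_inj; rewrite prjE.
  - move=> x; split=> [e|[z <-]]; first by apply: incl_im; rewrite -prjE e linear0.
    by apply: incl_inj; rewrite prjE incl_ker linear0.
  - exact: (@ir_injective k B C I j).
  - by apply: IH => //; rewrite addSnnS.
move=> r f fg fc.
have ag : hdeg 0 (ir_aug I) by apply/graded_hdeg; exact: ir_aug_graded.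
have ak x : kernel (ir_d I 0) (ir_aug I x) by apply/ir_exact0; exists x.
pose al : {linear C -> Z 0} := mklin (corestr_linear (@Zhs 0) ak).
have alg : hdeg r (al \o f).
  by apply: (hdeg_comp (i := r) (j := 0)) => //; rewrite addr0.
have [x|h hg hE] := H m 0%N (add0n m) i mi r (al \o f) alg.
  by transitivity (al 0); [congr (al _); exact: fc | exact: linear0].
have him x : exists y, ir_aug I y = (incl 0 \o h) x by apply/ir_exact0; exact: incl_ker.
have hg' : hdeg r (incl 0 \o h) by move=> a x xa; exact: hg.
have [u ug uE] := proj_lift (@Fpr i) (@ir_aug_graded k B C I) hg' him.
exists u => // x; apply: (@ir_aug_inj k B C I); rewrite uE /= -hE.
by [].
Qed.
End FromInjectiveResolution.

(** ['rV[k]_b] is a line or zero according to [b]; this and its converse turn the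
    isomorphisms of [ext_condition] into statements about elements. *)
Lemma rv_iso (V : lmodType k) (b : bool) : (~~ b -> forall v : V, v = 0) ->
  (b -> exists2 v0 : V, v0 != 0 & forall v, exists a : k, v = a *: v0) ->
  exists phi : {linear V -> 'rV[k]_b}, bijective phi.
Proof.
case: b => [_ /(_ isT)[v0 v00 /choice[f fE]]|/(_ isT) V0 _]; last first.
  have zl : linear (fun v : V => 0 : 'rV[k]_false) by move=> a u v; rewrite scaler0 addr0.
  exists (mklin zl); exists (fun=> 0) => v; first by rewrite [RHS]V0.
  by rewrite [LHS]thinmx0 [RHS]thinmx0.
have f_uniq v a : v = a *: v0 -> f v = a.
  move=> e; apply/eqP; rewrite -subr_eq0; apply: contraNT v00 => h.
  have : (f v - a) *: v0 = 0 by rewrite scalerBl -fE -e subrr.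
  by move=> /eqP; rewrite scaler_eq0 (negPf h).
have fl : linear (fun v : V => const_mx (f v) : 'rV[k]_true).
  move=> a u v; apply/matrixP => i j; rewrite !mxE; apply: f_uniq.
  by rewrite scalerDl -scalerA -!fE.
exists (mklin fl); exists (fun r : 'rV[k]_true => r 0 0 *: v0) => [v|r] /=.
  by rewrite mxE -fE.
by apply/rowP => i; rewrite mxE (f_uniq _ _ erefl) (ord1 i).
Qed.

Lemma rv_iso_inv (V : lmodType k) (b : bool) (phi : {linear V -> 'rV[k]_b}) :
  bijective phi -> if b then exists2 v0 : V, v0 != 0 & forall v, exists a : k, v = a *: v0
                   else forall v : V, v = 0.
Proof.
case: b phi => phi [g gK Kg]; last first.
  by move=> v; apply: (can_inj gK); rewrite [LHS]thinmx0 [RHS]thinmx0.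
exists (g (const_mx 1)).
  apply/eqP => e; have := Kg (const_mx 1); rewrite e linear0 => /matrixP/(_ 0 0).
  by rewrite !mxE => /eqP; rewrite eq_sym oner_eq0.
move=> v; exists (phi v 0 0); apply: (can_inj gK); rewrite linearZ /= Kg.
by apply/rowP => i; rewrite !mxE mulr1 (ord1 i).
Qed.
End LowerBounds.

Section RegularSide.
Variables (k : fieldType) (B : connGrAlg k) (c : freeRes B) (d : nat).
Local Notation P := (fr_obj c).
Local Notation X := (fr_X c).
Local Notation D := (fr_d c).
Local Notation dgr := (@fr_dg k B c _).
Local Notation reg := (regMod B).
Local Notation triv := (trivMod B).
Hypothesis top : forall i : int, d%:Z < i -> X i -> False.
Variable e : X d.
Hypothesis e_uniq : forall x, x = e.
Hypothesis fin : forall i, exists s : seq (X i), forall x, x \in s.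
Hypothesis dex : forall i j, dual_exact c d i j.

Lemma mini_reg (Y : choiceType) (dY : Y -> int) (g : {linear freeMod B dY -> reg}) u :
  mini dY u -> eps (g u : B) = 0.
Proof.
move=> mu; rewrite [u]free_sumU linear_sum.
rewrite (@eps_sum k B) big1 // => x _.
have -> : g (cf x u *: U dY x) = (cf x u : B) * g (U dY x) by rewrite linearZ.
by rewrite epsM mu mul0r.
Qed.

Lemma cocycle_d (L : grMod B) i n (g : {linear P i -> L}) u :
  is_cocycle (Q := toRes c) g -> g (D n i u) = 0.
Proof.
move=> gc; have [nE|/eqP nE] := eqVneq n (i + 1); last by rewrite fr_shape ?linear0.
by subst n; exact: gc.
Qed.

Local Notation etop := (coefL (B := B) (@fr_dg k B c d) e).
Let top_hdeg : hdeg (- dgr e) etop.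
Proof. exact: coefL_hdeg. Qed.
Let top_cocycle : is_cocycle (Q := toRes c) (etop : {linear P d -> reg}).
Proof.
move=> u; have -> : pr_d (toRes c) (d + 1) d u = 0; last by rewrite linear0.
exact: (@d_top k B c d top (d%:Z + 1) d u (lexx _)).
Qed.

Lemma top_not_cobound (i0 : int) (h : {linear P i0 -> reg}) :
  ~ (forall u, etop u = h (D d i0 u)).
Proof.
move=> /(_ (U dgr e))/(congr1 (@eps k B)).
rewrite [RHS]mini_reg; last exact: fr_min.
by rewrite [coefL _ _ _]cfUU eps1 => /eqP; rewrite oner_eq0.
Qed.

(** Modulo coboundaries, every cocycle is a scalar multiple of the coordinate of
    [e], of degree [- dgr e]. *)
Lemma ext_condition_of_dual : ext_condition B d (dgr e).
Proof.
have zero i j (g : {linear P i -> reg}) (x : ExtGr i j triv reg) :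
    rep (P := toRes c) g x -> (i = d -> forall u, eps (g u : B) = 0) -> x = 0.
  move=> gx ge; have [gg gc _] := gx; apply/(rep_cobound gx).
  have [n u||s sg sE] := @dex i j (i - 1) g (esym (subrK _ _)) gg; last by exists s.
    exact: cocycle_d.
  exact: ge.
move=> i; have [id|id] := eqVneq i d%:Z; last first.
  have V0 j (x : ExtGr i j triv reg) : x = 0.
    have [g gx] := rep_surj (toRes c) x.
    by apply: zero gx _ => ie; rewrite ie eqxx in id.
  have iso j : exists phi : {linear ExtGr i j triv reg -> 'rV[k]_false}, bijective phi.
    by apply: rv_iso => // _; exact: V0.
  by exists (fun j => projT1 (cid (iso j))) => j; exact: projT2 (cid (iso j)).
subst i.
have iso j : exists phi : {linear ExtGr d j triv reg -> 'rV[k]_((j + dgr e)%R == 0)}, bijective phi.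
  apply: rv_iso => [je x|/eqP je].
    have [g gx] := rep_surj (toRes c) x; have [gg gc _] := gx.
    apply: zero gx _ => _ u; rewrite [u]free_sumU linear_sum eps_sum big1 // => y _.
    have -> : g (cf y u *: U dgr y) = (cf y u : B) * g (U dgr y) by rewrite linearZ.
    rewrite epsM mulrC (e_uniq y) (@eps_deg _ _ (dgr e + j)) ?mul0r //.
      exact: (gg _ _ (U_comp B dgr e)).
    by rewrite addrC.
  have jE : - dgr e = j by apply/eqP; rewrite eq_sym -addr_eq0; apply/eqP.
  have ge : hdeg j etop by rewrite -jE.
  have [v0 v0P] := @rep_ex k B triv (toRes c) reg d j etop ge top_cocycle.
  exists v0.
    apply/eqP => /(rep_cobound v0P)[u _ uE].
    exact: (top_not_cobound uE).
  move=> v; have [g gv] := rep_surj (toRes c) v; have [gg gc _] := gv.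
  have gU : ga_comp 0 (g (U dgr e) : B).
    by have := gg _ _ (U_comp B dgr e); rewrite addrC je.
  exists (eps (g (U dgr e) : B)); rewrite -[RHS]addr0.
  apply: rep_uniq gv _.
  apply: rep_ext (rep_lcomb (eps (g (U dgr e) : B)) v0P (rep0 _ _ _ _)) _.
  apply: free_eqP => y; rewrite /= addr0 (e_uniq y) cfUU [RHS](eps_deg0 gU).
  exact: mulr1.
by exists (fun j => projT1 (cid (iso j))) => j; exact: projT2 (cid (iso j)).
Qed.

(** The bound [d] is attained, as the coordinate of [e] is a nonzero element of
    Ext^d(k, B). *)
Lemma injdim_of_dual : injdim_is reg d.
Proof.
split; first by apply: injdim_of_cosyz; apply: cosyz_injective; eauto.
move=> m [I Iz]; rewrite leqNgt; apply/negP => md.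
have [i di] : exists i, d = i.+1 by case: (d) md => // i; exists i.
pose F (n : nat) := P n; pose p n : {linear F n.+1 -> F n} := D n.+1 n.
have pg n : graded_map (p n) by exact: fr_d_graded.
have pex n x : p n x = 0 <-> exists y, p n.+1 y = x.
  by apply: (fr_exact (f := c)) => //; rewrite -addn1 PoszD.
have Fpr n : projective (F n) by exact: free_projective.
have mi : (m <= i)%N by rewrite -ltnS -di.
have van := injres_vanish pg pex Fpr Iz mi.
move: e top_hdeg top_cocycle top_not_cobound; rewrite di => e' eg ec nc.
have [x|h _ hE] := van _ (coefL (B := B) (@fr_dg k B c i.+1) e') eg; last exact: (nc i h hE).
by apply: cocycle_d ec.
Qed.

(** The bound [d] is attained, as the functional dual to [e] is a nonzero element of
    Ext^d(k, k). *)
Lemma gldim_of_dual : gldim_is B d.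
Proof.
split=> [M|m all].
  by apply: gldim_of_cosyz; apply: cosyz_injective; eauto.
rewrite leqNgt; apply/negP => md.
have [Q Qz] := all triv.
have xz := ext_above (P := Q) (N := triv) (i := d) (j := - dgr e) (fun y => Qz d y _).
apply: (@hcoord_neq0 k B c d e); apply: xz.
by rewrite ltz_nat.
Qed.
End RegularSide.

(** * The dual resolution *)

Lemma eps_opp (k : fieldType) (R : connGrAlg k) (a : R) : @eps k (oppGrAlg R) a = eps a.
Proof. exact: (@eps_uniq k (oppGrAlg R) a (eps a) (epsP a)). Qed.

Section DualResolution.
Variables (k : fieldType) (R : connGrAlg k).
Local Notation B := (oppGrAlg R).
Variables (c : freeRes B) (d : nat).
Local Notation P := (fr_obj c).
Local Notation X := (fr_X c).
Local Notation D := (fr_d c).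
Local Notation dg := (@fr_dg k B c).
Hypothesis top : forall i : int, d%:Z < i -> X i -> False.
Variable e : X d.
Hypothesis e_uniq : forall x, x = e.
Hypothesis fin : forall i, exists s : seq (X i), forall x, x \in s.
Hypothesis dex : forall i j, dual_exact c d i j.
Let L := dg e.

Let en (i : int) : seq (X i) := undup (projT1 (cid (fin i))).
Let en_uniq i : uniq (en i). Proof. exact: undup_uniq. Qed.
Let en_mem i x : x \in en i. Proof. by rewrite mem_undup; case: cid. Qed.

Definition dual_X (i : int) : choiceType := X (d%:Z - i).
Definition dual_dg (i : int) (x : dual_X i) : int := L - dg x.
Local Notation P' i := (freeMod R (@dual_dg i)).

Let sumU i (u : P i) : u = \sum_(x <- en i) cf x u *: U (@dg i) x.
Proof. by apply: cf_seq => [|x]; [exact: en_uniq | rewrite [_ \in _]en_mem]. Qed.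
Let sumU' i (u : P' i) : u = \sum_(x <- en (d%:Z - i)) cf x u *: U (@dual_dg i) x.
Proof. by apply: cf_seq => [|x]; [exact: en_uniq | rewrite [_ \in _]en_mem]. Qed.

(** The matrix of [dual_d] is the transpose of that of the differential of [P]. *)
Definition dual_d (i j : int) : {linear P' i -> P' j} :=
  free_lin (@dual_dg i) (fun x : X (d%:Z - i) => \sum_(y <- en (d%:Z - j))
    (cf x (D (d%:Z - j) (d%:Z - i) (U (@dg _) y)) : R) *: U (@dual_dg j) y).

(** Elements of the dual module are functionals on [P]. *)
Let fnl i (u : P' i) : {linear P (d%:Z - i) -> regMod B} :=
  free_lin (M := regMod B) (@dg (d%:Z - i)) (fun x : X (d%:Z - i) => (cf x u : R)).
Let fnlU i (u : P' i) x : fnl u (U (@dg _) x) = cf x u.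
Proof. exact: free_linE. Qed.

Let cf_pick (B0 : connGrAlg k) i (f : X i -> B0) (dX : X i -> int) y :
  cf y (\sum_(x <- en i) f x *: @U k B0 _ dX x) = f y.
Proof.
rewrite cf_sum (bigD1_seq y) ?en_mem //= cfZ cfUU mulr1 big1 ?addr0 // => x xy.
by rewrite cfZ cfU (negPf xy) mulr0.
Qed.

Let fnlZ i (u : P' i) (a : R) x :
  fnl u ((a : B) *: U (@dg _) x) = (cf x u : R) * a :> R.
Proof. by rewrite linearZ -(fnlU u x). Qed.

Let dual_dU i j (x : X (d%:Z - i)) (y : X (d%:Z - j)) :
  cf y (dual_d i j (U (@dual_dg i) x)) = cf x (D (d%:Z - j) (d%:Z - i) (U (@dg _) y)) :> R.
Proof. by rewrite /dual_d free_linE; exact: (@cf_pick R). Qed.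

Let cf_dual i j (u : P' i) (y : X (d%:Z - j)) :
  cf y (dual_d i j u) = fnl u (D (d%:Z - j) (d%:Z - i) (U (@dg _) y)) :> R.
Proof.
rewrite {1}[u]sumU' linear_sum cf_sum [D _ _ _]sumU linear_sum.
apply: eq_bigr => x _; rewrite [RHS]fnlZ linearZ cfZ dual_dU.
by [].
Qed.

Let fnl_hdeg i n (u : P' i) : gm_comp n u -> hdeg (n - L) (fnl u).
Proof.
move=> un; apply: free_hdeg => x; have := cf_comp (x : dual_X i) un.
by rewrite /dual_dg (_ : n - (L - dg x) = dg x + (n - L)) //; lia.
Qed.

Let fnl_dual i j (u : P' i) v : fnl (dual_d i j u) v = fnl u (D (d%:Z - j) (d%:Z - i) v).
Proof.
move: v; apply: (@free_eqP k B _ _ (regMod B) (fnl (dual_d i j u))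
  (fnl u \o D (d%:Z - j) (d%:Z - i))) => y.
by rewrite fnlU; exact: cf_dual.
Qed.

Let of_fnl i (w : {linear P (d%:Z - i) -> regMod B}) : P' i :=
  \sum_(x <- en (d%:Z - i)) (w (U (@dg _) x) : R) *: U (@dual_dg i) x.
Let of_fnlE i (w : {linear P (d%:Z - i) -> regMod B}) v : fnl (of_fnl w) v = w v.
Proof. by move: v; apply: free_eqP => x; rewrite fnlU; exact: (@cf_pick R). Qed.
Let fnl_inj i (u u' : P' i) : (forall v, fnl u v = fnl u' v) -> u = u'.
Proof. by move=> h; apply: cf_eq => x; have := h (U (@dg _) x); rewrite !fnlU. Qed.

Let fnl0 i v : fnl (0 : P' i) v = 0.
Proof.
transitivity (lin0 (P (d%:Z - i)) (regMod B) v) => //; apply: free_eqP => x.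
by rewrite fnlU; exact: cf0.
Qed.

Let fnl_eps i (u : P' i) v : mini (@dg _) v -> eps (fnl u v : R) = 0.
Proof. by move=> mv; rewrite -eps_opp; exact: mini_reg. Qed.

Fact dual_min i j u : mini (@dual_dg j) (dual_d i j u).
Proof. by move=> y; rewrite cf_dual; apply: fnl_eps; exact: fr_min. Qed.

Fact dual_graded i j : graded_map (dual_d i j).
Proof.
apply: free_lin_graded => x; apply: gm_sum => y _.
have h := cf_comp x (@fr_d_graded _ _ c (d%:Z - j) (d%:Z - i) _ _ (U_comp B (@dg _) y)).
apply: (gmZ (i := dg y - dg x) (j := dual_dg (y : dual_X j))); [exact: h|exact: U_comp|].
by rewrite /dual_dg; move: (dg x) (dg y) L => a b l; lia.
Qed.

Fact dual_shape i j u : i <> j + 1 -> dual_d i j u = 0.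
Proof.
move=> ij; apply: cf_eq => y; rewrite cf_dual cf0 fr_shape ?linear0 //.
by move=> E; apply: ij; lia.
Qed.

Fact dual_neg i (x : dual_X i) : 0 <= i.
Proof. by rewrite leNgt; apply/negP => i0; apply: (top (i := d%:Z - i)) x; lia. Qed.

Let at_top i (E : i = d%:Z) : exists2 x0 : X i, (forall x : X i, x = x0) & dg x0 = L.
Proof. by subst i; exists e. Qed.
Let at_zero i (E : i = 0) : exists2 x0 : X i, (forall x : X i, x = x0) & dg x0 = 0.
Proof. by subst i; have [x0 [x0E dg0]] := fr_base c; exists x0. Qed.

Definition dual_aug : {linear P' 0 -> trivMod R} :=
  free_lin (@dual_dg 0) (fun=> tone R).
Let dual_augU x : dual_aug (U (@dual_dg 0) x) = tone R.
Proof. exact: free_linE. Qed.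

Fact dual_aug_graded : graded_map dual_aug.
Proof.
apply: free_lin_graded => x; have [x0 x0E x0d] := at_top (subr0 d%:Z).
by rewrite /dual_dg (x0E x) x0d subrr; exact: triv_deg0.
Qed.

Let im_sub i j : subspace (P' j) := @Subspace R (P' j) (fun v => exists u, dual_d i j u = v)
  (im0 (dual_d i j)) (@imP _ _ _ _ (dual_d i j)).

Fact dual_aug_surj : Defs.surj dual_aug.
Proof.
move=> q; have [x0 _ _] := at_top (subr0 d%:Z).
exists (((tau q)%:A : R) *: U (@dual_dg 0) x0); rewrite linearZ dual_augU.
exact: esym (tauE q).
Qed.

(** The elements of degree [n] of the kernel are, as functionals on [P d], the
    cocycles that [dual_exact] makes coboundaries. *)
Fact dual_exact0 u : dual_aug u = 0 <-> exists v, dual_d 1 0 v = u.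
Proof.
split=> [uk|[v <-]]; last by apply: mini_triv; exact: dual_min.
have hk : hsub (kernel dual_aug).
  by apply: (@kernel_hsub _ _ _ _ _ 0); apply/graded_hdeg; exact: dual_aug_graded.
apply: (hsub_ind (Q := im_sub 1 0) hk _ _ _ uk); [exact: ss0|exact: ssD|].
move=> n {uk}u un uk.
have mu : mini (@dual_dg 0) u.
  have [x0 x0E _] := at_top (subr0 d%:Z).
  have := congr1 (@tau k R) (uk : dual_aug u = 0); rewrite tau0.
  rewrite (@tau_free _ _ _ _ dual_aug [:: x0 : dual_X 0]) //; last first.
    by move=> x; rewrite (x0E x) inE eqxx.
  by rewrite big_seq1 dual_augU tau_one mulr1 => h x; rewrite (x0E x).
have [|||s sg sE] := @dex (d%:Z - 0) (n - L) (d%:Z - 1) (fnl u) _ (fnl_hdeg un).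
- by rewrite subr0 subrK.
- by move=> m v; rewrite (d_top top) ?linear0 ?subr0 ?lexx.
- move=> _ v; rewrite eps_opp [v]sumU linear_sum (@eps_sum k R) big1 // => x _.
  by rewrite fnlZ epsM mu mul0r.
exists (of_fnl s); apply: fnl_inj => v.
by rewrite fnl_dual of_fnlE sE.
Qed.

Fact dual_exactE i j l u : 0 < i -> i = j + 1 -> l = i + 1 ->
  dual_d i j u = 0 <-> exists v, dual_d l i v = u.
Proof.
move=> i0 ij li; split=> [uk|[v <-]]; last first.
  by apply: fnl_inj => y; rewrite !fnl_dual fr_dd linear0 fnl0.
have hk : hsub (kernel (dual_d i j)).
  by apply: (@kernel_hsub _ _ _ _ _ 0); apply/graded_hdeg; exact: dual_graded.
apply: (hsub_ind (Q := im_sub l i) hk _ _ _ uk); [exact: ss0|exact: ssD|].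
move=> n {uk}u un uk.
have [|||s sg sE] := @dex (d%:Z - i) (n - L) (d%:Z - l) (fnl u) _ (fnl_hdeg un).
- by rewrite li; lia.
- move=> m v; have [mE|/eqP mE] := eqVneq m (d%:Z - j); last first.
    by rewrite fr_shape ?linear0 // => E; apply: mE; lia.
  by subst m; rewrite -fnl_dual (uk : dual_d i j u = 0) fnl0.
- by move=> E; lia.
exists (of_fnl s); apply: fnl_inj => v.
by rewrite fnl_dual of_fnlE sE.
Qed.

Fact dual_base : exists x0 : dual_X 0, (forall x, x = x0) /\ dual_dg x0 = 0.
Proof.
have [x0 x0E x0d] := at_top (subr0 d%:Z); exists (x0 : dual_X 0); split=> //.
by rewrite /dual_dg x0d subrr.
Qed.

Definition dualRes : freeRes R := FreeRes dual_graded dual_aug_graded dual_shape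
  dual_neg dual_aug_surj dual_exact0 dual_exactE dual_min dual_base.

Let ker_im i i1 l (v : P i) : i = i1 + 1 -> l = i + 1 -> D i i1 v = 0 ->
  (i = 0 -> mini (@dg i) v) -> exists y, D l i y = v.
Proof.
move=> iE lE vk v0; have [i0|i0] := ltP i 0.
  by exists 0; rewrite linear0 [RHS]fr_neg0.
move: i0; rewrite le_eqVlt => /orP[/eqP i0|i0].
  move: iE lE v vk v0; rewrite -{i}i0 add0r => _ -> v _ v0; apply/fr_exact0.
  by apply: mini_triv; exact: v0.
exact/(fr_exact (f := c) v i0 iE lE).
Qed.

(** The dual of the dual is the original resolution, which is exact. *)
Lemma dualRes_exact i j : dual_exact dualRes d i j.
Proof.
move=> i0 w iE wg wc we.
pose v : P (d%:Z - i) := \sum_(x <- en (d%:Z - i)) (w (U (@dual_dg i) x) : B) *: U (@dg _) x.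
have cfv x : cf x v = w (U (@dual_dg i) x) by exact: (@cf_pick B).
have wU (x : X (d%:Z - i)) : ga_comp (L - dg x + j) (w (U (@dual_dg i) x) : R).
  exact: (wg _ _ (U_comp R (@dual_dg i) x)).
have vg : gm_comp (L + j) v.
  apply: gm_sum => x _; apply: (gmZ (i := L - dg x + j) (j := dg x)).
  - exact: wU.
  - exact: U_comp.
  - by move: (dg x) L => a b; lia.
have vk : D (d%:Z - i) (d%:Z - (i + 1)) v = 0.
  apply: cf_eq => z; rewrite cf0 /v linear_sum cf_sum.
  transitivity (w (dual_d (i + 1) i (U (@dual_dg (i + 1)) z)) : R); last exact: wc.
  rewrite [dual_d _ _ _]sumU' linear_sum; apply: eq_bigr => x _.
  by rewrite linearZ cfZ [RHS]linearZ dual_dU.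
have vE : d%:Z - i = d%:Z - (i + 1) + 1 by lia.
have lE : d%:Z - i0 = d%:Z - i + 1 by lia.
have [|y yE] := ker_im vE lE vk.
  move=> di x; rewrite cfv eps_opp; apply: we; lia.
have Dyg : gm_comp (L + j) (D (d%:Z - i0) (d%:Z - i) y) by rewrite yE.
have [v' [v'g]] := graded_preim (@fr_d_graded _ _ c (d%:Z - i0) (d%:Z - i)) Dyg.
rewrite {}yE => v'E.
pose s : {linear P' i0 -> regMod R} :=
  free_lin (M := regMod R) (@dual_dg i0) (fun x : X (d%:Z - i0) => (cf x v' : B)).
have sU x : s (U (@dual_dg i0) x) = cf x v' by exact: free_linE.
exists s.
  apply: free_hdeg => x; have := cf_comp (x : X (d%:Z - i0)) v'g.
  by rewrite /dual_dg (_ : L + j - dg x = L - dg x + j) //; lia.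
move=> u; move: u; apply: (@free_eqP k R _ _ (regMod R) w (s \o dual_d i i0)) => x.
rewrite -cfv -v'E [v']sumU linear_sum cf_sum.
rewrite -[RHS]/(s (dual_d i i0 (U (@dual_dg i) x))).
rewrite [dual_d _ _ _]sumU' linear_sum; apply: eq_bigr => y' _.
by rewrite linearZ cfZ [RHS]linearZ dual_dU sU.
Qed.

Lemma dualRes_top i : d%:Z < i -> dual_X i -> False.
Proof. by move=> di x; have := fr_neg (x : X (d%:Z - i)); lia. Qed.
Lemma dualRes_fin i : exists s : seq (dual_X i), forall x, x \in s.
Proof. exact: fin. Qed.
Lemma dualRes_gen : exists2 e' : fr_X dualRes d, (forall x, x = e') & fr_dg e' = L.
Proof.
have [x0 x0E x0d] := at_zero (subrr d%:Z); exists (x0 : dual_X d) => //.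
by rewrite /= /dual_dg x0d subr0.
Qed.
End DualResolution.

(** * The minimal resolution of an Artin-Schelter Gorenstein algebra *)

Section Spans.
Variables (k : fieldType).

Fixpoint span (V : lmodType k) (t : seq V) (x : V) : Prop :=
  if t is a :: t' then exists c : k, span t' (x - c *: a) else x = 0.

Lemma span_cat (V : lmodType k) (t t' : seq V) x y :
  span t x -> span t' y -> span (t ++ t') (x + y).
Proof.
elim: t x => [x -> //|a t IH x [c h] h'] /=; first by rewrite add0r.
by exists c; rewrite addrAC; exact: IH.
Qed.

Lemma span_map (V W : lmodType k) (f : V -> W) (t : seq V) x :
  (forall c u v, f (u - c *: v) = f u - c *: f v) -> span t x -> span (map f t) (f x).
Proof.
move=> fl; have f0 : f 0 = 0.
  by have := fl 1 0 0; rewrite !scale1r !subrr.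
elim: t x => [x ->|a t IH x [c h]] //=; first by exists c; rewrite -fl; exact: IH.
Qed.

Lemma span_coord (V : lmodType k) (t : seq V) x : span t x ->
  exists c : 'I_(size t) -> k, x = \sum_i c i *: tnth (in_tuple t) i.
Proof.
elim: t x => [|a t IH] x /=; first by move=> ->; exists (fun=> 0); rewrite big_ord0.
move=> [c /IH[c' e]]; exists (fun i => if unlift ord0 i is Some j then c' j else c).
rewrite big_ord_recl unlift_none.
under eq_bigr do rewrite liftK.
rewrite (tnth_nth 0) /= -[LHS](subrK (c *: a)) e addrC; congr (_ + _).
by apply: eq_bigr => i _; rewrite !(tnth_nth 0).
Qed.

Definition fspan (V : lmodType k) (Q : V -> Prop) : Prop :=
  exists t : seq V, forall x, Q x -> span t x.

Lemma fspan_sum (I : eqType) (s : seq I) (V W : lmodType k) (f : I -> V -> W)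
  (Qi : I -> V -> Prop) (Q : W -> Prop) :
  (forall i c u v, f i (u - c *: v) = f i u - c *: f i v) ->
  (forall i, i \in s -> fspan (Qi i)) ->
  (forall x, Q x -> exists y : I -> V, (forall i, i \in s -> Qi i (y i)) /\
     x = \sum_(i <- s) f i (y i)) -> fspan Q.
Proof.
move=> fl fin dec.
suff [t tP] : exists t : seq W, forall y : I -> V, (forall i, i \in s -> Qi i (y i)) ->
    span t (\sum_(i <- s) f i (y i)).
  by exists t => x /dec[y [yQ ->]]; exact: tP.
elim: s fin {dec} => [|i s IH] fin.
  by exists [::] => y _; rewrite big_nil.
have [t tP] := fin i (mem_head _ _).
have [|t' t'P] := IH; first by move=> j js; apply: fin; rewrite inE js orbT.
exists (map (f i) t ++ t') => y yQ; rewrite big_cons; apply: span_cat.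
  by apply: span_map => //; apply: tP; apply: yQ; exact: mem_head.
by apply: t'P => j js; apply: yQ; rewrite inE js orbT.
Qed.
End Spans.

Section FromGorenstein.
Variables (k : fieldType) (B : connGrAlg k) (c : freeRes B) (d : nat) (l : int).
Local Notation P := (fr_obj c).
Local Notation X := (fr_X c).
Local Notation D := (fr_d c).
Local Notation dg i := (@fr_dg k B c i).
Local Notation reg := (regMod B).
Local Notation triv := (trivMod B).
Hypothesis pd : projdim_le triv d.
Hypothesis EC : ext_condition B d l.

Lemma gor_top (i : int) : d%:Z < i -> X i -> False.
Proof.
move=> di x; have [Q Qz] := pd; apply: (@hcoord_neq0 k B c i x).
exact: (ext_above (P := Q) (N := triv) (fun y => Qz i y di)).
Qed.

Let ext0 (i j : int) : (i == d%:Z) && (j + l == 0) = false ->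
  forall x : ExtGr i j triv reg, x = 0.
Proof.
have := EC i; case: eqP => [id|_] [phi phib] /=; last first.
  by move=> _; exact: (rv_iso_inv (b := false) (phib j)).
by move=> jl; move: (phi j) (phib j); rewrite /gr_shift /gr_k jl => f; exact: rv_iso_inv.
Qed.

Let ext1 : exists2 v0 : ExtGr d (- l) triv reg, v0 != 0 &
  forall v, exists a : k, v = a *: v0.
Proof.
have := EC d; rewrite eqxx => -[phi phib].
by move: (phi (- l)) (phib (- l)); rewrite /gr_shift /gr_k addNr eqxx => f; exact: rv_iso_inv.
Qed.

Let coc (i : int) (x : X i) : d%:Z <= i -> is_cocycle (Q := toRes c) (coefL (dg i) x : {linear P i -> reg}).
Proof.
move=> di u; have -> : pr_d (toRes c) (i + 1) i u = 0; last by rewrite linear0.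
exact: (@d_top k B c d gor_top (i + 1) i u di).
Qed.

Let top_rep (x : X d) : exists v : ExtGr d (- dg d x) triv reg,
  rep (P := toRes c) (coefL (dg d) x) v.
Proof. apply: rep_ex; [exact: coefL_hdeg | exact: coc]. Qed.

(** The coordinate of [x] is a cocycle and, [P] being minimal, not a coboundary; so
    its degree is the only one in which Ext^d(k, B) is nonzero. *)
Lemma gor_deg (x : X d) : dg d x = l.
Proof.
apply/eqP; apply: contraT => xl; exfalso; have [v vP] := top_rep x.
have v0 : v = 0 by apply: ext0; rewrite eqxx /= addrC subr_eq0 eq_sym (negPf xl).
have [u _ uE] := (rep_cobound vP).1 v0.
have := congr1 (@eps k B) (uE (U (dg d) x)).
rewrite [RHS]mini_reg; last exact: fr_min.
by rewrite [coefL _ _ _]cfUU eps1 => /eqP; rewrite oner_eq0.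
Qed.

(** The classes of the coordinates of distinct generators would be linearly
    independent. *)
Lemma gor_uniq (x y : X d) : x = y.
Proof.
apply/eqP; apply: contraT => xy; exfalso.
have rp (z : X d) : exists v : ExtGr d (- l) triv reg, rep (P := toRes c) (coefL (dg d) z) v.
  by apply: rep_ex; [rewrite -(gor_deg z); exact: coefL_hdeg | exact: coc].
have [v vP] := rp x; have [w wP] := rp y.
have [v0 _ sp] := ext1; have [a va] := sp v; have [b wb] := sp w.
have key (r s : k) : r *: v + (s *: w + 0) = 0 -> r = 0 /\ s = 0.
  have hP := rep_lcomb r vP (rep_lcomb s wP (rep0 _ _ _ _)).
  move=> /(rep_cobound hP)[u _ uE].
  have ev z : eps (lcomb r (coefL (dg d) x) (lcomb s (coefL (dg d) y) (lin0 (P d) reg)) (U (dg d) z) : B) = 0.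
    by rewrite uE mini_reg //; exact: fr_min.
  split.
    have := ev x; rewrite /= addr0 !cfU eqxx (negPf xy) /= mulr0n scaler0 addr0.
    by rewrite mulr1n => <-; rewrite -[LHS](@epsA k B); congr eps; exact: esym (mulr1 _).
  have := ev y; rewrite /= addr0 !cfU eqxx (eq_sym y x) (negPf xy) /= mulr0n scaler0 add0r.
  by rewrite mulr1n => <-; rewrite -[LHS](@epsA k B); congr eps; exact: esym (mulr1 _).
have [|b0 /eqP] := key b (- a).
  by rewrite va wb addr0 !scalerA mulNr scaleNr mulrC subrr.
rewrite oppr_eq0 => /eqP a0.
have [|/eqP] := key 1 0; last by rewrite oner_eq0.
by rewrite va a0 scale0r scaler0 add0r scale0r addr0.
Qed.

Lemma gor_nonempty : exists x : X d, True.
Proof.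
have [v0 v00 _] := ext1; apply: contrapT => nx; case/eqP: v00.
have [g gv] := rep_surj (toRes c) v0; apply/(rep_cobound gv).
exists (lin0 _ _); first exact: hdeg0.
move=> y; have -> : y = 0 by apply: cf_eq => x; case: nx; exists x.
by rewrite !linear0.
Qed.

Variable e : X d.
Let e_uniq (x : X d) : x = e. Proof. exact: gor_uniq. Qed.

(** A cocycle whose class vanishes is a coboundary.  In the degree where classes
    may be nonzero, the value at [e] is a scalar, which [eps] detects. *)
Lemma gor_exact i j : dual_exact c d i j.
Proof.
move=> i0 w iE wg wc we.
have i0E : i0 = i - 1 by rewrite iE addrK.
subst i0; have wc' : is_cocycle (Q := toRes c) w by move=> u; exact: wc.
have [x xP] := @rep_ex k B triv (toRes c) reg i j w wg wc'.
have [/andP[/eqP id /eqP jl]|/negPf h] := boolP ((i == d%:Z) && (j + l == 0)); last first.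
  have [u ug uE] := (rep_cobound xP).1 (ext0 h x).
  by exists u.
exists (lin0 _ _); first exact: hdeg0.
move=> u; transitivity (lin0 (P i) reg u) => //; move: u; apply: free_eqP => y.
have yl : dg i y = l by move: y; rewrite id => y; exact: gor_deg.
have := wg _ _ (U_comp B (dg i) y); rewrite yl addrC jl => /eps_deg0 ->.
by rewrite we // scale0r.
Qed.

(** An element of positive degree, as the value at [e] of a cocycle, is the value at
    [D e] of some [s].  So [B_(>= 1)] is generated, as a right ideal, by the finitely
    many coefficients of [D e], of positive degree. *)
Lemma gor_locally_finite n : fspan (fun x : B => ga_comp n x).
Proof.
suff H (N : nat) : forall n, n < N%:Z -> fspan (fun x : B => ga_comp n x).
  by apply: (H `|n|.+1); lia.
elim: N => [|N IH] {}n nN; first by exists [::] => x xn; exact: ga_neg nN xn.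
have [n0|n0] := eqVneq n 0.
  exists [:: 1 : B] => x; rewrite n0 => xn; exists (eps x) => /=.
  by rewrite -eps_deg0 // subrr.
pose De := D d (d%:Z - 1) (U (dg d) e).
pose sv := enum_fset (msupp (De : {malg B[X (d%:Z - 1)]})).
have Dec v : ga_comp (dg d e - dg _ v) (cf v De).
  exact: cf_comp (@fr_d_graded _ _ c d (d%:Z - 1) _ _ (U_comp B (dg d) e)).
have De0 v : dg d e - dg _ v <= 0 -> cf v De = 0.
  move=> h; have := Dec v; have [h0|h0] := ltP (dg d e - dg _ v) 0.
    exact: ga_neg.
  have -> : dg d e - dg _ v = 0 by apply/eqP; rewrite eq_le h h0.
  by move=> /eps_deg0 ->; rewrite (@fr_min _ _ c) scale0r.
pose sp := [seq v <- sv | 0 < dg d e - dg _ v].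
apply: (@fspan_sum k _ sp B B (fun v a => cf v De * a)
   (fun v a => ga_comp (dg _ v + (n - dg d e)) a)).
- by move=> v a x y; rewrite mulrBr -scalerAr.
- move=> v; rewrite mem_filter => /andP[h _]; apply: IH.
  by move: h; move: (dg d e) (dg _ v) => a b; lia.
move=> x xn.
have wg : hdeg (n - dg d e) (free_lin (M := reg) (dg d) (fun=> x)).
  by apply: free_hdeg => y; rewrite (e_uniq y) addrC subrK.
have [m u|_ u|s sg sE] := gor_exact (esym (subrK 1 d%:Z)) wg.
- by rewrite (d_top gor_top) ?linear0.
- rewrite [u]free_sumU linear_sum eps_sum big1 // => y _.
  have -> : free_lin (M := reg) (dg d) (fun=> x) (cf y u *: U (dg d) y) = (cf y u : B) * x.
    by rewrite linearZ free_linE.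
  by rewrite epsM (eps_deg xn n0) mulr0.
exists (fun v => s (U (dg _) v)); split=> [v _|]; first exact: sg (U_comp B (dg _) v).
transitivity (s De : B); first by rewrite -sE free_linE.
have -> : s De = \sum_(v <- sv) s (cf v De *: U (dg _) v) :> B.
  by rewrite {1}[De]free_sumU linear_sum.
rewrite (bigID (fun v => 0 < dg d e - dg _ v)) /=.
rewrite [X in _ + X = _]big1 ?addr0 => [|v]; last first.
  by rewrite -leNgt => /De0 h; rewrite linearZ; rewrite h; exact: mul0r.
by rewrite -big_filter; apply: eq_bigr => v _; rewrite linearZ.
Qed.

Lemma gor_obj_finite i n : (exists s : seq (X i), forall x, x \in s) ->
  fspan (fun u : resk (P i) => gm_comp n (u : P i)).
Proof.
move=> [s sP].
apply: (@fspan_sum k _ (undup s) B (resk (P i)) (fun x a => (a : B) *: U (dg i) x)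
  (fun x a => ga_comp (n - dg i x) a)).
- move=> x a u v; rewrite scalerBl; congr (_ - _).
  by rewrite -[RHS]/((a%:A : B) *: (v *: U (dg i) x)) scalerA -scalerAl mul1r.
- by move=> x _; exact: gor_locally_finite.
move=> u un; exists (fun x => cf x (u : P i)); split=> [x _|]; first exact: cf_comp.
transitivity (\sum_(x <- undup s) (cf x (u : P i) : B) *: U (dg i) x : P i) => [|//].
by apply: cf_seq; [exact: undup_uniq | move=> x; rewrite mem_undup sP].
Qed.

(** The differential is injective on the [k]-span of the generators. *)
Lemma gor_degree_finite (i i0 n : int) : i = i0 + 1 -> 0 < i ->
  (exists s : seq (X i0), forall x, x \in s) ->
  exists s : seq (X i), forall x, dg i x = n -> x \in s.
Proof.
move=> iE ip fin0; have [t tP] := gor_obj_finite n fin0.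
apply: (@finite_of_bound _ _ (size t)) => s us sn.
rewrite leqNgt; apply/negP => ts.
have s0 : exists x0 : X i, x0 \in s by case: (s) ts => // x0 ? _; exists x0; rewrite inE eqxx.
have [x0 _] := s0.
pose v (r : 'I_(size t).+1) := nth x0 s r.
have vs r : v r \in s by apply: mem_nth; exact: leq_trans (ltn_ord r) ts.
have [r|a [r ar] rel] := @lin_dep k (resk (P i0)) _ (tnth (in_tuple t))
    (fun r => D i i0 (U (dg i) (v r))).
  apply: span_coord; apply: tP; rewrite -(sn _ (vs r)).
  by apply: fr_d_graded; exact: U_comp.
pose w : P i := \sum_r (a r)%:A *: U (dg i) (v r).
have w0 : D i i0 w = 0.
  rewrite /w linear_sum -[RHS]rel; apply: eq_bigr => q _; exact: linearZ.
have [y yE] := (fr_exact (f := c) w ip iE erefl).1 w0.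
have := @fr_min _ _ c (i + 1) i y (v r); rewrite yE cf_sum (bigD1 r) //= cfZ cfUU mulr1.
rewrite big1 ?addr0 => [|q qr]; first by rewrite epsA => /eqP; rewrite (negPf ar).
rewrite cfZ cfU (_ : (v q == v r) = false) ?mulr0 //; apply: contraNF qr.
by rewrite nth_uniq //; exact: leq_trans (ltn_ord _) ts.
Qed.
End FromGorenstein.

(** * Homotopies and the nondegeneracy of the pairing *)

Section Homotopies.
Variables (k : fieldType) (B : connGrAlg k) (c : freeRes B) (d : nat).
Local Notation P := (fr_obj c).
Local Notation X := (fr_X c).
Local Notation D := (fr_d c).
Local Notation dgr := (@fr_dg k B c _).
Local Notation triv := (trivMod B).
Hypothesis top : forall i, d%:Z < i -> X i -> False.
Variable e : X d.
Hypothesis e_uniq : forall x, x = e.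
Hypothesis dex : forall i j, dual_exact c d i j.

Let fin i := exists s : seq (X i), forall x, x \in s.

(** A map [y] with [D y D = 0] is, up to homotopy, a component of a chain map.  By
    induction on the target: [D y] is a cocycle, hence some [y' D], and the result
    for [y'] determines [y] up to a map into cycles.  In position 0, [y] lifts the
    functional that it induces. *)
Lemma chain_map_homotopy (b : int) (t : nat) : (forall m : nat, (m < t)%N -> fin m) ->
  forall (q q0 t0 t1 j : int) (y : {linear P q -> P t}),
  q = t%:Z + b -> q = q0 + 1 -> t%:Z = t0 + 1 -> t1 = t%:Z + 1 -> hdeg j y ->
  (forall n u, D t t0 (y (D n q u)) = 0) ->
  exists (f : {linear P b -> triv}) (F : forall n m, {linear P n -> P m})
    (s : {linear P q -> P t1}) (s' : {linear P q0 -> P t}),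
  [/\ hdeg j f, is_lift (P := toRes c) (Q := toRes c) j f F, hdeg j s &
      forall u, y u = F q t u + D t1 t (s u) + s' (D q q0 u)].
Proof.
elim: t => [|t IH] finX q q0 t0 t1 j y qE q0E tE t1E yg yc.
  have qb : q = b by rewrite qE add0r.
  move: t1E; rewrite add0r => {}t1E; subst t1.
  move: y yg yc q0E; rewrite {q qE}qb => y yg _ q0E.
  have fg : hdeg j (fr_aug c \o y).
    by apply: hdeg_comp yg (@fr_aug_hdeg k B c) _; rewrite addr0.
  have [F FL] := @lift_ex k B triv triv (toRes c) (toRes c) b j (fr_aug c \o y) fg
    (fun u => fr_triv_d (fr_aug c \o y) u).
  have Fg : hdeg j (F b 0) by move=> a u; apply: (lift_graded FL); rewrite add0r.
  have [u|s sg sE] := @proj_lift k B (P b) (P 1) (P 0) j (D 1 0) (y \- F b 0)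
      (@fr_projective _ _ c b) (@fr_d_graded _ _ c 1 0) (@hdegB _ _ _ _ _ _ _ yg Fg).
    apply/fr_exact0; rewrite [LHS]linearB; apply/eqP; rewrite subr_eq0 eq_sym.
    by apply/eqP; exact: (lift_aug FL).
  exists (fr_aug c \o y), F, s, (lin0 _ _); split=> // u.
  by rewrite sE /= addr0 addrC subrK.
have tE' : t.+1%:Z = t%:Z + 1 by rewrite -addn1 PoszD.
have t0E : t0 = t by apply: (@addIr _ 1); rewrite -tE.
move: yc; rewrite {t0 tE}t0E => yc.
have wg : hdeg j (D t.+1 t \o y).
  by apply: hdeg_comp yg (@fr_d_hdeg _ _ _ _ _) _; rewrite addr0.
have [st stP] := finX t (leqnn _).
have [||||||y' y'g y'E] := @dual_exact_free _ _ c d _ _ st q q0 j (D t.+1 t \o y); try by [].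
- by move=> _ u; exact: (@fr_min k B c t.+1 t (y u)).
- by move=> u x; rewrite stP.
have [||||n u|f [F [s [s' [fg FL sg sE]]]]] := IH _ q0 (q0 - 1) (t%:Z - 1) t.+1 j y' _ _ _ tE' y'g.
- by move=> m mt; apply: finX; exact: ltnW.
- by apply: (@addIr _ 1); rewrite -q0E qE tE' addrAC.
- by rewrite subrK.
- by rewrite subrK.
- have [nq|/eqP nq] := eqVneq n q.
    by subst n; rewrite -y'E /= fr_dd.
  have -> : D n q0 u = 0 by apply: fr_shape; rewrite -q0E.
  by rewrite !linear0.
have zim u : exists p, D t1 t.+1 p = y u - F q t.+1 u - s (D q q0 u).
  apply/(fr_exact (f := c) (j := t)) => //.
  rewrite !linearB /=; have := y'E u; rewrite /= => ->; rewrite sE fr_dd linear0 addr0.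
  have := @lift_commE _ _ _ _ (toRes c) (toRes c) _ _ _ _ _ _ _ _ u FL qE tE' q0E.
  by rewrite /= => ->; rewrite [X in X - _ - _]addrC addrK subrr.
have zg : hdeg j ((y \- F q t.+1) \- (s \o D q q0)).
  apply: hdegB; first by apply: hdegB => // a u; exact: (lift_graded FL qE).
  by apply: hdeg_comp sg _; [exact: fr_d_hdeg | rewrite add0r].
have [s2 s2g s2E] := @proj_lift k B (P q) (P t1) (P t.+1) j (D t1 t.+1)
   ((y \- F q t.+1) \- (s \o D q q0)) (@fr_projective _ _ c q) (@fr_d_graded _ _ c _ _) zg zim.
exists f, F, s2, s; split=> // u.
by rewrite s2E /= -addrA subrK addrC subrK.
Qed.

(** [chain_map_homotopy] for the map that sends [e] to [v]; at [e] the homotopy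
    terms lie in [B_(>= 1)] times the module, by minimality. *)
Lemma reach_top (a b n : int) (v : P a) : (forall m : nat, m%:Z < a -> fin m) ->
  d%:Z = a + b -> gm_comp n v ->
  exists (f : {linear P b -> triv}) (F : forall n m, {linear P n -> P m}),
  [/\ hdeg (n - dgr e) f,
      is_lift (P := toRes c) (Q := toRes c) (n - dgr e) f F &
      mini dgr (F d a (U dgr e) - v)].
Proof.
case: a v => [a|a] v finX dE vn; last first.
  exists (lin0 _ _), (fun n m => lin0 _ _); split; first exact: hdeg0.
    by split=> [p m _|u|p m u _] //=; [exact: hdeg0 | rewrite linear0 | rewrite linear0].
  have -> : v = 0 by apply: (@fr_neg0 k B c (Negz a) v).
  by rewrite /= subrr; exact: (ss0 (mini _)).
have yg : hdeg (n - dgr e) (free_lin (M := P a) (@fr_dg k B c d) (fun=> v)).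
  by apply: free_hdeg => x; rewrite (e_uniq x) addrC subrK.
have [m ma|||p u|f [F [s [s' [fg FL _ sE]]]]] :=
  chain_map_homotopy (b := b) (t := a) _ (q0 := d%:Z - 1) (t0 := a%:Z - 1)
    dE _ _ (erefl (a%:Z + 1)) yg.
- by apply: finX; rewrite ltz_nat.
- by rewrite subrK.
- by rewrite subrK.
- by have -> : D p d u = 0; [exact: (@d_top k B c d top) | rewrite !linear0].
exists f, F; split=> //.
have := sE (U dgr e); rewrite free_linE => ->.
rewrite -addrA opprD addNKr -scaleN1r; apply: ssZ; apply: ssD.
  exact: (@fr_min k B c).
by apply: mini_lin; exact: (@fr_min k B c).
Qed.

(** By [reach_top], [x] is the value at [e], modulo [B_(>= 1)], of a chain map of
    degree [dgr x - dgr e].  If this is positive, the functional that it lifts is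
    zero, since generators have nonnegative degree. *)
Lemma gens_le_top (a : int) (x : X a) : (forall m : nat, m%:Z < a -> fin m) ->
  (forall i (y : X i), 0 <= dgr y) -> dgr x <= dgr e.
Proof.
move=> finX dg_ge0; rewrite leNgt; apply/negP => xe.
have dE : d%:Z = a + (d%:Z - a) by rewrite addrC subrK.
have [f [F [fg FL Fm]]] := reach_top finX dE (U_comp B dgr x).
have f0 u : f u = 0.
  transitivity (lin0 (P (d%:Z - a)) triv u) => //; apply: free_eqP => y.
  by apply: hdeg_triv fg _; have := dg_ge0 _ y; lia.
have ZL : is_lift (P := toRes c) (Q := toRes c) (dgr x - dgr e) f (fun n m => lin0 (P n) (P m)).
  split=> [n m _|u|n m u _] /=; first exact: (@hdeg0 _ _ (P n) (P m) (dgr x - dgr e)).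
    by rewrite linear0 f0.
  by rewrite linear0.
have [s _ sE] := lift_uniq FL ZL (@tcoord_hdeg k B _ (@fr_dg k B c a) x)
  (fun u => fr_triv_d (tcoord dgr x) u) dE.
have := Fm x; rewrite cfB cfUU epsB eps1 -tau_tcoord.
have -> : tcoord dgr x (F d a (U dgr e)) = 0.
  have := sE (U dgr e); rewrite [X in _ - X](_ : _ = 0) ?subr0; last exact: linear0.
  by move=> ->; exact: fr_triv_d.
by rewrite tau0 sub0r => /eqP; rewrite oppr_eq0 oner_eq0.
Qed.

Section AllFinite.
Hypothesis finX : forall i, fin i.

Lemma pairing_surj_of_dual : pairing_surj e.
Proof. by move=> a b n v; apply: reach_top. Qed.

(** The null homotopy of [F], one component at a time from position [a] down to 0.
    The corrected map [F - D h] is a cocycle, hence some [s D], and [s] is the next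
    component. *)
Lemma null_homotopy (b a j : int) (f : {linear P b -> triv})
  (F : forall n m, {linear P n -> P m}) : d%:Z = a + b -> hdeg j f ->
  is_lift (P := toRes c) (Q := toRes c) j f F -> mini dgr (F d a (U dgr e)) ->
  forall (N : nat) (t t1 q : int), a = t + N%:Z -> t1 = t + 1 -> q = t + b -> 0 <= t ->
  exists2 h : {linear P q -> P t1}, hdeg j h &
    (forall n u, F q t (D n q u) = D t1 t (h (D n q u))) /\
    (q = d -> forall u, mini dgr (F q t u - D t1 t (h u))).
Proof.
move=> dE fg FL Fm; elim=> [|N IH] t t1 q aE t1E qE t0.
  have {aE} aE : a = t by rewrite aE addr0.
  have qd : q = d by rewrite qE -aE.
  move: qE Fm; rewrite {q}qd {a}aE in dE *  => _ Fm.
  exists (lin0 _ _); first exact: hdeg0.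
  split=> [n u|_ u].
    have -> : D n d u = 0 by exact: (@d_top k B c d top).
    by rewrite !linear0.
  rewrite (linear0 (D t1 t)) subr0; apply: mini_linU => x.
  by rewrite (e_uniq x).
have [||||h hg [hc hm]] := IH t1 (t1 + 1) (q + 1); try lia.
have wg : hdeg j (F (q + 1) t1 \- (D (t1 + 1) t1 \o h)).
  apply: hdegB; first by move=> i u; apply: (lift_graded FL); rewrite qE t1E addrAC.
  by apply: hdeg_comp hg (@fr_d_hdeg _ _ _ _ _) _; rewrite addr0.
have [st stP] := finX t1.
have [||||s sg sE] := @dual_exact_free _ _ c d _ _ st (q + 1) q j
  (F (q + 1) t1 \- (D (t1 + 1) t1 \o h)) _ erefl wg; try by [].
- by move=> n u; rewrite /= hc subrr.
- by move=> u y /negP[]; exact: stP.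
exists s => //; split=> [n u|qd]; last lia.
have [nq|/eqP nq] := eqVneq n (q + 1); last first.
  have -> : D n q u = 0 by apply: fr_shape.
  by rewrite !linear0.
subst n; rewrite -sE /= linearB /= fr_dd subr0.
have qE' : q + 1 = t1 + b by lia.
by have := @lift_commE _ _ _ _ (toRes c) (toRes c) _ _ _ _ _ _ _ _ u FL qE' t1E erefl.
Qed.

(** In position 0 the null homotopy shows that [F] takes its values in
    [B_(>= 1)] times the module, where the augmentation vanishes. *)
Lemma pairing_inj_of_dual : pairing_inj e.
Proof.
move=> b a j f F dE fg FL Fm u.
have [a0|a0] := ltP a 0.
  by rewrite (@above_top k B c d top b u) ?linear0 //; lia.
have [||||h hg [hc hm]] := null_homotopy dE fg FL Fm (N := `|a|) (t := 0) (t1 := 1) (q := b); try lia.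
have wg : hdeg j (F b 0 \- (D 1 0 \o h)).
  apply: hdegB; first by move=> i v; apply: (lift_graded FL); rewrite add0r.
  by apply: hdeg_comp hg (@fr_d_hdeg _ _ _ _ _) _; rewrite addr0.
have [st stP] := finX 0.
have [||||||s sg sE] := @dual_exact_free _ _ c d _ _ st b (b - 1) j
  (F b 0 \- (D 1 0 \o h)); try by [].
- by rewrite subrK.
- by move=> n v; rewrite /= hc subrr.
- by move=> v y /negP[]; exact: stP.
rewrite -(lift_aug FL u); apply: mini_triv.
rewrite -[F b 0 u](subrK (D 1 0 (h u))); apply: ssD; last exact: (@fr_min k B c).
have := sE u; rewrite /= => ->; apply: mini_lin; exact: (@fr_min k B c).
Qed.
End AllFinite.
End Homotopies.

(** By induction on [i]: the generators of [P i] have degrees between 0 and that of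
    [e], and finitely many of them have a given degree. *)
Lemma gor_finite (k : fieldType) (B : connGrAlg k) (c : freeRes B) (d : nat) (l : int) :
  (forall i (x : fr_X c i), 0 <= fr_dg x) -> projdim_le (trivMod B) d ->
  ext_condition B d l -> forall i, exists s : seq (fr_X c i), forall x, x \in s.
Proof.
move=> dg_ge0 pd EC.
have [e _] := gor_nonempty c EC.
have top := @gor_top k B c d pd.
have e_uniq x : x = e by exact: (gor_uniq pd EC x e).
have dex := gor_exact pd EC.
suff H (n : nat) : forall m : nat, (m <= n)%N -> exists s : seq (fr_X c m), forall x, x \in s.
  by case=> [m|m]; [exact: (H m) | exists [::] => x; have := fr_neg x].
elim: n => [|n IH] m mn.
  have -> : m = 0%N by lia.
  by have [x0 [x0E _]] := fr_base c; exists [:: x0] => x; rewrite inE (x0E x).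
have [mn'|nm] := leqP m n; first exact: IH.
have {mn nm} -> : m = n.+1 by lia.
have finX (p : nat) : p%:Z < n.+1%:Z -> exists s : seq (fr_X c p), forall x, x \in s.
  by move=> pn; apply: IH; lia.
have iE : n.+1%:Z = n%:Z + 1 by rewrite -addn1 PoszD.
have /choice[s sP] := fun j => gor_degree_finite pd EC e j iE isT (IH n (leqnn n)).
exists (flatten [seq s r%:Z | r <- iota 0 `|fr_dg e|.+1]) => x.
apply/flattenP; exists (s (fr_dg x)); last exact: sP.
have := @gens_le_top _ _ _ _ top _ e_uniq (dex c) _ x finX dg_ge0; have := dg_ge0 _ x.
have := dg_ge0 _ e; move: (fr_dg x) (fr_dg e) => a b b0 a0 ab.
apply/mapP; exists `|a|%N; first by rewrite mem_iota; lia.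
by rewrite gez0_abs.
Qed.

(** * Frobenius forms *)

(** Duality of finite-dimensional spaces is symmetric: the element of [V] that
    represents [psi] has as coordinates the values of [psi] on the elements of [W]
    representing the coordinate functions of [V]. *)
Lemma perfect_pairing (k : fieldType) (V W : lmodType k) (beta : V -> W -> k)
  (I : Type) (s : seq I) (w : I -> V) (co : I -> {linear V -> k^o}) :
  (forall a y y' x, beta (a *: y + y') x = a * beta y x + beta y' x) ->
  (forall a y x x', beta y (a *: x + x') = a * beta y x + beta y x') ->
  (forall y, y = \sum_(i <- s) co i y *: w i) ->
  (forall x, (forall y, beta y x = 0) -> x = 0) ->
  (forall psi : {linear V -> k^o}, exists x, forall y, psi y = beta y x) ->
  (forall y, (forall x, beta y x = 0) -> y = 0) /\
  (forall psi : {linear W -> k^o}, exists y, forall x, psi x = beta y x).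
Proof.
move=> bl br span inj surj; split=> [y y0|psi].
  rewrite [y]span big1 // => i _; have [x xE] := surj (co i).
  by rewrite xE y0; exact: scale0r.
have /choice[x xE] i := surj (co i).
have b0l z : beta 0 z = 0 by have := bl (- 1) 0 0 z; rewrite scaler0 addr0 mulN1r addNr.
have b0r y : beta y 0 = 0 by have := br (- 1) y 0 0; rewrite scaler0 addr0 mulN1r addNr.
have bsl (a : I -> k) (v : I -> V) z :
    beta (\sum_(i <- s) a i *: v i) z = \sum_(i <- s) a i * beta (v i) z.
  by elim: (s) => [|i r IH]; rewrite ?big_nil ?b0l // !big_cons bl IH.
have bsr y (a : I -> k) (v : I -> W) :
    beta y (\sum_(i <- s) a i *: v i) = \sum_(i <- s) a i * beta y (v i).
  by elim: (s) => [|i r IH]; rewrite ?big_nil ?b0r // !big_cons br IH.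
exists (\sum_(i <- s) psi (x i) *: w i) => z; rewrite bsl.
have zE : z = \sum_(i <- s) beta (w i) z *: x i.
  apply/eqP; rewrite -subr_eq0 addrC -scaleN1r; apply/eqP/inj => y.
  rewrite br mulN1r [y in beta y z]span bsl bsr addrC; apply/eqP; rewrite subr_eq0.
  by apply/eqP/eq_bigr => i _; rewrite xE mulrC.
rewrite {1}zE linear_sum; apply: eq_bigr => i _; rewrite linearZ; exact: mulrC.
Qed.

Lemma bij_of_inj_surj (S T : Type) (f : S -> T) :
  injective f -> (forall y, exists x, f x = y) -> bijective f.
Proof.
move=> fi /choice[g gP]; exists g => [x|y]; last exact: gP.
by apply: fi; rewrite gP.
Qed.

Section FrobeniusForm.
Variables (k : fieldType) (H : bigrAlg k) (d dd : int) (t : {linear H d dd -> k^o}).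

Definition form a ja b jb (e : d = a + b) (e' : dd = ja + jb) (y : H a ja) (x : H b jb) : k :=
  t (bg_mul e e' y x).

Lemma form_linl a ja b jb (e : d = a + b) (e' : dd = ja + jb) x :
  linear (fun y : H a ja => form e e' y (x : H b jb) : k^o).
Proof. by move=> s y y'; rewrite /form bg_mulDl linearP. Qed.
Lemma form_linr a ja b jb (e : d = a + b) (e' : dd = ja + jb) y :
  linear (fun x : H b jb => form e e' (y : H a ja) x : k^o).
Proof. by move=> s x x'; rewrite /form bg_mulDr linearP. Qed.

(** The isomorphisms of left and right modules are the two curried versions of the
    form, linear because the product is associative. *)
Lemma Frobenius_of_form : bg_findim H ->
  (forall a ja b jb (e : d = a + b) (e' : dd = ja + jb),
    [/\ forall x : H b jb, (forall y : H a ja, form e e' y x = 0) -> x = 0,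
        forall psi : {linear H a ja -> k^o}, exists x : H b jb, forall y, psi y = form e e' y x,
        forall y : H a ja, (forall x : H b jb, form e e' y x = 0) -> y = 0 &
        forall psi : {linear H b jb -> k^o}, exists y : H a ja, forall x, psi x = form e e' y x]) ->
  Frobenius H.
Proof.
move=> fin perf; split=> //; exists d, dd.
have el (i d' : int) : d' = - i + (i + d') by rewrite addKr.
have er (i d' : int) : d' = i + d' + - i by rewrite addrAC subrr add0r.
split.
  exists (fun i j x => mklin (form_linl (el i d) (el j dd) x)); split; last first.
    by move=> a b i j h x y ei ej ei' ej'; rewrite /= /form; congr (t _); symmetry; exact: bg_mulA.
  split=> [i j s x x' y|i j]; first exact: (form_linr (el i d) (el j dd) y).
  have [inj surj _ _] := perf _ _ _ _ (el i d) (el j dd).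
  apply: bij_of_inj_surj => [x x' xx|psi].
    suff h : -1 *: x + x' = 0 by rewrite -[LHS]addr0 -h scaleN1r addNKr.
    apply: inj => y.
    have := congr1 (fun f : {linear _ -> k^o} => f y) xx; rewrite /= => yE.
    by rewrite [LHS](form_linr (el i d) (el j dd) y) yE scaleN1r addNr.
  by have [x xE] := surj psi; exists x; apply: linear_funext => y; rewrite xE.
exists (fun i j x => mklin (form_linr (er i d) (er j dd) x)); split; last first.
  by move=> a b i j h x y ei ej ei' ej'; rewrite /= /form; congr (t _); exact: bg_mulA.
split=> [i j s x x' y|i j]; first exact: (form_linl (er i d) (er j dd) y).
have [_ _ inj surj] := perf _ _ _ _ (er i d) (er j dd).
apply: bij_of_inj_surj => [x x' xx|psi].
  suff h : -1 *: x + x' = 0 by rewrite -[LHS]addr0 -h scaleN1r addNKr.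
    apply: inj => y.
  have := congr1 (fun f : {linear _ -> k^o} => f y) xx; rewrite /= => yE.
  by rewrite [LHS](form_linl (er i d) (er j dd) y) yE scaleN1r addNr.
by have [x xE] := surj psi; exists x; apply: linear_funext => y; rewrite xE.
Qed.
End FrobeniusForm.

Section FrobeniusFromPairing.
Variables (k : fieldType) (B : connGrAlg k) (c : freeRes B) (d : nat).
Local Notation P := (fr_obj c).
Local Notation X := (fr_X c).
Local Notation D := (fr_d c).
Local Notation dgr := (@fr_dg k B c _).
Local Notation triv := (trivMod B).
Local Notation H := (ExtAlg triv).
Hypothesis top : forall i, d%:Z < i -> X i -> False.
Variable e : X d.
Hypothesis fin : forall i, exists s : seq (X i), forall x, x \in s.
Hypothesis pinj : pairing_inj e.
Hypothesis psurj : pairing_surj e.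

Lemma hval_inj i j (x y : H i j) :
  (forall z, hval j (U (@fr_dg k B c i) z) x = hval j (U dgr z) y) -> x = y.
Proof.
move=> h; apply/(hrep_eq (hfunP (c := c) x) (hfunP y)) => u.
by apply: free_eqP => z; apply: tau_eq; exact: h.
Qed.

(** The basis of [H i j] dual to the generators of degree [- j]; generators of other
    degrees are assigned zero. *)
Lemma hbasis i j : exists (s : seq (X i)) (w : X i -> H i j), uniq s /\
  [/\ forall z, dgr z = - j -> hrep (tcoord dgr z) (w z), forall z, dgr z != - j -> w z = 0 &
      forall x, x = \sum_(z <- s) hval j (U dgr z) x *: w z].
Proof.
have [s0 sP] := fin i; exists (undup s0).
have /choice[w wP] z : exists w : H i j,
    (dgr z = - j -> hrep (tcoord dgr z) w) /\ (dgr z != - j -> w = 0).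
  have [zj|zj] := eqVneq (dgr z) (- j); last by exists 0; split=> // e'; rewrite e' eqxx in zj.
  have tg : hdeg j (tcoord (B := B) (@fr_dg k B c i) z).
    by apply: hdeg_eq (@tcoord_hdeg _ _ _ _ _) _; rewrite zj opprK.
  by have [w wP] := hrep_ex tg; exists w.
exists w; split; first exact: undup_uniq.
split=> [z|z|x]; [exact: (wP z).1 | exact: (wP z).2 |].
have h0 (z : X i) : dgr z != - j -> hval j (U dgr z) x = 0.
  move=> zj; rewrite hvalE (hdeg_triv (hrep_hdeg (hfunP x))) ?tau0 //.
  by rewrite addr_eq0.
apply: hval_inj => z; rewrite linear_sum (bigD1_seq z) ?undup_uniq ?mem_undup //.
rewrite big1 => [|z' zz'].
  rewrite [RHS]addr0.
  have [zj|zj] := eqVneq (dgr z) (- j); last by rewrite h0 // scale0r linear0.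
  by rewrite hvalZ (hfunE _ ((wP z).1 zj)) tau_tcoord cfUU eps1 mulr1.
have [zj|zj] := eqVneq (dgr z') (- j); last by rewrite h0 // scale0r linear0.
rewrite hvalZ (hfunE _ ((wP z').1 zj)) tau_tcoord cfU eq_sym (negPf zz') eps0.
exact: mulr0.
Qed.

Lemma ext_findim : bg_findim H.
Proof.
split=> [i j|].
  have [s [w [_ [_ _ sp]]]] := hbasis i j.
  exists (size s), (fun r => w (tnth (in_tuple s) r)) => x.
  exists (fun r => hval j (U dgr (tnth (in_tuple s) r)) x).
  by rewrite {1}[x]sp big_tnth.
have [n nP] : exists n : nat, forall i (x : X i), (`|dgr x| <= n)%N.
  pose s i := projT1 (cid (fin i)); have sP i x : x \in s i := projT2 (cid (fin i)) x.
  exists (\sum_(i < d.+1) \sum_(x <- s i%:Z) `|dgr x|)%N => i x.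
  have [i' ?] : exists i' : nat, i = i'%:Z by exists `|i|%N; have := fr_neg x; lia.
  subst i; have id : (i' < d.+1)%N by rewrite ltnS leqNgt; apply/negP => h; apply: (top (i := i')) x; lia.
  rewrite (bigD1 (Ordinal id)) //= (big_rem x) ?sP //=.
  by rewrite -addnA leq_addr.
exists (n + d)%N => i j x h; apply: contrapT => /(hom_neq0 c)[y yj].
have := nP i y; rewrite yj; have := fr_neg y.
have [di|di] := ltP d%:Z i; first by case: (top di y).
by lia.
Qed.

Let t : {linear H d (- dgr e) -> k^o} := hval (- dgr e) (U dgr e).

Lemma form_val a ja b jb (ea : d%:Z = a + b) (ej : - dgr e = ja + jb) (y : H a ja) (x : H b jb)
  g f F : hrep g y -> hrep f x -> is_lift (P := toRes c) (Q := toRes c) jb f F ->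
  form t ea ej y x = tau (g (F d a (U dgr e))).
Proof. by move=> gy fx FL; rewrite /form hvalE (hfunE _ (hrep_mul ea ej gy fx FL)). Qed.

Lemma form_perfect a ja b jb (ea : d%:Z = a + b) (ej : - dgr e = ja + jb) :
  [/\ forall x : H b jb, (forall y : H a ja, form t ea ej y x = 0) -> x = 0,
      forall psi : {linear H a ja -> k^o}, exists x : H b jb, forall y, psi y = form t ea ej y x,
      forall y : H a ja, (forall x : H b jb, form t ea ej y x = 0) -> y = 0 &
      forall psi : {linear H b jb -> k^o}, exists y : H a ja, forall x, psi x = form t ea ej y x].
Proof.
have [s [w [us [wP w0 sp]]]] := hbasis a ja.
have inj (x : H b jb) : (forall y : H a ja, form t ea ej y x = 0) -> x = 0.
  move=> x0; have fx := hfunP (c := c) x; have [F FL] := hrep_lift fx.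
  apply/(hrep_eq0 fx); apply: (pinj ea (hrep_hdeg fx) FL) => z.
  rewrite -tau_tcoord; have [zj|zj] := eqVneq (dgr z) (- ja).
    by rewrite -(form_val ea ej (wP z zj) fx FL) x0.
  have Fg := lift_graded FL ea (U_comp B dgr e).
  apply: triv_deg (@tcoord_hdeg k B _ (@fr_dg k B c a) z _ _ Fg) _.
  by move: zj; apply: contraNneq; move: (dgr z) (dgr e) (ej) => p q; lia.
have surj (psi : {linear H a ja -> k^o}) : exists x : H b jb, forall y, psi y = form t ea ej y x.
  pose v : P a := \sum_(z <- s) ((psi (w z))%:A : B) *: U dgr z.
  have vg : gm_comp (- ja) v.
    apply: gm_sum => z _; have [zj|zj] := eqVneq (dgr z) (- ja); last first.
      by rewrite w0 // linear0 !scale0r; exact: gm0.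
    apply: (gmZ (i := 0) (j := - ja)); last by rewrite add0r.
      by apply/ga_conn; exists (psi (w z)).
    by rewrite -zj; exact: U_comp.
  have [f [F [fg FL Fm]]] := psurj ea vg.
  have jE : - ja - dgr e = jb by rewrite ej addKr.
  rewrite jE in fg FL; have [x xP] := hrep_ex fg; exists x => y.
  rewrite (form_val ea ej (hfunP y) xP FL).
  have -> : tau (hfun y (F d a (U dgr e))) = tau (hfun y v).
    by apply/eqP; rewrite -subr_eq0 -tauB -linearB mini_triv // tau0.
  rewrite [in LHS](sp y) /v !linear_sum tau_sum; apply: eq_bigr => z _.
  by rewrite !linearZ tauZ epsA; exact: mulrC.
have [N2 S2] := perfect_pairing (beta := @form k H d (- dgr e) t a ja b jb ea ej) (s := s) (w := w)
  (co := fun z => hval ja (U dgr z)) (fun a y y' x => form_linl t ea ej x a y y')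
  (fun a y x x' => form_linr t ea ej y a x x') sp inj surj.
by split.
Qed.

Lemma Frobenius_of_pairing : Frobenius H.
Proof. exact: Frobenius_of_form ext_findim form_perfect. Qed.
End FrobeniusFromPairing.

(** * The equivalence *)

(** Both sides at once: the dual resolution inherits the hypotheses, with the same
    degree of its last generator. *)
Lemma ASregular_of_dual (k : fieldType) (R : connGrAlg k) (c : freeRes (oppGrAlg R))
    (d : nat) (e : fr_X c d) :
  (forall i : int, d%:Z < i -> fr_X c i -> False) -> (forall x, x = e) ->
  (forall i, exists s : seq (fr_X c i), forall x, x \in s) ->
  (forall i j, dual_exact c d i j) -> ASregular R.
Proof.
move=> top e_uniq fin dex.
pose c' := dualRes top e_uniq fin dex.
have top' (i : int) : d%:Z < i -> fr_X c' i -> False := @dualRes_top k R c d e i.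
have fin' : forall i, exists s : seq (fr_X c' i), forall x, x \in s := dualRes_fin d fin.
have dex' i j : dual_exact c' d i j := @dualRes_exact k R c d top e e_uniq fin dex i j.
have [e' e'_uniq e'E] := dualRes_gen top e_uniq fin dex.
exists d; split; last first.
  by split; [exact: (gldim_of_dual top e_uniq fin dex) |
             exact: (gldim_of_dual top' e'_uniq fin' dex')].
split.
  by split; [exact: (injdim_of_dual top e_uniq fin dex) |
             exact: (injdim_of_dual top' e'_uniq fin' dex')].
exists (fr_dg e); split; first exact: (ext_condition_of_dual top e_uniq dex).
by rewrite -e'E; exact: (ext_condition_of_dual top' e'_uniq dex').
Qed.

Theorem corollaryD (k : fieldType) (R : connGrAlg k) :
  ASregular R <-> Frobenius (ExtAlg (trivMod (oppGrAlg R))).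
Proof.
have [c c0] := minimal_resolution (oppGrAlg R).
split=> [[d [[_ [l [EC _]]] [[pd _] _]]]|[HF [l [dd [[phi [phiI phiL]] _]]]]].
  have [e _] := gor_nonempty c EC.
  have top := @gor_top k _ c d (pd _).
  have e_uniq x : x = e by exact: (gor_uniq (pd _) EC x e).
  have dex := @gor_exact k _ c d l (pd _) EC.
  have fin := gor_finite c0 (pd _) EC.
  exact: (Frobenius_of_pairing top fin (pairing_inj_of_dual top e_uniq dex fin)
    (pairing_surj_of_dual top e_uniq dex fin)).
have fin := gens_finite c HF.
have [e _] := @frob_nonempty k _ c l dd phi phiI.
have top i := @frob_top k _ c l dd phi phiI i.
have e_uniq x : x = e := @frob_uniq k _ c l dd phi phiI x e.
have pinj : pairing_inj e := @frob_inj k _ c l dd phi phiI phiL e.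
have psurj : pairing_surj e := @frob_surj k _ c l dd phi phiI phiL e.
have dex i j := @dual_exact_of_pairing k _ c (0 + l) top e e_uniq fin pinj psurj i j.
have [d dE] : exists d : nat, 0 + l = d%:Z by exists `|(0 + l)%R|%N; rewrite gez0_abs // (fr_neg e).
move: e e_uniq pinj psurj dex top; rewrite dE => e e_uniq _ _ dex top.
exact: ASregular_of_dual top e_uniq fin dex.
Qed.
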